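(* Let $0<p<\infty$, $\alpha>-1$, $a\in\mathbb{D}$ and let $N$ be a positive integer. If $f\in A^p_\alpha$ satisfies $f(a)=f'(a)=\dots=f^{(N-1)}(a)=0$, then $f/\varphi_a^N$ (extended analytically to $z=a$) belongs to $A^p_\alpha$ and $$\left\|\frac{f}{\varphi_a^N}\right\|_{p,\alpha}\le\left(\frac{\Gamma\left(\frac{Np}{2}+2+\alpha\right)}{\Gamma(2+\alpha)\,\Gamma\left(\frac{Np}{2}+1\right)}\right)^{1/p}\|f\|_{p,\alpha},$$ and the inequality is sharp (equality is attained by a nonzero function in $A^p_\alpha$ with such a zero at $a$). In particular, for the unweighted Bergman space $A^p=A^p_0$ and $N=1$: if $f\in A^p$ and $f(a)=0$, then $$\left\|\frac{f}{\varphi_a}\right\|_{p}\le\left(\frac{p+2}{2}\right)^{1/p}\|f\|_p.$$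
   Context: $\mathbb{D}$ is the unit disk and $dA(z)=\pi^{-1}\,dx\,dy$ the normalized area measure on $\mathbb{D}$. For $\alpha>-1$ and $0<p<\infty$, $A^p_\alpha$ is the space of analytic functions $f$ on $\mathbb{D}$ with $$\|f\|_{p,\alpha}=\left(\int_{\mathbb{D}}|f(z)|^p(\alpha+1)(1-|z|^2)^\alpha\,dA(z)\right)^{1/p}<\infty$$ (for $0<p<1$ this is not a norm but the same notation is used); $\|\cdot\|_p$ denotes $\|\cdot\|_{p,0}$. For $a\in\mathbb{D}$, $\varphi_a(z)=\frac{a-z}{1-\overline{a}z}$. $\Gamma$ is the Euler Gamma function. *)

(* Defs.v *)
(* MathComp-Analysis over an abstract R : realType,
   complex numbers are R[i] (mathcomp-real-closed), viewed as a normed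
   module over itself via (R[i])^o so that derivable/derive1 are the
   complex derivative. *)
From HB Require Import structures.
From mathcomp Require Import all_boot all_order all_algebra.
From mathcomp Require Import all_classical all_reals all_analysis.
From mathcomp Require Import complex.
Import Order.TTheory GRing.Theory Num.Theory.
Import numFieldNormedType.Exports.

Set Implicit Arguments.
Unset Strict Implicit.
Unset Printing Implicit Defensive.

Local Open Scope ring_scope.
Local Open Scope classical_set_scope.

Section Bergman.
Variable R : realType.

Definition CC : Type := (R[i])^o.

Definition cabs (z : CC) : R := Normc.normc (z : R[i]).

Definition disk : set CC := [set z | cabs z < 1].

Definition holo_disk (f : CC -> CC) : Prop :=
  forall z : CC, z \in disk -> derivable f z 1.

Definition cderiv (k : nat) (f : CC -> CC) : CC -> CC := derive1n k f.

Definition cpt (xy : R * R) : CC := Complex xy.1 xy.2.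

(** integral over D of |f|^p (alpha+1)(1-|z|^2)^alpha dA(z),
    dA = (1/pi) dx dy the normalized area measure *)
Definition bergman_int (p alpha : R) (f : CC -> CC) : \bar R :=
  let F := fun xy : R * R =>
    (cabs (f (cpt xy))) `^ p * ((alpha + 1) * (1 - cabs (cpt xy) ^+ 2) `^ alpha)
      / pi in
  (\int[(@lebesgue_measure R) \x (@lebesgue_measure R)]_(xy in cpt @^-1` disk)
     (F xy)%:E)%E.

Definition in_Apa (p alpha : R) (f : CC -> CC) : Prop :=
  holo_disk f /\ (bergman_int p alpha f < +oo)%E.

(** ||f||_{p,alpha} (meaningful for f in A^p_alpha) *)
Definition bergman_norm (p alpha : R) (f : CC -> CC) : R :=
  (fine (bergman_int p alpha f)) `^ (p^-1).

Definition phi (a z : CC) : CC := (a - z) / (1 - conjc (a : R[i]) * z).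

Definition Gamma (x : R) : R :=
  let F := fun t : R => t `^ (x - 1) * expR (- t) in
  fine (\int[@lebesgue_measure R]_(t in [set t : R | (0 < t)%R]) (F t)%:E)%E.

Definition is_div_ext (a : CC) (N : nat) (f g : CC -> CC) : Prop :=
  holo_disk g /\ forall z : CC, z \in disk -> z != a -> g z = f z / phi a z ^+ N.

End Bergman.
Arguments disk {R}.

(* Main.v *)
(** Let [H] be a branch of [(phi_a')^((alpha+2)/p)] and [F w = g (phi_a w) H w].
    The substitution [w = phi_a z] turns the norm of [g] into that of [F], and
    the norm of [f = g phi_a^N] into the integral of [|F w|^p |w|^(Np)] against
    [(1-|w|^2)^alpha]. The circle means of [|F|^p] are nondecreasing in the
    radius, as is [|w|^(Np)], so Chebyshev's integral inequality bounds that
    integral below by [kappa] times the norm of [F], with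
    [kappa = B(Np/2+1, alpha+1) / B(1, alpha+1)]; the Beta-Gamma relation gives
    [kappa^-1 = K^p]. Equality holds when [F] has constant modulus: [g = H].

    The circle means are monotone by the maximum principle for the rotational
    average of [max(|F|^p, d)], which is locally subharmonic because a branch of
    [(F / F c)^p] near [c] has the mean value property. The substitution is only
    needed as an inequality, in both directions since [phi_a] is an involution;
    it is proved by averaging over small balls, with Tonelli and Fatou. *)
Require Import Defs.
From HB Require Import structures.
From mathcomp Require Import all_boot all_order all_algebra.
From mathcomp Require Import all_classical all_reals all_analysis.
From mathcomp Require Import measurable_realfun.
From mathcomp Require Import complex.
From mathcomp Require Import ring lra.
Import Order.TTheory GRing.Theory Num.Theory.
Import numFieldNormedType.Exports.

Set Implicit Arguments.
Unset Strict Implicit.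
Unset Printing Implicit Defensive.

Local Open Scope ring_scope.
Local Open Scope classical_set_scope.

(** * Limits and differentiability in [R[i]] *)

Section limits.
Context {R : realType}.
Local Notation C := R[i].
Local Notation N := (@Normc.normc R).
Local Notation Re := (@complex.Re R).
Local Notation Im := (@complex.Im R).

Lemma normcB (z w : C) : N (z - w) = N (w - z).
Proof. by rewrite -normcN opprB. Qed.

Lemma normc_ge0 (z : C) : 0 <= N z.
Proof. by case: z => x y /=; rewrite sqrtr_ge0. Qed.

Lemma normc_triangle (z w u : C) : N (z - w) <= N (z - u) + N (u - w).
Proof. by rewrite (le_trans _ (le_normcD _ _))// addrA subrK. Qed.

Lemma normc_eq0 (z : C) : (N z == 0) = (z == 0).
Proof.
by apply/eqP/eqP => [/Normc.eq0_normc//|->]; rewrite Normc.normc0.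
Qed.

Lemma normc_gt0 (z : C) : (0 < N z) = (z != 0).
Proof. by rewrite lt_neqAle normc_ge0 andbT eq_sym normc_eq0. Qed.

Lemma normc_sqr (z : C) : N z ^+ 2 = Re z ^+ 2 + Im z ^+ 2.
Proof. by case: z => x y /=; rewrite sqr_sqrtr// addr_ge0 ?sqr_ge0. Qed.

Lemma normc_geRe (z : C) : `|Re z| <= N z.
Proof.
case: z => x y /=; rewrite -sqrtr_sqr ler_sqrt ?addr_ge0 ?sqr_ge0//.
by rewrite lerDl sqr_ge0.
Qed.

Lemma normc_geIm (z : C) : `|Im z| <= N z.
Proof.
case: z => x y /=; rewrite -sqrtr_sqr ler_sqrt ?addr_ge0 ?sqr_ge0//.
by rewrite lerDr sqr_ge0.
Qed.

Lemma normc_leReIm (z : C) : N z <= `|Re z| + `|Im z|.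
Proof.
rewrite -(@ler_pXn2r _ 2%N)// ?nnegrE ?normc_ge0 ?addr_ge0//.
rewrite normc_sqr sqrrD !real_normK ?num_real// -addrA lerD2l lerDr.
by rewrite mulrn_wge0// mulr_ge0.
Qed.

Lemma normcR (x : R) : N (x%:C%C) = `|x|.
Proof. by rewrite /= expr0n /= addr0 sqrtr_sqr. Qed.

Lemma normc_conj (z : C) : N (conjc z) = N z.
Proof. by case: z => a b /=; rewrite sqrrN. Qed.

Lemma ler_normc_dist (z w : C) : `|N z - N w| <= N (z - w).
Proof.
rewrite ler_norml; apply/andP; split.
  by rewrite lerNl opprB lerBlDr normcB (le_trans _ (le_normcD _ _))// subrK.
by rewrite lerBlDr (le_trans _ (le_normcD _ _))// subrK.
Qed.

(* The neighbourhoods of [z], with real radii: the balls of the library's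
   topology on [(R[i])^o] have radii in the partially ordered [R[i]]. *)
Definition nearC (z : C) : set_system C :=
  [set P | exists2 e : R, 0 < e & forall w, N (z - w) < e -> P w].

#[global] Instance nearC_proper z : ProperFilter (nearC z).
Proof.
split; first by case=> e e0 /(_ z); rewrite subrr Normc.normc0; exact.
split; first by exists 1.
- move=> P Q [e e0 eP] [d d0 dQ]; exists (Num.min e d).
    by rewrite lt_min e0.
  by move=> w; rewrite lt_min => /andP[/eP ? /dQ].
- by move=> P Q PQ [e e0 eP]; exists e => // w /eP /PQ.
Qed.

Lemma near_normc (z : C) (e : R) : 0 < e -> \forall w \near nearC z, N (z - w) < e.
Proof. by move=> e0; exists e. Qed.

Lemma nearC_singleton (z : C) (P : set C) : nearC z P -> P z.
Proof. by case=> e e0; apply; rewrite subrr Normc.normc0. Qed.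

Definition tendsC {T : Type} (F : set_system T) (f : T -> C) (l : C) :=
  forall e : R, 0 < e -> \forall y \near F, N (l - f y) < e.

Section maps.
Context {T : Type} {F : set_system T} {FF : Filter F}.
Implicit Types (f g : T -> C) (l m : C).

Lemma tendsC_cst l : tendsC F (fun=> l) l.
Proof. by move=> e e0; apply: nearW => y; rewrite subrr Normc.normc0. Qed.

Lemma tendsCD f g l m : tendsC F f l -> tendsC F g m ->
  tendsC F (fun y => f y + g y) (l + m).
Proof.
move=> fl gm e e0; have e2 : 0 < e / 2 by rewrite divr_gt0.
near=> y; rewrite opprD addrACA (le_lt_trans (le_normcD _ _))//.
by rewrite (splitr e) ltrD//; near: y; [exact: fl|exact: gm].
Unshelve. all: by end_near. Qed.

Lemma tendsCN f l : tendsC F f l -> tendsC F (fun y => - f y) (- l).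
Proof.
by move=> fl e /fl; apply: filterS => y; rewrite -opprD normcN.
Qed.

Lemma tendsCB f g l m : tendsC F f l -> tendsC F g m ->
  tendsC F (fun y => f y - g y) (l - m).
Proof. by move=> fl /tendsCN; exact: tendsCD. Qed.

Lemma tendsCM f g l m : tendsC F f l -> tendsC F g m ->
  tendsC F (fun y => f y * g y) (l * m).
Proof.
move=> fl gm e e0.
have A0 : 0 < N l + 1 by rewrite ltr_wpDl// normc_ge0.
have B0 : 0 < N m + 1 by rewrite ltr_wpDl// normc_ge0.
have eA : 0 < e / 2 / (N l + 1) by rewrite !divr_gt0.
have eB : 0 < Num.min 1 (e / 2 / (N m + 1)) by rewrite lt_min ltr01 !divr_gt0.
near=> y.
have gy : N (m - g y) < Num.min 1 (e / 2 / (N l + 1)).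
  by near: y; apply: gm; rewrite lt_min ltr01.
have fy : N (l - f y) < e / 2 / (N m + 1).
  by near: y; apply: fl; rewrite !divr_gt0.
rewrite (_ : _ - _ = l * (m - g y) + (l - f y) * g y); last by ring.
rewrite (le_lt_trans (le_normcD _ _))// !Normc.normcM (splitr e).
move: gy; rewrite lt_min => /andP[gy1 gy].
have gyb : N (g y) <= N m + 1.
  have := ler_normc_dist (g y) m; rewrite normcB ler_norml => /andP[_].
  by rewrite lerBlDl => /le_trans; apply; rewrite lerD2l ltW.
apply: ltr_leD.
  move: gy; rewrite ltr_pdivlMr// mulrDr mulr1 mulrC; apply: le_lt_trans.
  by rewrite lerDl normc_ge0.
rewrite (le_trans (ler_wpM2l (normc_ge0 _) gyb))//.
by rewrite -ler_pdivlMr// ltW.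
Unshelve. all: by end_near. Qed.

Lemma tendsCV f l : tendsC F f l -> l != 0 -> tendsC F (fun y => (f y)^-1) l^-1.
Proof.
move=> fl l0 e e0.
have nl : 0 < N l by rewrite normc_gt0.
have nl2 : 0 < N l / 2 by rewrite divr_gt0.
have ed : 0 < Num.min (N l / 2) (e * (N l * (N l / 2))).
  by rewrite lt_min nl2 !mulr_gt0.
near=> y.
have : N (l - f y) < Num.min (N l / 2) (e * (N l * (N l / 2))).
  by near: y; exact: fl.
rewrite lt_min => /andP[h1 h2].
have fy : N l / 2 < N (f y).
  have := ler_normc_dist l (f y); rewrite ler_norml => /andP[_ h].
  rewrite -(ltrD2l (N l / 2)) -splitr -ltrBlDr.
  exact: le_lt_trans h h1.
have fy0 : f y != 0 by rewrite -normc_gt0 (lt_trans _ fy).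
rewrite (_ : _ - _ = (f y - l) * (l * f y)^-1); last by field; rewrite fy0.
rewrite Normc.normcM Normc.normcV Normc.normcM normcB ltr_pdivrMr ?mulr_gt0 ?(lt_trans _ fy)//.
by rewrite (lt_le_trans h2)// ler_pM2l// ler_pM2l// ltW.
Unshelve. all: by end_near. Qed.

Lemma tendsC_comp f (g : C -> C) l m : tendsC F f l -> tendsC (nearC l) g m ->
  tendsC F (fun y => g (f y)) m.
Proof.
move=> fl gm e /gm[d d0 dP]; apply: filterS (fl d d0) => y; exact: dP.
Qed.

Lemma tendsC_Re f l : tendsC F f l -> Re (f y) @[y --> F] --> Re l.
Proof.
move=> fl; apply/cvgrPdist_lt => e /fl; apply: filterS => y.
by apply: le_lt_trans; rewrite -raddfB normc_geRe.
Qed.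

Lemma tendsC_Im f l : tendsC F f l -> Im (f y) @[y --> F] --> Im l.
Proof.
move=> fl; apply/cvgrPdist_lt => e /fl; apply: filterS => y.
by apply: le_lt_trans; rewrite -raddfB normc_geIm.
Qed.

Lemma tendsC_normc f l : tendsC F f l -> N (f y) @[y --> F] --> N l.
Proof.
move=> fl; apply/cvgrPdist_lt => e /fl; apply: filterS => y.
exact: le_lt_trans (ler_normc_dist _ _).
Qed.

Lemma cvg_tendsC (g : C -> R) f l : g w @[w --> nearC l] --> g l -> tendsC F f l ->
  g (f y) @[y --> F] --> g l.
Proof. by move=> gl fl A /gl[d d0 dA]; apply: filterS (fl d d0) => y; exact: dA. Qed.

Lemma tendsC_Complex (u v : T -> R) (a b : R) :
  u @ F --> a -> v @ F --> b -> tendsC F (fun y => Complex (u y) (v y)) (Complex a b).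
Proof.
move=> /cvgrPdist_lt ux /cvgrPdist_lt vx e e0.
have e2 : 0 < e / 2 by rewrite divr_gt0.
near=> y; rewrite (le_lt_trans (normc_leReIm _))//= (splitr e) ltrD//.
  by near: y; exact: ux.
by near: y; exact: vx.
Unshelve. all: by end_near. Qed.

Lemma tendsC_near f g l : (\forall y \near F, f y = g y) ->
  tendsC F f l -> tendsC F g l.
Proof.
by move=> fg fl e /fl; apply: filterS2 fg => y ->.
Qed.

End maps.

Lemma tendsC_id (z : C) : tendsC (nearC z) id z.
Proof. by move=> e e0; exact: near_normc. Qed.

(* Caratheodory's form of complex differentiability: it makes the chain, product
   and inverse function rules purely algebraic. *)
Definition cdiff (f : C -> C) (z d : C) :=
  exists2 q : C -> C, tendsC (nearC z) q d /\ q z = d &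
    forall w, f w = f z + (w - z) * q w.

Lemma cdiff_cont f z d : cdiff f z d -> tendsC (nearC z) f (f z).
Proof.
case=> q [qc qz] fE.
have : tendsC (nearC z) (fun w => f z + (w - z) * q w) (f z + (z - z) * d).
  by apply: tendsCD (tendsC_cst _) (tendsCM (tendsCB (tendsC_id z) _) qc);
     exact: tendsC_cst.
rewrite subrr mul0r addr0 => h; apply: tendsC_near h.
by apply: nearW => w; rewrite (fE w).
Qed.

Lemma cdiff_cst (c z : C) : cdiff (fun=> c) z 0.
Proof.
exists (fun=> 0); first by split=> //; exact: tendsC_cst.
by move=> w; rewrite mulr0 addr0.
Qed.

Lemma cdiff_id (z : C) : cdiff id z 1.
Proof.
exists (fun=> 1); first by split=> //; exact: tendsC_cst.
by move=> w; rewrite mulr1 addrC subrK.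
Qed.

Lemma cdiffD f g z d e : cdiff f z d -> cdiff g z e ->
  cdiff (fun w => f w + g w) z (d + e).
Proof.
case=> q [qc qz] fE [r [rc rz] gE]; exists (fun w => q w + r w).
  by split; [exact: tendsCD|rewrite qz rz].
by move=> w; rewrite fE gE mulrDr addrACA.
Qed.

Lemma cdiffM f g z d e : cdiff f z d -> cdiff g z e ->
  cdiff (fun w => f w * g w) z (d * g z + f z * e).
Proof.
move=> df; have fc := cdiff_cont df; case: df.
move=> q [qc qz] fE [r [rc rz] gE]; exists (fun w => q w * g z + f w * r w).
  split; last by rewrite qz rz.
  exact: (tendsCD (tendsCM qc (tendsC_cst _)) (tendsCM fc rc)).
by move=> w; rewrite gE mulrDr; rewrite {1}fE; ring.
Qed.

Lemma cdiffZ c f z d : cdiff f z d -> cdiff (fun w => c * f w) z (c * d).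
Proof.
by move=> df; have := cdiffM (cdiff_cst c z) df; rewrite mul0r add0r.
Qed.

Lemma cdiffN f z d : cdiff f z d -> cdiff (fun w => - f w) z (- d).
Proof.
case=> q [qc qz] fE; exists (fun w => - q w).
  by split; [exact: tendsCN|rewrite qz].
by move=> w; rewrite fE mulrN opprD.
Qed.

Lemma cdiffB f g z d e : cdiff f z d -> cdiff g z e ->
  cdiff (fun w => f w - g w) z (d - e).
Proof. by move=> df dg; exact: cdiffD df (cdiffN dg). Qed.

Lemma cdiff_comp f g z d e : cdiff f z d -> cdiff g (f z) e ->
  cdiff (fun w => g (f w)) z (e * d).
Proof.
move=> df; have fc := cdiff_cont df; case: df => q [qc qz] fE.
case=> r [rc rz] gE; exists (fun w => r (f w) * q w).
  by split; [exact: (tendsCM (tendsC_comp fc rc) qc)|rewrite qz rz].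
move=> w; rewrite gE; have -> : f w - f z = (w - z) * q w by rewrite fE; ring.
by ring.
Qed.

Lemma cdiff_nearI (f q : C -> C) z d :
  (\forall v \near nearC z, f v = f z + (v - z) * q v) -> tendsC (nearC z) q d ->
  cdiff f z d.
Proof.
move=> fE qd; exists (fun v => if v == z then d else (f v - f z) / (v - z)).
  split; last by rewrite eqxx.
  move=> e /qd; apply: filterS2 fE => v fvE.
  have [_|vz] := eqVneq v z; first by rewrite subrr Normc.normc0; exact: le_lt_trans (normc_ge0 _).
  by rewrite fvE [f z + _]addrC addrK mulrC mulKf// subr_eq0.
move=> v; have [->|vz] := eqVneq v z; first by rewrite subrr mul0r addr0.
by rewrite [(v - z) * _]mulrC divfK ?subr_eq0// addrC subrK.
Qed.

Lemma cdiff_near f g z d : (\forall w \near nearC z, f w = g w) ->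
  cdiff f z d -> cdiff g z d.
Proof.
move=> fg [q [qc _] fE]; apply: (@cdiff_nearI _ q) => //.
have fgz := nearC_singleton fg.
by apply: filterS fg => w <-; rewrite -fgz.
Qed.

Lemma cdiff_ext f g z d : (forall w, f w = g w) -> cdiff f z d -> cdiff g z d.
Proof. by move=> /funext ->. Qed.

Lemma tendsC_neq0 {T : Type} {F : set_system T} {FF : Filter F} f l :
  tendsC F f l -> l != 0 -> \forall y \near F, f y != 0.
Proof.
move=> fl; rewrite -normc_gt0 => /fl; apply: filterS => y.
by apply: contraTneq => ->; rewrite subr0 ltxx.
Qed.

Lemma cdiffV f z d : cdiff f z d -> f z != 0 ->
  cdiff (fun w => (f w)^-1) z (- d / f z ^+ 2).
Proof.
move=> df f0; have fc := cdiff_cont df; case: df => q [qc qz] fE.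
apply: (@cdiff_nearI _ (fun w => - q w / (f w * f z))).
  apply: filterS (tendsC_neq0 fc f0) => w fw0.
  have E : (w - z) * q w = f w - f z by rewrite [f w]fE; ring.
  by rewrite mulrA mulrN E; field; rewrite fw0 f0.
rewrite expr2; apply: tendsCM (tendsCN qc) (tendsCV (tendsCM fc _) (mulf_neq0 f0 f0)).
exact: tendsC_cst.
Qed.

End limits.

Section derivable_cdiff.
Context {R : realType}.
Local Notation C := R[i].

Lemma derive_cvgP (f : CC R -> CC R) (z d : CC R) :
  (fun h : CC R => h^-1 *: (f (h *: 1 + z) - f z)) @ 0^' --> d <->
  cdiff (f : C -> C) z d.
Proof.
split=> [/cvgrPdist_lt fd|[q [qc qz] fE]].
  exists (fun w : C => if w == z then d : C else ((f w : C) - f z) / (w - z)).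
    split; last by rewrite eqxx.
    move=> e e0.
    have e0' : (0 : C) < e%:C%C by rewrite ltcR.
    have /nbhs_ballP[/= h h0 hh] := fd _ e0'.
    have := h0; rewrite ltcE /= => /andP[/eqP ih rh].
    exists (complex.Re h) => // w wz.
    have [_|wnz] := eqVneq w z; first by rewrite subrr Normc.normc0.
    have := hh (w - z : C); rewrite -ball_normE /= sub0r normrN.
    rewrite normcB in wz.
    rewrite ltcE /= ih eqxx /= => /(_ wz); rewrite subr_eq0 => /(_ wnz).
    rewrite -[(_ - _) *: 1]/((w - z : C) * 1) mulr1 subrK.
    rewrite -[_ *: _]/((w - z : C)^-1 * (f w - f z)) mulrC.
    by rewrite ltcR.
  move=> w; have [->|wnz] := eqVneq w z; first by rewrite subrr mul0r addr0.
  by field; rewrite subr_eq0.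
apply/cvgrPdist_lt => e e0.
have := e0; rewrite ltcE /= => /andP[/eqP ie re].
have [h h0 hh] := qc _ re.
have h0' : (0 : C) < h%:C%C by rewrite ltcR.
apply/nbhs_ballP; exists (h%:C%C) => //= k; rewrite -ball_normE /= sub0r normrN.
rewrite ltcR => kh k0.
rewrite -[k *: 1]/((k : C) * 1) mulr1 -[_ *: _]/((k : C)^-1 * (f (k + z) - f z)).
rewrite (fE (k + z)) addrK (addrC (f z)) addrK mulrA mulVf// mul1r.
rewrite ltcE/= ie eqxx/=; apply: hh.
by rewrite opprD addrCA subrr addr0 normcN.
Qed.

Lemma derivable_cdiff (f : CC R -> CC R) (z : CC R) :
  derivable f z 1 <-> exists d, cdiff (f : C -> C) z d.
Proof.
split; first by move=> /cvg_ex[/= l /derive_cvgP hl]; exists l.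
by case=> d /derive_cvgP h; apply/cvg_ex; exists d.
Qed.

Lemma cdiff_derive1 (f : CC R -> CC R) (z d : CC R) :
  cdiff (f : C -> C) z d -> (f^`())%classic z = d.
Proof.
move=> /derive_cvgP fd; rewrite derive1E; exact: cvg_lim fd.
Qed.

End derivable_cdiff.

Section segint.
Context {R : realType}.
Notation mu := (@lebesgue_measure R).
Implicit Types (a b c : R) (f g : R -> R).

Definition segint a b f : R := (\int[mu]_(x in `[a, b]) f x)%R.

Definition contI a b f := forall x, a <= x <= b -> {for x, continuous f}.

Lemma contI_sub a b c d f : a <= c -> d <= b -> contI a b f -> contI c d f.
Proof.
by move=> ac db fc x /andP[cx xd]; apply: fc; rewrite (le_trans ac)//= (le_trans xd).
Qed.

Lemma contI_within a b f : contI a b f -> {within `[a, b], continuous f}.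
Proof.
move=> fc; apply: continuous_in_subspaceT => x; rewrite inE/= in_itv/=.
exact: fc.
Qed.

Lemma contI_integrable a b f : contI a b f -> mu.-integrable `[a, b] (EFin \o f).
Proof.
move=> /contI_within fc; apply: continuous_compact_integrable => //.
exact: segment_compact.
Qed.

Lemma contI_cst a b c : contI a b (fun=> c).
Proof. by move=> x _; exact: cst_continuous. Qed.

Lemma contID a b f g : contI a b f -> contI a b g -> contI a b (fun x => f x + g x).
Proof. by move=> fc gc x xab; apply: continuousD; [exact: fc|exact: gc]. Qed.

Lemma contIB a b f g : contI a b f -> contI a b g -> contI a b (fun x => f x - g x).
Proof. by move=> fc gc x xab; apply: continuousB; [exact: fc|exact: gc]. Qed.

Lemma contIM a b f g : contI a b f -> contI a b g -> contI a b (fun x => f x * g x).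
Proof. by move=> fc gc x xab; apply: continuousM; [exact: fc|exact: gc]. Qed.

Lemma eq_segint a b f g : (forall x, a <= x <= b -> f x = g x) -> segint a b f = segint a b g.
Proof.
move=> fg; apply: eq_Rintegral => x; rewrite inE/= in_itv/=; exact: fg.
Qed.

Lemma segintD a b f g : contI a b f -> contI a b g ->
  segint a b (fun x => f x + g x) = segint a b f + segint a b g.
Proof. by move=> fc gc; rewrite /segint RintegralD//; exact: contI_integrable. Qed.

Lemma segintB a b f g : contI a b f -> contI a b g ->
  segint a b (fun x => f x - g x) = segint a b f - segint a b g.
Proof. by move=> fc gc; rewrite /segint RintegralB//; exact: contI_integrable. Qed.

Lemma segintZ a b c f : contI a b f -> segint a b (fun x => c * f x) = c * segint a b f.
Proof. by move=> fc; rewrite /segint RintegralZl//; exact: contI_integrable. Qed.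

Lemma segintN a b f : contI a b f -> segint a b (fun x => - f x) = - segint a b f.
Proof.
move=> fc; rewrite -mulN1r -segintZ//; apply: eq_segint => x _.
by rewrite mulN1r.
Qed.

Lemma segint_cst a b c : a <= b -> segint a b (fun=> c) = c * (b - a).
Proof.
move=> ab; rewrite /segint Rintegral_cst//; congr (_ * _).
have := @lebesgue_measure_itv R (Interval (BLeft a) (BRight b)); rewrite /= => ->; rewrite lte_fin.
by move: ab; rewrite le_eqVlt => /predU1P[->|->//]; rewrite ltxx subrr.
Qed.

Lemma le_segint a b f g : contI a b f -> contI a b g ->
  (forall x, a <= x <= b -> f x <= g x) -> segint a b f <= segint a b g.
Proof.
move=> fc gc fg.
apply: le_Rintegral => [//|||]; [exact: contI_integrable|exact: contI_integrable|].
by move=> x /=; rewrite in_itv/=; exact: fg.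
Qed.

Lemma segint_norm_le a b f c : a <= b -> contI a b f ->
  (forall x, a <= x <= b -> `|f x| <= c) -> `|segint a b f| <= c * (b - a).
Proof.
move=> ab fc fb; rewrite ler_norml; apply/andP; split.
  rewrite -mulNr -segint_cst//; apply: le_segint => //; first exact: contI_cst.
  by move=> x /fb; rewrite ler_norml => /andP[].
rewrite -segint_cst//; apply: le_segint => //; first exact: contI_cst.
by move=> x /fb; rewrite ler_norml => /andP[].
Qed.

Lemma segint_split a b c f : a <= c -> c <= b -> contI a b f ->
  segint a b f = segint a c f + segint c b f.
Proof.
move=> ac cb fc; have fi := contI_integrable fc.
have := @Rintegral_itvB R f (BLeft a) (BRight b) c fi.
rewrite !bnd_simp => /(_ ac cb) => h.
apply/eqP; rewrite addrC -subr_eq; apply/eqP; rewrite /segint h.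
apply: Rintegral_itv_obnd_cbnd; apply: integrableS fi => //.
by apply: subset_itvScc => //=; rewrite bnd_simp.
Qed.

Lemma segint_ge0 a b f : (forall x, a <= x <= b -> 0 <= f x) -> 0 <= segint a b f.
Proof. by move=> f0; apply: Rintegral_ge0 => x /=; rewrite in_itv/=; exact: f0. Qed.

Lemma segint_eq0 a b f : a < b -> contI a b f ->
  (forall x, a <= x <= b -> 0 <= f x) -> segint a b f <= 0 ->
  forall x, a <= x <= b -> f x = 0.
Proof.
move=> ab fc f0 fi x xab; apply/eqP; rewrite eq_le f0// andbT leNgt; apply/negP => fx.
have fx2 : 0 < f x / 2 by rewrite divr_gt0.
have /cvgrPdist_lt /(_ _ fx2) /nbhs_ballP[/= e e0 he] := fc _ xab.
have [d [d0 de]] : exists d, 0 < d /\ d < e /\ d <= b - a.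
  exists (Num.min (e / 2) (b - a)); rewrite lt_min divr_gt0//= subr_gt0 ab.
  by rewrite gt_min ltr_pdivrMr// ltr_pMr// ltr1n ge_min lexx orbT.
case: de => de dab.
have [c [ac cb ce]] : exists c, [/\ a <= c, c + d <= b & c <= x <= c + d].
  have [h|h] := lerP (x + d) b.
    exists x; split => //; first by case/andP: xab.
    by rewrite lexx lerDl ltW.
  exists (b - d); split.
  - by rewrite lerBrDl -lerBrDr.
  - by rewrite subrK.
  - by rewrite subrK lerBlDr ltW//=; case/andP: xab.
have fcd : contI c (c + d) f by apply: contI_sub fc.
have h1 : f x / 2 * d <= segint c (c + d) f.
  have -> : f x / 2 * d = segint c (c + d) (fun=> f x / 2).
    by rewrite segint_cst ?lerDl ?(ltW d0)// addrAC subrr add0r.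
  apply: le_segint => //; first exact: contI_cst.
  move=> y /andP[cy yd]; have := he y; rewrite /ball/= => h.
  have : `|f x - f y| < f x / 2.
    apply: h; rewrite (le_lt_trans _ de)// ler_norml.
    by case/andP: ce => cx xcd; apply/andP; split; lra.
  rewrite ltr_norml => /andP[_ ?]; lra.
have : segint a b f = segint a c f + (segint c (c + d) f + segint (c + d) b f).
  rewrite -segint_split//; last 2 first.
  - by rewrite lerDl ltW.
  - by apply: contI_sub fc.
  by rewrite -segint_split// (le_trans _ cb)// lerDl ltW.
have : 0 <= segint a c f.
  by apply: segint_ge0 => y /andP[ay yc]; apply: f0; rewrite ay (le_trans yc)// (le_trans _ cb)// lerDl ltW.
have : 0 <= segint (c + d) b f.
  by apply: segint_ge0 => y /andP[ay yc]; apply: f0; rewrite yc andbT (le_trans _ ay)// (le_trans ac)// lerDl ltW.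
have : 0 < f x / 2 * d by rewrite mulr_gt0.
lra.
Qed.

Lemma segint_cvg {T : Type} {F : set_system T} {FF : Filter F} a b (U : T -> R -> R) f :
  a <= b -> (\forall t \near F, contI a b (U t)) -> contI a b f ->
  (forall e : R, 0 < e -> \forall t \near F, forall x, a <= x <= b -> `|f x - U t x| < e) ->
  (fun t => segint a b (U t)) @ F --> segint a b f.
Proof.
move=> ab Uc fc h; apply/cvgrPdist_lt => e e0.
have d0 : 0 < e / (b - a + 1) by rewrite divr_gt0// ltr_wpDl// subr_ge0.
apply: filterS2 Uc (h _ d0) => t Ut ht; rewrite -segintB//.
have h1 : `|segint a b (fun x => f x - U t x)| <= e / (b - a + 1) * (b - a).
  by apply: segint_norm_le => //; [exact: contIB|move=> x /ht /ltW].
rewrite (le_lt_trans h1)// mulrAC ltr_pdivrMr ?ltr_wpDl ?subr_ge0//.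
by rewrite ltr_pM2l// ltrDl.
Qed.

Lemma near_segment {I : Type} (F : set_system I) {FF : Filter F} a b (P : I -> R -> Prop) :
  (forall x, a <= x <= b -> \forall x' \near x & i \near F, P i x') ->
  \forall i \near F, forall x, a <= x <= b -> P i x.
Proof.
move=> h; have /compact_near_coveringP := @segment_compact R a b.
move=> /(_ I F P FF); rewrite /near_covering.
have hP : (forall x, `[a, b]%classic x -> \forall x' \near x & i \near F, P i x').
  by move=> x /=; rewrite in_itv/=; exact: h.
move=> /(_ hP); apply: filterS => i iP x xab; apply: iP.
by rewrite /= in_itv.
Qed.

End segint.

(** * Cauchy theory *)

Section Goursat.
Context {R : realType}.
Local Notation C := R[i].
Local Notation N := (@Normc.normc R).
Local Notation Re := (@complex.Re R).
Local Notation Im := (@complex.Im R).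
Implicit Types f : C -> C.

Lemma contC_hor f (t y : R) : tendsC (nearC (Complex t y)) f (f (Complex t y)) ->
  tendsC (nbhs t) (fun s => f (Complex s y)) (f (Complex t y)).
Proof.
move=> fc; apply: tendsC_comp fc.
by apply: tendsC_Complex; [exact: cvg_id|exact: cvg_cst].
Qed.

Lemma contC_ver f (t y : R) : tendsC (nearC (Complex t y)) f (f (Complex t y)) ->
  tendsC (nbhs y) (fun s => f (Complex t s)) (f (Complex t y)).
Proof.
move=> fc; apply: tendsC_comp fc.
by apply: tendsC_Complex; [exact: cvg_cst|exact: cvg_id].
Qed.

Definition rect_boundary f (x0 x1 y0 y1 : R) : R :=
  (segint y0 y1 (fun y => Re (f (Complex x1 y))) -
   segint y0 y1 (fun y => Re (f (Complex x0 y)))) -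
  (segint x0 x1 (fun x => Im (f (Complex x y1))) -
   segint x0 x1 (fun x => Im (f (Complex x y0)))).

Definition holo_rect f (x0 x1 y0 y1 : R) :=
  forall x y, x0 <= x <= x1 -> y0 <= y <= y1 -> exists d, cdiff f (Complex x y) d.

Lemma holo_rect_Re f x0 x1 y0 y1 x : holo_rect f x0 x1 y0 y1 ->
  x0 <= x <= x1 -> contI y0 y1 (fun y => Re (f (Complex x y))).
Proof.
move=> fh xi y yi; have [d /cdiff_cont fc] := fh _ _ xi yi.
by apply: tendsC_Re; exact: contC_ver fc.
Qed.

Lemma holo_rect_Im f x0 x1 y0 y1 y : holo_rect f x0 x1 y0 y1 ->
  y0 <= y <= y1 -> contI x0 x1 (fun x => Im (f (Complex x y))).
Proof.
move=> fh yi x xi; have [d /cdiff_cont fc] := fh _ _ xi yi.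
by apply: tendsC_Im; exact: contC_hor fc.
Qed.

Lemma rect_boundary_splitx f x0 x1 y0 y1 x : x0 <= x <= x1 -> y0 <= y1 ->
  holo_rect f x0 x1 y0 y1 ->
  rect_boundary f x0 x1 y0 y1 = rect_boundary f x0 x y0 y1 + rect_boundary f x x1 y0 y1.
Proof.
move=> /andP[x0x xx1] y01 fh; rewrite /rect_boundary.
rewrite (@segint_split _ x0 x1 x (fun x => Im (f (Complex x y1))))//; last first.
  by apply: (holo_rect_Im fh); rewrite lexx y01.
rewrite (@segint_split _ x0 x1 x (fun x => Im (f (Complex x y0))))//; last first.
  by apply: (holo_rect_Im fh); rewrite lexx y01.
by ring.
Qed.

Lemma rect_boundary_splity f x0 x1 y0 y1 y : y0 <= y <= y1 -> x0 <= x1 ->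
  holo_rect f x0 x1 y0 y1 ->
  rect_boundary f x0 x1 y0 y1 = rect_boundary f x0 x1 y0 y + rect_boundary f x0 x1 y y1.
Proof.
move=> /andP[y0y yy1] x01 fh; rewrite /rect_boundary.
rewrite (@segint_split _ y0 y1 y (fun y => Re (f (Complex x1 y))))//; last first.
  by apply: (holo_rect_Re fh); rewrite lexx x01.
rewrite (@segint_split _ y0 y1 y (fun y => Re (f (Complex x0 y))))//; last first.
  by apply: (holo_rect_Re fh); rewrite lexx x01.
by ring.
Qed.

Definition rect_ok f (s : (R * R) * (R * R)) :=
  [/\ s.1.1 <= s.1.2, s.2.1 <= s.2.2 & holo_rect f s.1.1 s.1.2 s.2.1 s.2.2].

Definition quarter f (s u : (R * R) * (R * R)) :=
  [/\ s.1.1 <= u.1.1 /\ u.1.2 <= s.1.2, s.2.1 <= u.2.1 /\ u.2.2 <= s.2.2,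
      u.1.2 - u.1.1 = (s.1.2 - s.1.1) / 2, u.2.2 - u.2.1 = (s.2.2 - s.2.1) / 2 &
      `|rect_boundary f s.1.1 s.1.2 s.2.1 s.2.2| <=
      4 * `|rect_boundary f u.1.1 u.1.2 u.2.1 u.2.2| ].

Lemma holo_rect_sub f x0 x1 y0 y1 x0' x1' y0' y1' : x0 <= x0' -> x1' <= x1 ->
  y0 <= y0' -> y1' <= y1 -> holo_rect f x0 x1 y0 y1 -> holo_rect f x0' x1' y0' y1'.
Proof.
move=> ? ? ? ? fh x y /andP[? ?] /andP[? ?]; apply: fh; apply/andP; split; lra.
Qed.

Lemma quarter_exists f s : rect_ok f s -> exists u, rect_ok f u /\ quarter f s u.
Proof.
case: s => -[x0 x1] [y0 y1] [/= x01 y01 fh].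
pose x := (x0 + x1) / 2; pose y := (y0 + y1) / 2.
have [x0x xx1 xl xr] : [/\ x0 <= x, x <= x1, x - x0 = (x1 - x0) / 2 & x1 - x = (x1 - x0) / 2].
  by rewrite /x; split; lra.
have [y0y yy1 yl yr] : [/\ y0 <= y, y <= y1, y - y0 = (y1 - y0) / 2 & y1 - y = (y1 - y0) / 2].
  by rewrite /y; split; lra.
have E : rect_boundary f x0 x1 y0 y1 =
  (rect_boundary f x0 x y0 y + rect_boundary f x0 x y y1) +
  (rect_boundary f x x1 y0 y + rect_boundary f x x1 y y1).
  rewrite (@rect_boundary_splitx _ _ _ _ _ x) ?x0x//.
  congr (_ + _); apply: rect_boundary_splity; rewrite ?y0y ?yy1//;
    exact: holo_rect_sub fh.
have key a b c d : a <= b -> c <= d -> x0 <= a -> b <= x1 -> y0 <= c -> d <= y1 ->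
   b - a = (x1 - x0) / 2 -> d - c = (y1 - y0) / 2 ->
   `|rect_boundary f x0 x1 y0 y1| <= 4 * `|rect_boundary f a b c d| ->
   exists u, rect_ok f u /\ quarter f (x0, x1, (y0, y1)) u.
  move=> *; exists (a, b, (c, d)); split; split => //=.
  exact: holo_rect_sub fh.
have [h1|h1] := lerP `|rect_boundary f x0 x1 y0 y1| (4 * `|rect_boundary f x0 x y0 y|).
  exact: key h1.
have [h2|h2] := lerP `|rect_boundary f x0 x1 y0 y1| (4 * `|rect_boundary f x0 x y y1|).
  exact: key h2.
have [h3|h3] := lerP `|rect_boundary f x0 x1 y0 y1| (4 * `|rect_boundary f x x1 y0 y|).
  exact: key h3.
have [h4|h4] := lerP `|rect_boundary f x0 x1 y0 y1| (4 * `|rect_boundary f x x1 y y1|).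
  exact: key h4.
exfalso; move: h1 h2 h3 h4; rewrite E.
set a := rect_boundary _ _ _ _ _; set b := rect_boundary _ _ _ _ _.
set c := rect_boundary _ _ _ _ _; set d := rect_boundary _ _ _ _ _.
have := ler_normD (a + b) (c + d); have := ler_normD a b; have := ler_normD c d.
lra.
Qed.

Lemma rect_boundary_small f x0 x1 y0 y1 x y d (e r : R) :
  holo_rect f x0 x1 y0 y1 -> x0 <= x <= x1 -> y0 <= y <= y1 -> 0 <= e ->
  (forall w, N (Complex x y - w) < r ->
     N (f w - f (Complex x y) - (w - Complex x y) * d) <= e * N (Complex x y - w)) ->
  (x1 - x0) + (y1 - y0) < r ->
  `|rect_boundary f x0 x1 y0 y1| <= 2 * e * ((x1 - x0) + (y1 - y0)) ^+ 2.
Proof.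
move=> fh /andP[x0x xx1] /andP[y0y yy1] e0 H.
set L := (x1 - x0) + (y1 - y0) => Lr.
pose E w := f w - f (Complex x y) - (w - Complex x y) * d.
have Eb a b : x0 <= a <= x1 -> y0 <= b <= y1 -> N (E (Complex a b)) <= e * L.
  move=> /andP[x0a ax1] /andP[y0b by1].
  have D : N (Complex x y - Complex a b) <= L.
    rewrite (le_trans (normc_leReIm _))//= lerD//.
      by rewrite ler_norml; apply/andP; split; lra.
    by rewrite ler_norml; apply/andP; split; lra.
  by rewrite (le_trans (H _ _))// ?(le_lt_trans D)// ler_wpM2l.
have x01 : x0 <= x1 by exact: le_trans xx1.
have y01 : y0 <= y1 by exact: le_trans yy1.
rewrite /rect_boundary -!segintB; last 4 first.
- by apply: (holo_rect_Im fh); rewrite lexx y01.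
- by apply: (holo_rect_Im fh); rewrite lexx y01.
- by apply: (holo_rect_Re fh); rewrite lexx x01.
- by apply: (holo_rect_Re fh); rewrite lexx x01.
have h1 : `|segint y0 y1 (fun y => (Re (f (Complex x1 y)) - Re (f (Complex x0 y))) -
     (x1 - x0) * Re d)| <= 2 * e * L * (y1 - y0).
  apply: segint_norm_le => //.
    apply: contIB; last exact: contI_cst.
    by apply: contIB; apply: (holo_rect_Re fh); rewrite lexx x01.
  move=> b bi; have := Eb x1 b; have := Eb x0 b; rewrite !lexx x01 => /(_ isT bi) h0 /(_ isT bi) h1.
  have -> : Re (f (Complex x1 b)) - Re (f (Complex x0 b)) - (x1 - x0) * Re d =
     Re (E (Complex x1 b)) - Re (E (Complex x0 b)).
    rewrite /E !raddfB /=; case: (d) => d1 d2 /=; ring.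
  have := normc_geRe (E (Complex x1 b)); have := normc_geRe (E (Complex x0 b)).
  have := ler_normB (Re (E (Complex x1 b))) (Re (E (Complex x0 b))).
  lra.
have h2 : `|segint x0 x1 (fun x => (Im (f (Complex x y1)) - Im (f (Complex x y0))) -
     (y1 - y0) * Re d)| <= 2 * e * L * (x1 - x0).
  apply: segint_norm_le => //.
    apply: contIB; last exact: contI_cst.
    by apply: contIB; apply: (holo_rect_Im fh); rewrite lexx y01.
  move=> b bi; have := Eb b y1; have := Eb b y0; rewrite !lexx y01 => /(_ bi isT) h0 /(_ bi isT) h3.
  have -> : Im (f (Complex b y1)) - Im (f (Complex b y0)) - (y1 - y0) * Re d =
     Im (E (Complex b y1)) - Im (E (Complex b y0)).
    rewrite /E !raddfB /=; case: (d) => d1 d2 /=; ring.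
  have := normc_geIm (E (Complex b y1)); have := normc_geIm (E (Complex b y0)).
  have := ler_normB (Im (E (Complex b y1))) (Im (E (Complex b y0))).
  lra.
rewrite segintB ?segint_cst// in h1; last 2 first.
- by apply: contIB; apply: (holo_rect_Re fh); rewrite lexx x01.
- exact: contI_cst.
rewrite segintB ?segint_cst// in h2; last 2 first.
- by apply: contIB; apply: (holo_rect_Im fh); rewrite lexx y01.
- exact: contI_cst.
move: h1 h2.
set A := segint _ _ _; set B := segint _ _ _ => h1 h2.
have -> : A - B = (A - (x1 - x0) * Re d * (y1 - y0)) - (B - (y1 - y0) * Re d * (x1 - x0)).
  by ring.
rewrite (le_trans (ler_normB _ _))// (le_trans (lerD h1 h2))//.
by rewrite [leLHS](_ : _ = 2 * e * L ^+ 2) // /L; ring.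
Qed.

Lemma goursat f x0 x1 y0 y1 : x0 <= x1 -> y0 <= y1 -> holo_rect f x0 x1 y0 y1 ->
  rect_boundary f x0 x1 y0 y1 = 0.
Proof.
move=> x01 y01 fh.
have /choice[next nextP] : forall s, exists u, rect_ok f s -> rect_ok f u /\ quarter f s u.
  move=> s; have [/quarter_exists[u us]|ns] := pselect (rect_ok f s); first by exists u.
  by exists s.
pose s n := iter n next ((x0, x1), (y0, y1)).
have sok n : rect_ok f (s n).
  by elim: n => [|n ih]; [split|have [] := nextP _ ih].
have sq n : quarter f (s n) (s n.+1) by have [] := nextP _ (sok n).
have ndl n k : (s n).1.1 <= (s (k + n)%N).1.1 /\ (s (k + n)%N).1.2 <= (s n).1.2 /\
    (s n).2.1 <= (s (k + n)%N).2.1 /\ (s (k + n)%N).2.2 <= (s n).2.2.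
  elim: k => [|k [h1 [h2 [h3 h4]]]]; first by rewrite add0n !lexx.
  have [[q1 q2] [q3 q4] _ _ _] := sq (k + n)%N.
  by rewrite addSn (le_trans h1)// (le_trans q2)// (le_trans h3)// (le_trans q4).
have cross n m : (s n).1.1 <= (s m).1.2 /\ (s n).2.1 <= (s m).2.2.
  have [a1 [a2 [a3 a4]]] := ndl n m; have [b1 [b2 [b3 b4]]] := ndl m n.
  have [c1 c2 _] := sok (m + n)%N; rewrite addnC in b1 b2 b3 b4.
  split; first by rewrite (le_trans a1)// (le_trans c1).
  by rewrite (le_trans a3)// (le_trans c2).
pose x := sup (range (fun n => (s n).1.1)); pose y := sup (range (fun n => (s n).2.1)).
have xP n : (s n).1.1 <= x <= (s n).1.2.
  apply/andP; split.
    apply: ub_le_sup; last by exists n.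
    by exists (s n).1.2 => _ [m _ <-]; exact: (cross m n).1.
  by apply: ge_sup => [|_ [m _ <-]]; [exists (s 0%N).1.1, 0%N|exact: (cross m n).1].
have yP n : (s n).2.1 <= y <= (s n).2.2.
  apply/andP; split.
    apply: ub_le_sup; last by exists n.
    by exists (s n).2.2 => _ [m _ <-]; exact: (cross m n).2.
  by apply: ge_sup => [|_ [m _ <-]]; [exists (s 0%N).2.1, 0%N|exact: (cross m n).2].
have lenE n : (s n).1.2 - (s n).1.1 = (x1 - x0) / 2 ^+ n /\
              (s n).2.2 - (s n).2.1 = (y1 - y0) / 2 ^+ n.
  elim: n => [|n [h1 h2]]; first by rewrite expr0 !divr1.
  have [_ _ -> -> _] := sq n; rewrite h1 h2 exprSr invfM !mulrA; split; ring.
have bnd n : `|rect_boundary f x0 x1 y0 y1| <=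
    4 ^+ n * `|rect_boundary f (s n).1.1 (s n).1.2 (s n).2.1 (s n).2.2|.
  elim: n => [|n h]; first by rewrite expr0 mul1r.
  have [_ _ _ _ q] := sq n.
  by rewrite (le_trans h)// exprSr -mulrA ler_wpM2l// exprn_ge0.
set L := (x1 - x0) + (y1 - y0).
have L0 : 0 <= L by rewrite addr_ge0 ?subr_ge0.
have main (e : R) : 0 < e -> `|rect_boundary f x0 x1 y0 y1| <= 2 * e * L ^+ 2.
  move=> e0.
  have [d [q [qc qz] fE]] := fh x y (xP 0%N) (yP 0%N).
  have [r r0 qr] := qc e e0.
  have [n nr] : exists n, L / 2 ^+ n < r.
    have := @cvg_geometric R L (2^-1); rewrite ger0_norm ?invr_ge0// invf_lt1// ltr1n.
    move=> /(_ isT) /cvgrPdist_lt /(_ _ r0) [n _ /(_ n (leqnn n))].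
    rewrite sub0r normrN ger0_norm => [h|]; last first.
      by rewrite /geometric/= mulr_ge0// exprn_ge0// invr_ge0.
    by exists n; rewrite -exprVn.
  have [l1 l2] := lenE n.
  have := @rect_boundary_small f _ _ _ _ x y d e r (let: And3 _ _ h := sok n in h)
     (xP n) (yP n) (ltW e0).
  rewrite l1 l2 -mulrDl -/L => h.
  have {h}h : `|rect_boundary f (s n).1.1 (s n).1.2 (s n).2.1 (s n).2.2| <=
      2 * e * (L / 2 ^+ n) ^+ 2.
    apply: h nr => w wr.
    have -> : f w - f (Complex x y) - (w - Complex x y) * d =
        (w - Complex x y) * (q w - d) by rewrite (fE w); ring.
    by rewrite Normc.normcM mulrC (normcB w) ler_wpM2r ?normc_ge0// normcB ltW// qr.
  have p4 : 0 <= 4 ^+ n :> R by rewrite exprn_ge0.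
  rewrite (le_trans (bnd n))// (le_trans (ler_wpM2l p4 h))//.
  rewrite expr_div_n -exprM mulnC exprM (_ : 2 ^+ 2 = 4 :> R); last by ring.
  by rewrite mulrC -!mulrA mulVf ?mulr1// gt_eqF// exprn_gt0.
apply/eqP; rewrite -normr_le0; apply/ler_addgt0Pl => e e0; rewrite addr0.
have d0 : 0 < e / (2 * (L ^+ 2 + 1)) by rewrite divr_gt0// mulr_gt0// ltr_wpDl ?sqr_ge0.
rewrite (le_trans (main _ d0))//.
have -> : 2 * (e / (2 * (L ^+ 2 + 1))) * L ^+ 2 = e * (L ^+ 2 / (L ^+ 2 + 1)).
  by field; rewrite gt_eqF// ltr_wpDl ?sqr_ge0.
by rewrite ler_piMr ?(ltW e0)// ler_pdivrMr ?mul1r ?lerDl// ltr_wpDl ?sqr_ge0.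
Qed.

End Goursat.

Section cexp.
Context {R : realType}.
Local Notation C := R[i].
Local Notation N := (@Normc.normc R).
Local Notation Re := (@complex.Re R).
Local Notation Im := (@complex.Im R).

Lemma near_dist_lt {T : Type} {F : set_system T} {FF : Filter F} (f : T -> R) l e :
  f @ F --> l -> 0 < e -> \forall t \near F, `|l - f t| < e.
Proof. by move=> /cvgrPdist_lt h e0; exact: h. Qed.

Definition cis (t : R) : C := Complex (cos t) (sin t).

Definition cexp (z : C) : C := (expR (Re z))%:C%C * cis (Im z).

Lemma cisD s t : cis (s + t) = cis s * cis t.
Proof.
apply/eqP; rewrite eq_complex /= cosD sinD eqxx /=; apply/eqP; ring.
Qed.

Lemma normc_cis t : N (cis t) = 1.
Proof. by rewrite /= cos2Dsin2 sqrtr1. Qed.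

Lemma cexpD z w : cexp (z + w) = cexp z * cexp w.
Proof. by rewrite /cexp !raddfD /= expRD cisD rmorphM /=; ring. Qed.

Lemma normc_cexp z : N (cexp z) = expR (Re z).
Proof. by rewrite Normc.normcM normc_cis mulr1 normcR gtr0_norm ?expR_gt0. Qed.

Lemma Re_cexp z : Re (cexp z) = expR (Re z) * cos (Im z).
Proof. by rewrite /cexp /= mul0r subr0. Qed.

Lemma Im_cexp z : Im (cexp z) = expR (Re z) * sin (Im z).
Proof. by rewrite /cexp /= mul0r addr0. Qed.

Lemma cexp_neq0 z : cexp z != 0.
Proof. by rewrite -normc_gt0 normc_cexp expR_gt0. Qed.

Lemma is_derive_Caratheodory (f : R -> R) (x l : R) : is_derive x 1 f l ->
  exists q : R -> R, [/\ q y @[y --> x] --> l, q x = l &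
    forall y, f y = f x + (y - x) * q y].
Proof.
move=> [/cvg_ex[/= l' fl] lE].
have {lE} : l' = l by rewrite -lE; apply/esym/(cvg_lim _ fl).
move=> <- {l}; move: l' fl => l fl.
exists (fun y => if y == x then l else (f y - f x) / (y - x)); split.
- apply/cvgrPdist_lt => e e0.
  have := near_dist_lt fl e0; rewrite near_withinE => -[r /= r0 hr].
  apply: filterS (nbhsx_ballx x r r0) => y; rewrite /ball/= distrC => yr.
  have [_|yx] := eqVneq y x; first by rewrite subrr normr0.
  have := hr (y - x); rewrite /ball/= sub0r normrN => /(_ yr).
  rewrite subr_eq0 => /(_ yx).
  by rewrite -[_ *: 1]/((y - x) * 1) mulr1 subrK [_ *: _]mulrC.
- by rewrite eqxx.
- move=> y; have [->|yx] := eqVneq y x; first by rewrite subrr mul0r addr0.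
  by field; rewrite subr_eq0.
Qed.

Lemma cdiff_cexp0 : cdiff cexp 0 1.
Proof.
have [a [ac a0 aE]] := is_derive_Caratheodory (is_derive_expR 0).
have [b [bc b0 bE]] := is_derive_Caratheodory (is_derive_cos 0).
have [c [cc c0 cE]] := is_derive_Caratheodory (is_derive_sin 0).
rewrite expR0 in ac a0; rewrite sin0 oppr0 in bc b0; rewrite cos0 in cc c0.
exists (fun w => if w == 0 then 1 else (cexp w - 1) / w); last first.
  move=> w; rewrite subr0 /cexp /= expR0 mul1r.
  have -> : cis 0 = 1 by rewrite /cis cos0 sin0.
  have [->|w0] := eqVneq w 0; first by rewrite mul0r addr0 expR0 /cis cos0 sin0 mul1r.
  by rewrite [w * _]mulrC divfK// addrC subrK.
split; last by rewrite eqxx.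
move=> e e0.
have Rec : Re w @[w --> nearC (0 : C)] --> (0 : R).
  by apply: (tendsC_Re (@tendsC_id R 0)).
have Imc : Im w @[w --> nearC (0 : C)] --> (0 : R).
  by apply: (tendsC_Im (@tendsC_id R 0)).
have h1 : (fun w : C => a (Re w) * cos (Im w) - 1) w @[w --> nearC (0 : C)] --> (0 : R).
  have -> : 0 = 1 * 1 - 1 :> R by rewrite mulr1 subrr.
  apply: cvgB; last exact: cvg_cst.
  apply: cvgM; first exact: (cvg_comp _ _ Rec ac).
  by have := cvg_comp _ _ Imc (@continuous_cos R 0); rewrite cos0.
have h2 : b (Im w) @[w --> nearC (0 : C)] --> (0 : R) by exact: (cvg_comp _ _ Imc bc).
have h3 : (fun w : C => expR (Re w) * c (Im w) - 1) w @[w --> nearC (0 : C)] --> (0 : R).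
  have -> : 0 = 1 * 1 - 1 :> R by rewrite mulr1 subrr.
  apply: cvgB; last exact: cvg_cst.
  apply: cvgM; last exact: (cvg_comp _ _ Imc cc).
  by have := cvg_comp _ _ Rec (@continuous_expR R 0); rewrite expR0.
have e3 : 0 < e / 4 by rewrite divr_gt0.
near=> w.
have k1 : `|a (Re w) * cos (Im w) - 1| < e / 4.
  rewrite -normrN -sub0r; near: w; exact: (near_dist_lt h1).
have k2 : `|b (Im w)| < e / 4.
  rewrite -normrN -sub0r; near: w; exact: (near_dist_lt h2).
have k3 : `|expR (Re w) * c (Im w) - 1| < e / 4.
  rewrite -normrN -sub0r; near: w; exact: (near_dist_lt h3).
have [_|w0] := eqVneq w 0; first by rewrite subrr Normc.normc0.
have nw : 0 < N w by rewrite normc_gt0.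
rewrite (_ : _ - _ = (w + 1 - cexp w) / w); last by field.
rewrite Normc.normcM Normc.normcV ltr_pdivrMr//.
rewrite (le_lt_trans (normc_leReIm _))//.
have E1 := aE (Re w); have E2 := bE (Im w); have E3 := cE (Im w).
rewrite expR0 subr0 in E1; rewrite cos0 subr0 in E2; rewrite sin0 add0r subr0 in E3.
have -> : Re (w + 1 - cexp w) = - (Re w * (a (Re w) * cos (Im w) - 1) + Im w * b (Im w)).
  have -> : Re (w + 1 - cexp w) = Re w + 1 - Re (cexp w) by case: (w) (cexp w) => ? ? [].
  rewrite Re_cexp E1 mulrDl mul1r {1}E2 /=; ring.
have -> : Im (w + 1 - cexp w) = - (Im w * (expR (Re w) * c (Im w) - 1)).
  have -> : Im (w + 1 - cexp w) = Im w + 0 - Im (cexp w) by case: (w) (cexp w) => ? ? [].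
  rewrite Im_cexp E3 /=; ring.
rewrite !normrN.
have := ler_normD (Re w * (a (Re w) * cos (Im w) - 1)) (Im w * b (Im w)).
rewrite !normrM => h.
have hr := normc_geRe w; have hi := normc_geIm w.
have g1 : `|Re w| * `|a (Re w) * cos (Im w) - 1| <= N w * (e / 4).
  by rewrite ler_pM// ltW.
have g2 : `|Im w| * `|b (Im w)| <= N w * (e / 4) by rewrite ler_pM// ltW.
have g3 : `|Im w| * `|expR (Re w) * c (Im w) - 1| <= N w * (e / 4) by rewrite ler_pM// ltW.
have : 0 < N w * (e / 4) by rewrite mulr_gt0.
lra.
Unshelve. all: by end_near. Qed.

Lemma cdiff_cexp z : cdiff cexp z (cexp z).
Proof.
have h : cdiff (fun w => w - z) z (1 - 0) by apply: cdiffB; [exact: cdiff_id|exact: cdiff_cst].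
have := @cdiff_comp _ (fun w => w - z) cexp z (1 - 0) 1 h.
rewrite subrr => /(_ cdiff_cexp0) /(cdiffZ (cexp z)).
rewrite mul1r subr0 mulr1; apply: cdiff_ext => w.
by rewrite -cexpD addrC subrK.
Qed.

Lemma cexp_Complex (x y : R) : cexp (Complex x y) = (expR x)%:C%C * cis y.
Proof. by []. Qed.

End cexp.

Section circle_mean.
Context {R : realType}.
Local Notation C := R[i].
Local Notation N := (@Normc.normc R).
Local Notation Re := (@complex.Re R).
Local Notation Im := (@complex.Im R).

Definition tau : R := pi *+ 2.

Lemma tau_gt0 : 0 < tau.
Proof. by rewrite /tau pmulrn_lgt0// pi_gt0. Qed.

Lemma cis_tau (t : R) : cis (t + tau) = cis t.
Proof. by rewrite /cis cosD2pi sinD2pi. Qed.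

Lemma cis0 : cis (0 : R) = 1.
Proof. by rewrite /cis cos0 sin0. Qed.

Definition circ (c : C) (r t : R) : C := c + r%:C%C * cis t.

Lemma normc_circ c r t : 0 <= r -> N (circ c r t - c) = r.
Proof.
by move=> r0; rewrite /circ addrC addKr Normc.normcM normc_cis mulr1 normcR ger0_norm.
Qed.

Lemma tends_circ {T : Type} {F : set_system T} {FF : Filter F} (u v : T -> R) c r t :
  u @ F --> r -> v @ F --> t -> tendsC F (fun x => circ c (u x) (v x)) (circ c r t).
Proof.
move=> ur vt; apply: tendsCD; first exact: tendsC_cst.
apply: tendsCM; apply: tendsC_Complex => //.
- exact: cvg_cst.
- exact: (cvg_comp _ _ vt (@continuous_cos R t)).
- exact: (cvg_comp _ _ vt (@continuous_sin R t)).
Qed.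

Definition cont_ball (g : C -> R) (c : C) (r : R) :=
  forall z, N (z - c) <= r -> g w @[w --> nearC z] --> g z.

Lemma cont_ball_circ g c r s : cont_ball g c r -> 0 <= s <= r ->
  forall t, {for t, continuous (fun t => g (circ c s t))}.
Proof.
move=> gc /andP[s0 sr] t.
apply: (@cvg_tendsC _ _ _ _ g (circ c s)).
  by apply: gc; rewrite normc_circ.
by apply: tends_circ; [exact: cvg_cst|exact: cvg_id].
Qed.

Lemma tendsC_fst {T U : Type} {F : set_system T} {FF : Filter F} (G : set_system U)
  {FG : Filter G} (f : T -> C) l :
  tendsC F f l -> tendsC (filter_prod F G) (fun p => f p.1) l.
Proof.
move=> fl e /fl h; have : fst @ filter_prod F G --> F by exact: cvg_fst.
by move=> /(_ _ h).
Qed.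

Lemma tendsC_snd {T U : Type} {F : set_system T} {FF : Filter F} (G : set_system U)
  {FG : Filter G} (f : U -> C) l :
  tendsC G f l -> tendsC (filter_prod F G) (fun p => f p.2) l.
Proof.
move=> fl e /fl h; have : snd @ filter_prod F G --> G by exact: cvg_snd.
by move=> /(_ _ h).
Qed.

Definition contR (f : R -> C) := forall t, tendsC (nbhs t) f (f t).

Lemma near_unif {T : Type} {F : set_system T} {FF : Filter F} (B : R -> T -> C) (B0 : R -> C) e :
  contR B0 -> (forall t, tendsC (filter_prod (nbhs t) F) (fun p => B p.1 p.2) (B0 t)) ->
  0 < e -> \forall v \near F, forall t, 0 <= t <= tau -> N (B0 t - B t v) < e.
Proof.
move=> B0c BB0 e0; apply: near_segment => t _.
have e2 : 0 < e / 2 by rewrite divr_gt0.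
have h1 := BB0 t _ e2.
have h2 : \forall p \near filter_prod (nbhs t) F, N (B0 t - B0 p.1) < e / 2.
  have h : tendsC (filter_prod (nbhs t) F) (fun p => B0 p.1) (B0 t).
    exact: tendsC_fst (B0c t).
  exact: h.
near=> p => /=.
rewrite (le_lt_trans (normc_triangle _ _ (B0 t)))// (splitr e) ltrD//.
  by rewrite normcB; near: p.
by near: p.
Unshelve. all: by end_near. Qed.

Lemma cont_circ_mean g c (r s e : R) : cont_ball g c r -> 0 <= s <= r -> 0 < e ->
  exists2 d, 0 < d & forall s', 0 <= s' <= r -> `|s - s'| < d ->
    `|segint 0 tau (fun t => g (circ c s t)) - segint 0 tau (fun t => g (circ c s' t))| < e.
Proof.
move=> gc si e0.
pose F := within (fun x : R => 0 <= x <= r) (nbhs s).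
have FF : Filter F by exact: within_filter.
have : (fun s' => segint 0 tau (fun t => g (circ c s' t))) @ F -->
       segint 0 tau (fun t => g (circ c s t)).
  apply: segint_cvg; first exact: (ltW tau_gt0).
  - rewrite /F near_withinE; apply: nearW => s' s'r x _.
    exact: (cont_ball_circ gc s'r).
  - by move=> x _; exact: (cont_ball_circ gc si).
  - move=> e'; have u := @near_unif _ F FF (fun t s' => (g (circ c s' t))%:C%C).
    move=> /(u (fun t => (g (circ c s t))%:C%C)) h; apply: filterS (h _ _) => [s' h' t /h'|t|t].
    + by rewrite -rmorphB normcR.
    + by apply: tendsC_Complex; [exact: (cont_ball_circ gc si)|exact: cvg_cst].
    apply: tendsC_Complex; last exact: cvg_cst.
    apply: (@cvg_tendsC _ _ _ _ g (fun p => circ c p.2 p.1)).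
      by apply: gc; rewrite normc_circ//; case/andP: si.
    apply: tends_circ; last exact: cvg_fst.
    by move=> A sA; apply: cvg_snd; exact: cvg_within.
move=> /near_dist_lt /(_ e0); rewrite near_withinE => -[d /= d0 dP].
by exists d => // s' s'r ss'; apply: dP.
Qed.

Lemma const_from_within (g : R -> R) (u v r : R) : 0 <= u -> u < v -> v <= r ->
  (forall s e, 0 <= s <= r -> 0 < e -> exists2 d, 0 < d &
     forall s', 0 <= s' <= r -> `|s - s'| < d -> `|g s - g s'| < e) ->
  (forall x y, u < x -> x <= y -> y < v -> g x = g y) -> g u = g v.
Proof.
move=> u0 uv vr gc gE; apply/eqP; rewrite -subr_eq0 -normr_le0.
apply/ler_addgt0Pl => e e0; rewrite addr0.
have e2 : 0 < e / 2 by rewrite divr_gt0.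
have [|d d0 dP] := gc u (e / 2) _ e2; first by apply/andP; split; lra.
have [|d' d'0 d'P] := gc v (e / 2) _ e2; first by apply/andP; split; lra.
pose m := Num.min (Num.min d d') (v - u).
have m0 : 0 < m by rewrite !lt_min d0 d'0 subr_gt0.
have md : m <= d by rewrite /m !ge_min lexx.
have md' : m <= d' by rewrite /m !ge_min lexx orbT.
have muv : m <= v - u by rewrite /m !ge_min lexx orbT.
have h1 : `|g u - g (u + m / 2)| < e / 2.
  apply: dP; first by apply/andP; split; lra.
  by rewrite opprD addrA subrr add0r normrN gtr0_norm; lra.
have h2 : `|g v - g (v - m / 2)| < e / 2.
  apply: d'P; first by apply/andP; split; lra.
  by rewrite opprD addrA subrr add0r opprK gtr0_norm; lra.
have h3 : g (u + m / 2) = g (v - m / 2) by apply: gE; lra.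
rewrite h3 in h1; rewrite distrC in h2.
rewrite (_ : g u - g v = (g u - g (v - m / 2)) + (g (v - m / 2) - g v)); last by ring.
by rewrite (le_trans (ler_normD _ _))// (splitr e) lerD// ltW.
Qed.

Lemma const_off_point (g : R -> R) (b r : R) : 0 < r ->
  (forall s e, 0 <= s <= r -> 0 < e -> exists2 d, 0 < d &
     forall s', 0 <= s' <= r -> `|s - s'| < d -> `|g s - g s'| < e) ->
  (forall x y, 0 < x -> x <= y -> y <= r -> ~~ (x <= b <= y) -> g x = g y) ->
  g 0 = g r.
Proof.
move=> r0 gc gE.
have [b0|b0] := lerP b 0.
  apply: (const_from_within (lexx 0) r0 (lexx r) gc) => x y x0 xy yr.
  by apply: gE => //; [exact: ltW|rewrite negb_and -ltNge (le_lt_trans b0)].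
have [rb|br] := lerP r b.
  apply: (const_from_within (lexx 0) r0 (lexx r) gc) => x y x0 xy yr.
  apply: gE => //; [exact: ltW|rewrite negb_and orbC -!ltNge (lt_le_trans yr)//].
transitivity (g b).
  apply: (const_from_within (lexx 0) b0 (ltW br) gc) => x y x0 xy yb.
  apply: gE => //; first by rewrite ltW// (lt_trans yb).
  by rewrite negb_and orbC -!ltNge yb.
apply: (const_from_within (ltW b0) br (lexx r) gc) => x y x0 xy yr.
apply: gE => //; [exact: lt_trans x0|exact: ltW|].
by rewrite negb_and -!ltNge x0.
Qed.

(* Cauchy's theorem on the rectangle [ln x, ln y] x [0, 2 pi] for
   [f (c + exp z)]: the horizontal sides cancel by periodicity. *)
Lemma circ_mean_annulus (f : C -> C) c x y : 0 < x -> x <= y ->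
  (forall z, x <= N (z - c) <= y -> exists d, cdiff f z d) ->
  segint 0 tau (fun t => Re (f (circ c x t))) = segint 0 tau (fun t => Re (f (circ c y t))).
Proof.
move=> x0 xy fh; have y0 : 0 < y by exact: lt_le_trans xy.
pose g z := f (c + cexp z).
have gE s t : 0 < s -> g (Complex (ln s) t) = f (circ c s t).
  by move=> s0; rewrite /g cexp_Complex lnK.
have lxy : ln x <= ln y by rewrite ler_ln.
have gh : holo_rect g (ln x) (ln y) 0 tau.
  move=> s t /andP[sx sy] _.
  have [|d fd] := fh (c + cexp (Complex s t)).
    rewrite addrC addKr normc_cexp /=.
    have -> : x = expR (ln x) by rewrite lnK.
    have -> : y = expR (ln y) by rewrite lnK.
    by rewrite !ler_expR sx.
  exists (d * (0 + cexp (Complex s t))).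
  apply: (@cdiff_comp _ (fun z => c + cexp z) f) => //.
  by apply: cdiffD; [exact: cdiff_cst|exact: cdiff_cexp].
have := goursat lxy (ltW tau_gt0) gh; rewrite /rect_boundary.
have -> : (fun z => Im (g (Complex z tau))) = (fun z => Im (g (Complex z 0))).
  by apply/funext => z; rewrite /g !cexp_Complex -[tau]add0r cis_tau.
have -> : segint 0 tau (fun t => Re (g (Complex (ln x) t))) =
    segint 0 tau (fun t => Re (f (circ c x t))).
  by apply: eq_segint => t _; rewrite gE.
have -> : segint 0 tau (fun t => Re (g (Complex (ln y) t))) =
    segint 0 tau (fun t => Re (f (circ c y t))).
  by apply: eq_segint => t _; rewrite gE.
set A := segint 0 tau _; set B := segint 0 tau _; set D := segint _ _ _.
by clearbody A B D; lra.
Qed.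

Lemma mean_value_Re (f : C -> C) c b r : 0 < r ->
  (forall z, N (z - c) <= r -> tendsC (nearC z) f (f z)) ->
  (forall z, N (z - c) <= r -> z != c -> z != b -> exists d, cdiff f z d) ->
  segint 0 tau (fun t => Re (f (circ c r t))) = tau * Re (f c).
Proof.
move=> r0 fc fd.
have gc : cont_ball (fun z => Re (f z)) c r.
  by move=> z zr; apply: tendsC_Re; exact: fc.
have := @const_off_point (fun s => segint 0 tau (fun t => Re (f (circ c s t)))) (N (b - c)) r r0.
have h1 s e : 0 <= s <= r -> 0 < e -> exists2 d, 0 < d &
     forall s', 0 <= s' <= r -> `|s - s'| < d ->
     `|segint 0 tau (fun t => Re (f (circ c s t))) - segint 0 tau (fun t => Re (f (circ c s' t)))| < e.
  exact: cont_circ_mean gc.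
move=> /(_ h1) <-.
  rewrite (eq_segint (g := fun=> Re (f c))).
    by rewrite segint_cst ?(ltW tau_gt0)// subr0 mulrC.
  by move=> t _; rewrite /circ mul0r addr0.
move=> x y x0 xy yr xby; apply: circ_mean_annulus => // z /andP[xz zy].
apply: fd; first exact: le_trans yr.
  by rewrite -subr_eq0 -normc_gt0 (lt_le_trans x0).
by apply: contraNneq xby => <-; rewrite xz.
Qed.

Definition cmean (f : R -> C) : C :=
  Complex (segint 0 tau (fun t => Re (f t)) / tau) (segint 0 tau (fun t => Im (f t)) / tau).

Lemma contR_Re f a b : contR f -> contI a b (fun t => Re (f t)).
Proof. by move=> fc t _; exact: tendsC_Re (fc t). Qed.

Lemma contR_Im f a b : contR f -> contI a b (fun t => Im (f t)).
Proof. by move=> fc t _; exact: tendsC_Im (fc t). Qed.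

Lemma contR_circ c r : contR (circ c r).
Proof. by move=> t; apply: tends_circ; [exact: cvg_cst|exact: cvg_id]. Qed.

Lemma cmeanD f g : contR f -> contR g -> cmean (fun t => f t + g t) = cmean f + cmean g.
Proof.
move=> fc gc; rewrite /cmean.
rewrite (eq_segint (g := fun t => Re (f t) + Re (g t))); last first.
  by move=> t _; case: (f t) (g t) => ? ? [].
rewrite [X in Complex _ (X / _)](eq_segint (g := fun t => Im (f t) + Im (g t))); last first.
  by move=> t _; case: (f t) (g t) => ? ? [].
by rewrite !segintD ?mulrDl//; do ?[exact: contR_Re|exact: contR_Im].
Qed.

Lemma cmeanZ c f : contR f -> cmean (fun t => c * f t) = c * cmean f.
Proof.
move=> fc; rewrite /cmean; case: c => a b.
rewrite (eq_segint (g := fun t => a * Re (f t) - b * Im (f t))); last first.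
  by move=> t _; case: (f t).
rewrite [X in Complex _ (X / _)](eq_segint (g := fun t => a * Im (f t) + b * Re (f t))); last first.
  by move=> t _; case: (f t).
have hr x : contI 0 tau (fun t => x * Re (f t)).
  by apply: contIM; [exact: contI_cst|exact: contR_Re].
have hi x : contI 0 tau (fun t => x * Im (f t)).
  by apply: contIM; [exact: contI_cst|exact: contR_Im].
rewrite segintB// segintD// !segintZ; do ?[exact: contR_Re|exact: contR_Im].
by apply/eqP; rewrite eq_complex /=; apply/andP; split; apply/eqP; ring.
Qed.

Lemma eq_cmean f g : (forall t, f t = g t) -> cmean f = cmean g.
Proof. by move=> /funext ->. Qed.

Lemma mean_value (f : C -> C) c b r : 0 < r ->
  (forall z, N (z - c) <= r -> tendsC (nearC z) f (f z)) ->
  (forall z, N (z - c) <= r -> z != c -> z != b -> exists d, cdiff f z d) ->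
  cmean (fun t => f (circ c r t)) = f c.
Proof.
move=> r0 fc fd; rewrite /cmean (mean_value_Re r0 fc fd).
have tau0 : tau != 0 by rewrite gt_eqF// tau_gt0.
have ReIm z : Im z = Re (Complex 0 (-1) * z) by case: z => x y /=; ring.
rewrite (eq_segint (g := fun t => Re (Complex 0 (-1) * f (circ c r t)))); last first.
  by move=> t _; rewrite ReIm.
rewrite (@mean_value_Re (fun z => Complex 0 (-1) * f z) c b r)//.
- rewrite -ReIm ![tau * _]mulrC !mulfK//; by case: (f c).
- move=> z zr; apply: tendsCM (fc _ zr); exact: tendsC_cst.
- move=> z zr zc zb; have [d fzd] := fd z zr zc zb.
  by exists (Complex 0 (-1) * d); exact: cdiffZ.
Qed.

Lemma tends_cmean {T : Type} {F : set_system T} {FF : Filter F} (B : R -> T -> C) (B0 : R -> C) :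
  (\forall v \near F, contR (B ^~ v)) -> contR B0 ->
  (forall t, tendsC (filter_prod (nbhs t) F) (fun p => B p.1 p.2) (B0 t)) ->
  tendsC F (fun v => cmean (B ^~ v)) (cmean B0).
Proof.
move=> Bc B0c BB0.
have key e (e0 : 0 < e) : \forall v \near F, forall t, 0 <= t <= tau -> N (B0 t - B t v) < e.
  exact: near_unif B0c BB0 e0.
apply: tendsC_Complex; apply: cvgMl; apply: segint_cvg; rewrite ?(ltW tau_gt0)//.
- by apply: filterS Bc => v; exact: contR_Re.
- exact: contR_Re.
- move=> e /key; apply: filterS => v h t /h; apply: le_lt_trans.
  by rewrite (le_trans _ (normc_geRe _))//; case: (B0 t) (B t v) => ? ? [].
- by apply: filterS Bc => v; exact: contR_Im.
- exact: contR_Im.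
- move=> e /key; apply: filterS => v h t /h; apply: le_lt_trans.
  by rewrite (le_trans _ (normc_geIm _))//; case: (B0 t) (B t v) => ? ? [].
Qed.

End circle_mean.

Section Cauchy.
Context {R : realType}.
Local Notation C := R[i].
Local Notation N := (@Normc.normc R).
Local Notation Re := (@complex.Re R).
Local Notation Im := (@complex.Im R).
Local Notation circ := (@circ R 0).

Definition cdble (f : C -> C) z := exists d, cdiff f z d.

Lemma cdble_cst (c : C) z : cdble (fun=> c) z.
Proof. by exists 0; exact: cdiff_cst. Qed.

Lemma cdble_id (z : C) : cdble (fun w => w) z.
Proof. by exists 1; exact: cdiff_id. Qed.

Lemma cdbleB (f g : C -> C) z : cdble f z -> cdble g z -> cdble (fun w => f w - g w) z.
Proof. by move=> [d fd] [e ge]; exists (d - e); exact: cdiffB. Qed.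

Lemma cdbleM (f g : C -> C) z : cdble f z -> cdble g z -> cdble (fun w => f w * g w) z.
Proof. by move=> [d fd] [e ge]; exists (d * g z + f z * e); exact: cdiffM. Qed.

Lemma cdbleV (f : C -> C) z : cdble f z -> f z != 0 -> cdble (fun w => (f w)^-1) z.
Proof. by move=> [d fd] f0; exists (- d / f z ^+ 2); exact: cdiffV. Qed.

Lemma cdbleX (f : C -> C) n z : cdble f z -> cdble (fun w => f w ^+ n) z.
Proof.
move=> fd; elim: n => [|n ih].
  have -> : (fun w => f w ^+ 0) = fun=> 1 by apply/funext => w; rewrite expr0.
  exact: cdble_cst.
have -> : (fun w => f w ^+ n.+1) = fun w => f w * f w ^+ n.
  by apply/funext => w; rewrite exprS.
exact: cdbleM.
Qed.

Lemma cdble_comp (f g : C -> C) z : cdble f z -> cdble g (f z) -> cdble (fun w => g (f w)) z.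
Proof. by move=> [d fd] [e ge]; exists (e * d); exact: cdiff_comp. Qed.

Lemma cdble_near (f g : C -> C) z : (\forall w \near nearC z, f w = g w) ->
  cdble f z -> cdble g z.
Proof. by move=> fg [d fd]; exists d; exact: cdiff_near fd. Qed.

Lemma cdble_cont (f : C -> C) z : cdble f z -> tendsC (nearC z) f (f z).
Proof. by case=> d; exact: cdiff_cont. Qed.

Lemma contRM f g : contR f -> contR g -> contR (fun t => f t * g t : C).
Proof. by move=> fc gc t; apply: tendsCM; [exact: fc|exact: gc]. Qed.

Lemma contRV f : contR f -> (forall t, f t != 0) -> contR (fun t => (f t)^-1 : C).
Proof. by move=> fc f0 t; apply: tendsCV; [exact: fc|exact: f0]. Qed.

Lemma contRD f g : contR f -> contR g -> contR (fun t => f t + g t : C).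
Proof. by move=> fc gc t; apply: tendsCD; [exact: fc|exact: gc]. Qed.

Lemma contR_cst (c : C) : contR (fun=> c : C).
Proof. by move=> t; exact: tendsC_cst. Qed.

Lemma contR_comp (f : C -> C) g : contR g ->
  (forall t, tendsC (nearC (g t)) f (f (g t))) -> contR (fun t => f (g t)).
Proof. by move=> gc fc t; apply: tendsC_comp (gc t) (fc t). Qed.

Lemma cmeanB f g : contR f -> contR g ->
  cmean (fun t => f t - g t) = cmean f - cmean g :> C.
Proof.
move=> fc gc; rewrite (@eq_cmean _ _ (fun t => f t + (-1) * g t)); last first.
  by move=> t; rewrite mulN1r.
have g' : contR (fun t => -1 * g t) by apply: contRM => //; exact: contR_cst.
by rewrite (cmeanD fc g') cmeanZ// mulN1r.
Qed.

Lemma cdiff_cmean (B Q : R -> C -> C) z :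
  (\forall v \near nearC z, forall t, B t v = B t z + (v - z) * Q t v) ->
  (\forall v \near nearC z, contR (B ^~ v)) ->
  (\forall v \near nearC z, contR (Q ^~ v)) ->
  (forall t, tendsC (filter_prod (nbhs t) (nearC z)) (fun p => Q p.1 p.2) (Q t z)) ->
  cdiff (fun v => cmean (B ^~ v)) z (cmean (Q ^~ z)).
Proof.
move=> BE Bc Qc Qt; apply: (@cdiff_nearI _ _ (fun v => cmean (Q ^~ v))); last first.
  by apply: tends_cmean => //; exact: nearC_singleton Qc.
have Bz : contR (B ^~ z) by exact: nearC_singleton Bc.
near=> v; have Qv : contR (Q ^~ v) by near: v.
rewrite -cmeanZ// -cmeanD//; last by apply: contRM => //; exact: contR_cst.
by apply: eq_cmean; near: v.
Unshelve. all: by end_near. Qed.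

Lemma circ_sub_neq0 r z t : N z < r -> circ r t - z != 0.
Proof.
move=> zr; rewrite subr_eq0; apply: contraTneq zr => <-.
have [r0|r0] := lerP 0 r; last by rewrite -leNgt (le_trans (ltW r0))// normc_ge0.
by rewrite -leNgt -[circ r t]subr0 normc_circ.
Qed.

Lemma near_normc_lt (z : C) r : N z < r -> \forall v \near nearC z, N v < r.
Proof.
move=> zr; have d0 : 0 < r - N z by rewrite subr_gt0.
apply: filterS (near_normc z d0) => v h.
have := ler_normc_dist v z; rewrite ler_norml normcB => /andP[_]; lra.
Qed.

Lemma contR_kernel r z : N z < r -> contR (fun t => (circ r t - z)^-1).
Proof.
move=> zr; apply: contRV => [|t]; last exact: circ_sub_neq0.
by move=> t; apply: tendsCB; [exact: contR_circ|exact: tendsC_cst].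
Qed.

Lemma tends_kernel r z t : N z < r ->
  tendsC (filter_prod (nbhs t) (nearC z)) (fun p => (circ r p.1 - p.2)^-1) (circ r t - z)^-1.
Proof.
move=> zr; apply: tendsCV; last exact: circ_sub_neq0.
apply: tendsCB; first by apply: (tendsC_fst (f := circ r)); exact: contR_circ.
by apply: (tendsC_snd (f := id)); exact: tendsC_id.
Qed.

Lemma cdiff_kernel1 A r z : contR A -> N z < r ->
  cdiff (fun v => cmean (fun t => A t * (circ r t - v)^-1)) z
        (cmean (fun t => A t * ((circ r t - z)^-1 * (circ r t - z)^-1))).
Proof.
move=> Ac zr; have zn := near_normc_lt zr.
apply: (@cdiff_cmean (fun t v => A t * (circ r t - v)^-1)
  (fun t v => A t * ((circ r t - v)^-1 * (circ r t - z)^-1))).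
- apply: filterS zn => v vr t.
  by field; rewrite !circ_sub_neq0.
- by apply: filterS zn => v vr; apply: contRM => //; exact: contR_kernel.
- apply: filterS zn => v vr; apply: contRM => //.
  by apply: contRM; exact: contR_kernel.
- move=> t; apply: tendsCM; first by apply: (tendsC_fst (f := A)); exact: Ac.
  apply: tendsCM; first exact: tends_kernel.
  by apply: (tendsC_fst (f := fun t => (circ r t - z)^-1)); exact: contR_kernel.
Qed.

Lemma cdiff_kernel2 A r z : contR A -> N z < r -> exists d,
  cdiff (fun v => cmean (fun t => A t * ((circ r t - v)^-1 * (circ r t - v)^-1))) z d.
Proof.
move=> Ac zr; have zn := near_normc_lt zr.
exists (cmean (fun t => A t * ((circ r t - z)^-1 * (circ r t - z)^-1 * (circ r t - z)^-1 +
  (circ r t - z)^-1 * (circ r t - z)^-1 * (circ r t - z)^-1))).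
apply: (@cdiff_cmean (fun t v => A t * ((circ r t - v)^-1 * (circ r t - v)^-1))
  (fun t v => A t * ((circ r t - v)^-1 * (circ r t - v)^-1 * (circ r t - z)^-1 +
      (circ r t - v)^-1 * (circ r t - z)^-1 * (circ r t - z)^-1))).
- apply: filterS zn => v vr t.
  by field; rewrite !circ_sub_neq0.
- apply: filterS zn => v vr; apply: contRM => //.
  by apply: contRM; exact: contR_kernel.
- apply: filterS zn => v vr; apply: contRM => //.
  by apply: contRD; apply: contRM; try apply: contRM; exact: contR_kernel.
- move=> t; apply: tendsCM; first by apply: (tendsC_fst (f := A)); exact: Ac.
  have h := @tends_kernel _ _ t zr.
  have h' : tendsC (filter_prod (nbhs t) (nearC z)) (fun p => (circ r p.1 - z)^-1) (circ r t - z)^-1.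
    by apply: (tendsC_fst (f := fun t => (circ r t - z)^-1)); exact: contR_kernel.
  by apply: tendsCD; exact: (tendsCM (tendsCM _ _) _).
Qed.

Lemma cdiff_unique (f : C -> C) z d e : cdiff f z d -> cdiff f z e -> d = e.
Proof. by move=> df de; exact: etrans (esym (cdiff_derive1 df)) (cdiff_derive1 de). Qed.

Definition holoD (f : C -> C) := forall z, N z < 1 -> cdble f z.

Lemma cmean_conj f : contR f -> cmean (fun t => conjc (f t)) = conjc (cmean f : C).
Proof.
move=> fc; rewrite /cmean /=.
rewrite (eq_segint (g := fun t => Re (f t))); last by move=> t _; case: (f t).
rewrite [X in Complex _ (X / _)](eq_segint (g := fun t => - Im (f t))); last first.
  by move=> t _; case: (f t).
by rewrite segintN ?mulNr//; exact: contR_Im.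
Qed.

(* On the circle, [conj w = r ^ 2 / w], so the kernel is the conjugate of a
   function that is holomorphic in the disk. *)
Lemma cmean_kernel r z : 0 < r -> N z < r ->
  cmean (fun t => circ r t * (circ r t - z)^-1) = 1.
Proof.
move=> r0 zr; pose k w : C := (1 - conjc z / (r ^+ 2)%:C%C * w)^-1.
have k0 w : N (w - 0) <= r -> 1 - conjc z / (r ^+ 2)%:C%C * w != 0.
  rewrite subr0 => wr; rewrite subr_eq0; apply/eqP => h.
  have : N (conjc z / (r ^+ 2)%:C%C * w) < 1.
    rewrite Normc.normcM Normc.normcM Normc.normcV normcR normc_conj.
    rewrite ger0_norm ?sqr_ge0// mulrAC ltr_pdivrMr ?exprn_gt0// mul1r expr2.
    rewrite (le_lt_trans (ler_wpM2l (normc_ge0 _) wr))//.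
    by rewrite ltr_pM2r.
  by rewrite -h Normc.normc1 ltxx.
have kd w : N (w - 0) <= r -> cdble k w.
  move=> wr.
  apply: (@cdbleV (fun w => 1 - conjc z / (r ^+ 2)%:C%C * w)); last exact: k0.
  apply: cdbleB; first exact: cdble_cst.
  by apply: cdbleM; [exact: cdble_cst|exact: cdble_id].
have kc w : N (w - 0) <= r -> tendsC (nearC w) k (k w).
  by move=> /kd; exact: cdble_cont.
have : cmean (fun t => k (circ r t)) = k 0.
  by apply: (@mean_value _ k 0 0 r r0) => // w wr _ _; exact: kd.
rewrite /k mulr0 subr0 invr1 => h.
rewrite -[RHS]conjc1 -h -cmean_conj; last first.
  apply: (@contR_comp k (circ r)); first exact: contR_circ.
  by move=> t; apply: kc; rewrite normc_circ// ltW.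
apply: eq_cmean => t.
have -> : conjc ((1 - conjc z / (r ^+ 2)%:C%C * circ r t)^-1) =
    (1 - z / (r ^+ 2)%:C%C * conjc (circ r t))^-1.
  rewrite conjc_inv; congr (_^-1); case: (z) (circ r t) => z1 z2 [w1 w2].
  apply/eqP; rewrite eq_complex /=; apply/andP; split; apply/eqP; ring.
have w0 : circ r t != 0 by rewrite -[circ r t]subr0 circ_sub_neq0// Normc.normc0.
have ww : circ r t * conjc (circ r t) = (r ^+ 2)%:C%C.
  have -> : circ r t * conjc (circ r t) = (N (circ r t) ^+ 2)%:C%C.
    rewrite normc_sqr; case: (circ r t) => a b.
    by apply/eqP; rewrite eq_complex /=; apply/andP; split; apply/eqP; ring.
  by rewrite -[circ r t]subr0 normc_circ// ltW.
have cw0 : conjc (circ r t) != 0 by rewrite conjc_eq0.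
rewrite -ww (_ : 1 - _ = (circ r t - z) / circ r t); last by field; rewrite w0 cw0.
by rewrite invf_div.
Qed.

Lemma cauchy_formula f r z : holoD f -> 0 < r -> r < 1 -> N z < r ->
  f z = cmean (fun t => f (circ r t) * circ r t * (circ r t - z)^-1).
Proof.
move=> fh r0 r1 zr.
have [d [q [qc qz] fE]] := fh z (lt_trans zr r1).
have cc : contR (circ r) by exact: contR_circ.
have fhr w : N (w - 0) <= r -> cdble f w.
  by rewrite subr0 => wr; apply: fh; exact: le_lt_trans r1.
have qd w : w != z -> N (w - 0) <= r -> cdble q w.
  move=> wz /fhr fw.
  have h : cdble (fun v => (f v - f z) * (v - z)^-1) w.
    apply: cdbleM; first by apply: cdbleB fw _; exact: cdble_cst.
    apply: cdbleV; last by rewrite subr_eq0.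
    by apply: cdbleB; [exact: cdble_id|exact: cdble_cst].
  apply: cdble_near h.
  have wz0 : 0 < N (w - z) by rewrite normc_gt0 subr_eq0.
  apply: filterS (near_normc w wz0) => v.
  have [->|vz] := eqVneq v z; first by rewrite ltxx.
  by move=> _; rewrite (fE v); field; rewrite subr_eq0.
have Qc w : N (w - 0) <= r -> tendsC (nearC w) (fun v => v * q v) (w * q w).
  move=> wr; apply: tendsCM; first exact: tendsC_id.
  have [->|wz] := eqVneq w z; first by rewrite qz.
  exact: cdble_cont (qd _ wz wr).
have : cmean (fun t => circ r t * q (circ r t)) = 0 * q 0.
  apply: (@mean_value _ (fun v => v * q v) 0 z r r0) => // w wr _ wz.
  by apply: (cdbleM (@cdble_id w)); exact: qd.
rewrite mul0r => Q0.
have circr t : N (circ r t - 0) <= r by rewrite normc_circ// ltW.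
have fcc : contR (fun t => f (circ r t)).
  by apply: (@contR_comp f (circ r)) => // t; exact: cdble_cont (fhr _ (circr t)).
have kk : contR (fun t => circ r t * (circ r t - z)^-1).
  by apply: contRM => //; exact: contR_kernel.
rewrite (@eq_cmean _ _ (fun t => circ r t * q (circ r t) +
   f z * (circ r t * (circ r t - z)^-1))).
  rewrite cmeanD//; last 2 first.
  - apply: contRM => //; move=> t.
    have qct : tendsC (nearC (circ r t)) q (q (circ r t)).
      have [->|wz] := eqVneq (circ r t) z; first by rewrite qz.
      exact: cdble_cont (qd _ wz (circr t)).
    exact: tendsC_comp (cc t) qct.
  - by apply: contRM => //; exact: contR_cst.
  by rewrite Q0 add0r cmeanZ// cmean_kernel// mulr1.
move=> t; rewrite (fE (circ r t)); field.
exact: circ_sub_neq0.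
Qed.

Lemma holoD_circ f r : holoD f -> 0 < r -> r < 1 -> contR (fun t => f (circ r t)).
Proof.
move=> fh r0 r1; apply: (@contR_comp f (circ r)); first exact: contR_circ.
move=> t; apply: cdble_cont; apply: fh.
by rewrite -[circ r t]subr0 normc_circ// ltW.
Qed.

Lemma between1 (z : C) : N z < 1 -> exists r, [/\ 0 < r, r < 1 & N z < r].
Proof.
move=> z1; exists ((N z + 1) / 2); have := normc_ge0 z.
by split; lra.
Qed.

Lemma holoD_deriv (f : C -> C) : holoD f ->
  exists2 g : C -> C, holoD g & forall z, N z < 1 -> cdiff f z (g z).
Proof.
move=> fh.
have /choice[g gP] : forall z, exists d, N z < 1 -> cdiff f z d.
  move=> z; have [/fh[d fd]|z1] := pselect (N z < 1); first by exists d.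
  by exists 0.
exists g => // z z1; have [r [r0 r1 zr]] := between1 z1.
pose A t := f (circ r t) * circ r t.
have Ac : contR A by apply: contRM; [exact: holoD_circ|exact: contR_circ].
have [d hd] := cdiff_kernel2 Ac zr.
exists d; apply: cdiff_near hd; apply: filterS (near_normc_lt zr) => v vr.
apply: cdiff_unique (gP v (lt_trans vr r1)).
apply: cdiff_near (cdiff_kernel1 Ac vr).
by apply: filterS (near_normc_lt vr) => w wr; rewrite -cauchy_formula.
Qed.

Lemma holoD_slope (f : C -> C) a : holoD f -> N a < 1 -> f a = 0 ->
  exists2 g : C -> C, holoD g & forall z, N z < 1 -> f z = (z - a) * g z.
Proof.
move=> fh a1 fa; have [d [q [qc qa] fE]] := fh a a1.
exists q => [z z1|z z1]; last by rewrite fE fa add0r.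
have [->|za] := eqVneq z a; last first.
  have h : cdble (fun v => f v * (v - a)^-1) z.
    apply: cdbleM; first exact: fh.
    apply: cdbleV; last by rewrite subr_eq0.
    by apply: cdbleB; [exact: cdble_id|exact: cdble_cst].
  apply: cdble_near h.
  have za0 : 0 < N (z - a) by rewrite normc_gt0 subr_eq0.
  apply: filterS (near_normc z za0) => v.
  have [->|va] := eqVneq v a; first by rewrite ltxx.
  by move=> _; rewrite (fE v) fa; field; rewrite subr_eq0.
have [r [r0 r1 ar]] := between1 a1.
pose A t := f (circ r t) * circ r t * (circ r t - a)^-1.
have Ac : contR A.
  apply: contRM; last exact: contR_kernel.
  by apply: contRM; [exact: holoD_circ|exact: contR_circ].
exists (cmean (fun t => A t * ((circ r t - a)^-1 * (circ r t - a)^-1))).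
apply: cdiff_near (cdiff_kernel1 Ac ar).
have key v : N v < r -> v != a -> cmean (fun t => A t * (circ r t - v)^-1) = q v.
  move=> vr va; apply: (mulfI (_ : v - a != 0)); first by rewrite subr_eq0.
  have := fE v; rewrite fa add0r => <-.
  have -> : f v = f v - f a by rewrite fa subr0.
  rewrite (cauchy_formula fh r0 r1 vr) (cauchy_formula fh r0 r1 ar).
  have Bc w : N w < r -> contR (fun t => f (circ r t) * circ r t * (circ r t - w)^-1).
    move=> wr; apply: contRM; last exact: contR_kernel.
    by apply: contRM; [exact: holoD_circ|exact: contR_circ].
  rewrite -(cmeanB (Bc v vr) (Bc a ar)) -cmeanZ; last first.
    by apply: contRM => //; exact: contR_kernel.
  apply: eq_cmean => t; rewrite /A; field.
  by rewrite !circ_sub_neq0.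
have Kaq : cmean (fun t => A t * (circ r t - a)^-1) = q a.
  have Fc : contR (fun t => f (circ r t) * circ r t).
    by apply: contRM; [exact: holoD_circ|exact: contR_circ].
  have fda : cdiff f a d by exists q.
  rewrite qa; apply: cdiff_unique fda.
  have -> : cmean (fun t => A t * (circ r t - a)^-1) =
      cmean (fun t => f (circ r t) * circ r t * ((circ r t - a)^-1 * (circ r t - a)^-1)).
    by apply: eq_cmean => t; rewrite /A mulrA.
  apply: cdiff_near (cdiff_kernel1 Fc ar).
  by apply: filterS (near_normc_lt ar) => w wr; rewrite -cauchy_formula.
by apply: filterS (near_normc_lt ar) => v vr; have [->|/key->] := eqVneq v a.
Qed.

End Cauchy.

Section zeros.
Context {R : realType}.
Local Notation C := R[i].
Local Notation N := (@Normc.normc R).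

Lemma holoD_cdiff_derive1 (f : CC R -> CC R) : holoD (f : C -> C) ->
  forall z : C, N z < 1 -> cdiff (f : C -> C) z (f^`()%classic z).
Proof.
by move=> fh z /fh[d fd]; rewrite (cdiff_derive1 fd).
Qed.

Lemma holoD_derive1 (f : CC R -> CC R) : holoD (f : C -> C) ->
  holoD (f^`()%classic : C -> C).
Proof.
move=> fh z z1; have [g gh gP] := holoD_deriv fh.
apply: cdble_near (gh z z1); apply: filterS (near_normc_lt z1) => w w1.
by rewrite (cdiff_derive1 (gP w w1)).
Qed.

Lemma holoD_derive1n (f : CC R -> CC R) n : holoD (f : C -> C) ->
  holoD (derive1n n f : C -> C).
Proof. by move=> fh; elim: n => // n ih; rewrite derive1nS; exact: holoD_derive1. Qed.

Lemma derive1n_eq_disk (f g : CC R -> CC R) n : holoD (f : C -> C) ->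
  (forall z : C, N z < 1 -> f z = g z) ->
  forall z : C, N z < 1 -> derive1n n f z = derive1n n g z.
Proof.
move=> fh fg; elim: n => [|n ih] z z1; first exact: fg.
rewrite (derive1nS f) (derive1nS g).
have h := holoD_cdiff_derive1 (holoD_derive1n n fh) z1.
symmetry; apply: cdiff_derive1; apply: cdiff_near h.
by apply: filterS (near_normc_lt z1) => w; exact: ih.
Qed.

Lemma derive1n_mul_sub (a : C) (h : CC R -> CC R) n : holoD (h : C -> C) ->
  forall z : C, N z < 1 ->
  derive1n n (fun w : CC R => ((w : C) - a) * h w : CC R) z =
  ((z - a) * derive1n n h z + n%:R * derive1n n.-1 h z : C).
Proof.
move=> hh; elim: n => [|n ih] z z1; first by rewrite /= mul0r addr0.
rewrite derive1nS.
have h1 := holoD_cdiff_derive1 (holoD_derive1n n hh) z1.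
have h2 := holoD_cdiff_derive1 (holoD_derive1n n.-1 hh) z1.
have h3 : cdiff (fun w : C => w - a) z (1 - 0).
  by apply: cdiffB; [exact: cdiff_id|exact: cdiff_cst].
have h4 := cdiffD (cdiffM h3 h1) (cdiffZ n%:R h2).
have -> : derive1n n.+1 h z = (derive1n n h)^`()%classic z by rewrite derive1nS.
rewrite -pred_Sn.
transitivity ((1 - 0) * derive1n n h z + (z - a) * (derive1n n h)^`()%classic z +
   n%:R * (derive1n n.-1 h)^`()%classic z : C).
  apply: cdiff_derive1; apply: cdiff_near h4.
  by apply: filterS (near_normc_lt z1) => w w1; rewrite -ih.
have -> : n%:R * (derive1n n.-1 h)^`()%classic z = n%:R * derive1n n h z :> C.
  by case: n {ih h1 h2 h4} => [|n]; rewrite ?mul0r// -pred_Sn derive1nS.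
rewrite -natr1; ring.
Qed.

Lemma holoD_factor (a : C) n (f : CC R -> CC R) : N a < 1 -> holoD (f : C -> C) ->
  (forall k, (k < n)%N -> derive1n k f a = 0) ->
  exists2 g : C -> C, holoD g & forall z, N z < 1 -> f z = (z - a) ^+ n * g z.
Proof.
move=> a1; elim: n f => [|n ih] f fh f0.
  by exists f => // z z1; rewrite expr0 mul1r.
have [g gh fg] := holoD_slope fh a1 (f0 0%N isT).
have [k kn|g' g'h gg'] := ih g gh; last first.
  by exists g' => // z z1; rewrite fg// gg'// exprS mulrA.
have := f0 k.+1 kn; rewrite (derive1n_eq_disk k.+1 fh fg a1).
rewrite (derive1n_mul_sub a k.+1 gh a1) subrr mul0r add0r => /eqP.
by rewrite mulf_eq0 pnatr_eq0 /= => /eqP.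
Qed.

End zeros.

(** * Area and changes of variables in the plane *)

Section plane_measure.
Context {R : realType}.
Local Open Scope ereal_scope.
Notation Rm := (measurableTypeR R).

Definition leb1 : SigmaFiniteMeasure.type Rm R := @lebesgue_measure R.

(* An alias of the product measure: as a head constant, the library's
   [product_measure1] only has the sigma-finite instance for finite factors. *)
Definition leb2 : set (Rm * Rm) -> \bar R := (leb1 \x leb1).

HB.instance Definition _ := Measure.copy leb2 (leb1 \x leb1).

Lemma leb2_sigma_finite : sigma_finite [set: Rm * Rm] leb2.
Proof.
have /sigma_finiteP[F [TF ndF Foo]] := sigma_finiteT leb1.
exists (fun n => F n `*` F n).
  rewrite -setXTT TF predeqE => -[x y]; split.
    move=> [/= [n _ Fnx] [k _ Gky]]; exists (maxn n k) => //; split.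
    - by move: x Fnx; exact/subsetPset/ndF/leq_maxl.
    - by move: y Gky; exact/subsetPset/ndF/leq_maxr.
  by move=> [n _ []/= ? ?]; split; exists n.
move=> k; have [? ?] := Foo k.
split; first exact: measurableX.
by rewrite /leb2 product_measure1E// lte_mul_pinfty// ge0_fin_numE.
Qed.

HB.instance Definition _ := Measure_isSigmaFinite.Build _ _ _ leb2 leb2_sigma_finite.

End plane_measure.

Section planar_measurability.
Context {R : realType}.
Local Notation C := R[i].
Notation Rm := (measurableTypeR R).
Notation cpt := (@cpt R).

Definition openCC (D : set C) := forall z, D z -> nearC z D.

Lemma rat_dist_lt (x d : R) : 0 < d -> exists q : rat, `|x - ratr q| < d.
Proof.
move=> d0; have /rat_in_itvoo[q] : x - d < x + d by lra.
rewrite in_itv/= => /andP[h1 h2]; exists q.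
by rewrite ltr_norml; apply/andP; split; lra.
Qed.

Lemma open_measurableC (D : set C) : openCC D ->
  measurable (cpt @^-1` D : set (Rm * Rm)).
Proof.
move=> oD.
pose S (q1 q2 : rat) n : set (Rm * Rm) :=
  [set x : R | `|x - ratr q1| < n.+1%:R^-1] `*` [set y : R | `|y - ratr q2| < n.+1%:R^-1].
have mI (q : rat) n : measurable ([set x : R | `|x - ratr q| < n.+1%:R^-1] : set Rm).
  rewrite (_ : mkset _ = `]ratr q - n.+1%:R^-1, ratr q + n.+1%:R^-1[%classic)//.
  by apply/seteqP; split => x /=; rewrite in_itv/= ltr_distl.
have -> : (cpt @^-1` D : set (Rm * Rm)) = \bigcup_(q1 : rat) \bigcup_(q2 : rat)
    \bigcup_(n in [set n | S q1 q2 n `<=` cpt @^-1` D]) S q1 q2 n.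
  apply/seteqP; split; last by move=> z [q1 _ [q2 _ [n /= nD /nD]]].
  move=> [x y] /= Dxy; have [e e0 eD] := oD _ Dxy.
  have [n ne] : exists n, 4 * n.+1%:R^-1 < e :> R.
    have [n _ hn] := near_dist_lt (@cvg_harmonic R) (divr_gt0 e0 (ltr0n R 4)).
    exists n; have := hn n (leqnn n); rewrite sub0r normrN /harmonic /=.
    by rewrite gtr0_norm ?invr_gt0// ltr_pdivlMr// mulrC.
  have n0 : 0 < n.+1%:R^-1 :> R by rewrite invr_gt0.
  have [q1 xq1] := rat_dist_lt x n0; have [q2 yq2] := rat_dist_lt y n0.
  exists q1 => //; exists q2 => //; exists n => //= -[x' y'] [/= h1 h2].
  apply: eD; rewrite (le_lt_trans (normc_leReIm _))//= (le_lt_trans _ ne)//.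
  move: xq1 yq2 h1 h2; move: (n.+1%:R^-1) => d.
  rewrite !ltr_norml => /andP[? ?] /andP[? ?] /andP[? ?] /andP[? ?].
  have -> : 4 * d = 2 * d + 2 * d by ring.
  by rewrite lerD// ler_norml; apply/andP; split; lra.
apply: bigcupT_measurable_rat => q1; apply: bigcupT_measurable_rat => q2.
by apply: bigcup_measurable => n _; exact: measurableX.
Qed.

Lemma measurable_contC (D : set C) (g : C -> R) : openCC D ->
  (forall z, D z -> g w @[w --> nearC z] --> g z) ->
  measurable_fun (cpt @^-1` D : set (Rm * Rm)) (g \o cpt).
Proof.
move=> oD gc mD; apply: (measurability _ (RGenOInfty.measurableE R)) => //.
move=> /= _ [_ [x ->] <-].
rewrite (_ : _ `&` _ = cpt @^-1` (D `&` [set z | x < g z])); last first.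
  by apply/seteqP; split => -[a b] /=; rewrite in_itv/= andbT.
apply: open_measurableC => z [Dz xgz].
apply: filterI; first exact: oD.
have e0 : 0 < g z - x by rewrite subr_gt0.
apply: filterS (near_dist_lt (gc z Dz) e0) => w /=.
by rewrite ltr_norml => /andP[_]; lra.
Qed.

End planar_measurability.

Section areas.
Context {R : realType}.
Local Notation C := R[i].
Local Notation N := (@Normc.normc R).
Notation Rm := (measurableTypeR R).
Notation leb1 := (@leb1 R).
Notation leb2 := (@leb2 R).
Notation cpt := (@cpt R).

Definition measC (h : C -> R) := measurable_fun [set: Rm * Rm] (h \o cpt).

Definition intC (h : C -> R) : \bar R := (\int[leb2]_x (h (cpt x))%:E)%E.

Lemma measC_continuous (h : C -> R) : (forall z, h w @[w --> nearC z] --> h z) -> measC h.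
Proof.
move=> hc; have := @measurable_contC R setT h; rewrite preimage_setT; apply.
  by move=> z _; exact: filterT.
by move=> z _.
Qed.

Lemma measC_normB (y : C) : measC (fun z => N (z - y)).
Proof.
apply: measC_continuous => z; apply: tendsC_normc.
by apply: tendsCB; [exact: tendsC_id|exact: tendsC_cst].
Qed.

Definition ballI (y : C) (r : R) (z : C) : R := if N (z - y) < r then 1 else 0.

Lemma ballI_ge0 y r z : 0 <= ballI y r z.
Proof. by rewrite /ballI; case: ifP. Qed.

Lemma measC_ball (y : C) r : measC (ballI y r).
Proof.
apply: measurable_fun_ifT => //.
by apply: measurable_fun_ltr => //; exact: measC_normB.
Qed.

Definition halfchord (y : C) (r s : R) : R := Num.sqrt (r ^+ 2 - (s - complex.Re y) ^+ 2).

Lemma normc_lt_chord (y : C) r s t : 0 < r ->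
  (N (Complex s t - y) < r) = (`|t - complex.Im y| < halfchord y r s).
Proof.
move=> r0; rewrite -(@ltr_pXn2r _ 2%N)// ?nnegrE ?normc_ge0 ?(ltW r0)// normc_sqr.
have -> : complex.Re (Complex s t - y) = s - complex.Re y by case: y.
have -> : complex.Im (Complex s t - y) = t - complex.Im y by case: y.
rewrite /halfchord -ltrBrDl -[(t - _) ^+ 2]real_normK ?num_real//.
set a := `|_|; set b := r ^+ 2 - _.
have a0 : 0 <= a by exact: normr_ge0.
have [b0|b0] := lerP b 0.
  rewrite ler0_sqrtr// [RHS]ltNge a0; apply/negbTE; rewrite -leNgt (le_trans b0)//.
  by rewrite sqr_ge0.
by rewrite -[in LHS](@sqr_sqrtr _ b) ?(ltW b0)// ltr_pXn2r// nnegrE// sqrtr_ge0.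
Qed.

Lemma intC_ball_chord (y : C) r : 0 < r ->
  intC (ballI y r) = (\int[leb1]_s (2 * halfchord y r s)%:E)%E.
Proof.
move=> r0; rewrite /intC fubini_tonelli1; last 2 first.
- by apply/measurable_EFinP; exact: measC_ball.
- by move=> x; rewrite lee_fin ballI_ge0.
apply: eq_integral => s _; rewrite /fubini_F /=.
under eq_integral do rewrite /ballI /cpt /= normc_lt_chord//.
set h := halfchord y r s; have h0 : 0 <= h by exact: sqrtr_ge0.
pose b := complex.Im y.
rewrite (eq_integral (fun t : Rm => (\1_(`]b - h, b + h[%classic : set Rm) t)%:E)); last first.
  by move=> t _; rewrite indicE mem_setE in_itv/= -ltr_distl; case: ifP.
rewrite integral_indic//= setIT.
have := @lebesgue_measure_itv R (Interval (BRight (b - h)) (BLeft (b + h))).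
rewrite /= => ->; rewrite lte_fin; have [bh|bh] := ltP.
  by rewrite -EFinB; congr EFin; ring.
have -> : h = 0 by lra.
by rewrite mulr0.
Qed.

Definition unit_area : \bar R := (\int[leb1]_s (2 * Num.sqrt (1 - s ^+ 2))%:E)%E.

Lemma continuous_halfchord y r : continuous (fun s : R => 2 * halfchord y r s).
Proof.
move=> s; apply: cvgM; first exact: cvg_cst.
rewrite /halfchord; apply: (@continuous_comp _ _ _ (fun s => r ^+ 2 - (s - complex.Re y) ^+ 2) Num.sqrt);
  last exact: sqrt_continuous.
apply: cvgB; first exact: cvg_cst.
apply: (@continuous_comp _ _ _ (fun s => s - complex.Re y) (fun s => s ^+ 2)).
  by apply: cvgB; [exact: cvg_id|exact: cvg_cst].
exact: exprn_continuous.
Qed.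

Lemma continuous_chord : continuous (fun s : R => 2 * Num.sqrt (1 - s ^+ 2)).
Proof.
have := @continuous_halfchord 0 1; rewrite /halfchord /= expr1n.
by under eq_fun do rewrite subr0.
Qed.

Lemma ge0_integral_affine (a b : R) (G : Rm -> Rm) : 0 < a -> measurable_fun setT G ->
  (forall x, 0 <= G x) ->
  (\int[leb1]_x (G x)%:E = \int[leb1]_x (G (a * x + b) * a)%:E)%E.
Proof.
move=> a0 mG G0; pose T (x : Rm) : Rm := a * x + b.
have mT : measurable_fun setT T by apply: measurable_funD => //; apply: measurable_funM.
have aE : (a == 0) = false by rewrite gt_eqF.
pose push : {measure set Rm -> \bar R} :=
  measure_function_pushforward__canonical__measure_function_Measure leb1 mT.
pose nu : {measure set Rm -> \bar R} := mscale (NngNum (ltW a0)) push.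
have lebE (X : set Rm) : measurable X -> leb1 X = nu X.
  move=> mX; apply: lebesgue_measure_unique => // _ [[c d] _ <-].
  have -> : nu `]c, d]%classic = (a%:E * leb1 `]((c - b) / a)%R, ((d - b) / a)%R]%classic)%E.
    rewrite /nu/= /mscale/= /pushforward; congr (_ * leb1 _)%E.
    apply/seteqP; split=> x /=; rewrite !in_itv/= ltr_pdivrMr// ler_pdivlMr//;
    by rewrite /T ltrBlDr lerBrDr mulrC.
  have E : ((c - b) / a < (d - b) / a) = (c < d) by rewrite ltr_pM2r ?invr_gt0// ltrD2r.
  rewrite /leb1 [LHS]lebesgue_measure_itv [X in (_ * X)%E]lebesgue_measure_itv/= !lte_fin E.
  case: ifP => _; last by rewrite mule0.
  by rewrite -!EFinB -EFinM; congr EFin; field; rewrite aE.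
have mG' : measurable_fun setT (EFin \o G) by apply/measurable_EFinP.
rewrite (@eq_measure_integral _ _ _ _ nu); last by move=> X mX _; exact: lebE.
rewrite ge0_integral_mscale//=; last by move=> x _; rewrite lee_fin.
rewrite ge0_integral_pushforward//; last by move=> x _; rewrite lee_fin.
rewrite preimage_setT -ge0_integralZl//=.
- by apply: eq_integral => x _; rewrite -EFinM mulrC.
- exact: measurableT_comp.
- by move=> x _; rewrite lee_fin.
- by rewrite lee_fin ltW.
Qed.

Lemma intC_ballE (y : C) r : 0 < r -> intC (ballI y r) = ((r ^+ 2)%:E * unit_area)%E.
Proof.
move=> r0; rewrite intC_ball_chord// (ge0_integral_affine (complex.Re y) r0); last 2 first.
- exact: (continuous_measurable_fun (@continuous_halfchord _ _)).
- by move=> x; rewrite mulr_ge0// sqrtr_ge0.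
rewrite /unit_area -ge0_integralZl//=; last 2 first.
- apply/measurable_EFinP; exact: (continuous_measurable_fun continuous_chord).
- by rewrite lee_fin sqr_ge0.
apply: eq_integral => x _; rewrite -EFinM /halfchord; congr EFin.
have -> : r ^+ 2 - (r * x + complex.Re y - complex.Re y) ^+ 2 = r ^+ 2 * (1 - x ^+ 2) by ring.
rewrite sqrtrM ?sqr_ge0// sqrtr_sqr gtr0_norm//; ring.
Qed.

Lemma EFin_segint a b (f : R -> R) : contI a b f ->
  ((segint a b f)%:E = \int[leb1]_(x in `[a, b]) (f x)%:E)%E.
Proof.
move=> /contI_integrable fi; rewrite /segint /Rintegral fineK//.
exact: integrable_fin_num.
Qed.

Lemma integral_gt0 (a b : R) (f : Rm -> Rm) (h : R -> R) : a < b -> measurable_fun setT f ->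
  (forall t, 0 <= f t) -> contI a b h -> (forall t, a <= t <= b -> f t = h t) -> h a != 0 ->
  (0 < \int[leb1]_t (f t)%:E)%E.
Proof.
move=> ab mf f0 hc fh ha; have aab : a <= a <= b by rewrite lexx ltW.
have mf' : measurable_fun setT (fun t : Rm => (f t)%:E) by apply/measurable_EFinP.
have h0 t : a <= t <= b -> 0 <= h t by move=> tab; rewrite -fh.
apply: (@lt_le_trans _ _ (segint a b h)%:E).
  rewrite lte_fin ltNge; apply: contra ha => h'; apply/eqP.
  exact: (segint_eq0 ab hc h0 h').
rewrite EFin_segint//.
have -> : (\int[leb1]_(t in `[a, b]) (h t)%:E = \int[leb1]_(t in `[a, b]) (f t)%:E)%E.
  by apply: eq_integral => t; rewrite inE/= in_itv/= => /fh ->.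
by apply: ge0_subset_integral => // t _; rewrite lee_fin.
Qed.

Lemma unit_area_fin_gt0 : exists2 A : R, 0 < A & unit_area = A%:E.
Proof.
pose h (s : R) : R := 2 * Num.sqrt (1 - s ^+ 2).
have hc : continuous h by exact: continuous_chord.
have E : unit_area = (segint (-1) 1 h)%:E.
  rewrite EFin_segint; last by move=> s _; exact: hc.
  rewrite [RHS]integral_mkcond; apply: eq_integral => s _.
  rewrite patchE mem_setE in_itv/=; case: ifPn => // s1.
  rewrite ler0_sqrtr ?mulr0// subr_le0 -[s ^+ 2]real_normK ?num_real//.
  by rewrite expr_ge1// ltW// ltNge ler_norml.
exists (segint (-1) 1 h) => //; rewrite -lte_fin -E.
apply: (@integral_gt0 0 1 _ h) => //.
- exact: (continuous_measurable_fun hc).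
- by move=> s _; exact: hc.
- by rewrite /h expr0n subr0 sqrtr1 mulr1.
Qed.

End areas.

Section limn_einf_bounds.
Context {R : realType}.
Implicit Types (u : (\bar R)^nat) (c : \bar R).
Local Open Scope ereal_scope.

Lemma limn_einf_ge u c n0 : (forall k, (n0 <= k)%N -> c <= u k) -> c <= limn_einf u.
Proof.
move=> cu; rewrite limn_einf_lim; apply: lime_ge; first exact: is_cvg_einfs.
exists n0 => // n /= n0n; apply: le_ereal_inf_tmp => _ [k /= nk <-].
by apply: cu; exact: leq_trans nk.
Qed.

Lemma limn_einf_le u c : (forall k, u k <= c) -> limn_einf u <= c.
Proof.
move=> uc; rewrite limn_einf_lim; apply: lime_le; first exact: is_cvg_einfs.
apply: nearW => n; apply: le_trans (uc n); apply: ereal_inf_lbound.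
by exists n => /=.
Qed.

End limn_einf_bounds.

Section change_of_variables.
Context {R : realType}.
Local Notation C := R[i].
Local Notation N := (@Normc.normc R).
Notation Rm := (measurableTypeR R).
Notation leb2 := (@leb2 R).
Notation cpt := (@cpt R).

Definition dext (g : C -> R) (z : C) : R := if N z < 1 then g z else 0.

Definition contD (g : C -> R) := forall z, N z < 1 -> g w @[w --> nearC z] --> g z.

Lemma openCC_disk : openCC [set z : C | N z < 1].
Proof. by move=> z /= z1; exact: near_normc_lt. Qed.

Lemma measC_dext g : contD g -> measC (dext g).
Proof.
move=> gc.
have mD := open_measurableC openCC_disk.
have h : measurable_fun (cpt @^-1` [set z : C | N z < 1] : set (Rm * Rm)) (g \o cpt).
  by apply: measurable_contC; [exact: openCC_disk|move=> z; exact: gc].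
move/(measurable_restrictT _ mD) : h; apply: eq_measurable_fun => x _.
by rewrite patchE mem_setE /dext /=.
Qed.

Lemma dext_ge0 g : (forall z, N z < 1 -> 0 <= g z) -> forall z, 0 <= dext g z.
Proof. by move=> g0 z; rewrite /dext; case: ifP => // /g0. Qed.

Variable A : R.
Hypothesis A0 : 0 < A.
Hypothesis AE : @unit_area R = A%:E.

Variables (T : C -> C) (J h : C -> R).
Hypothesis Tc : forall z, N z < 1 -> tendsC (nearC z) T (T z).
Hypothesis TD : forall z, N z < 1 -> N (T z) < 1.
Hypothesis Jc : contD J.
Hypothesis J0 : forall z, N z < 1 -> 0 <= J z.
Hypothesis hc : contD h.
Hypothesis h0 : forall z, N z < 1 -> 0 <= h z.
Hypothesis TJ : forall e : R, 0 < e -> exists2 r0, 0 < r0 & forall (r : R) (x : C), 0 < r -> r < r0 ->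
  N x < 1 -> (intC (dext (fun z => J z * ballI x r (T z))%R) <= ((1 + e) * (r ^+ 2 * A))%:E)%E.

Let inball (r : R) (z x : Rm * Rm) : R :=
  if (dext (fun w => complex.Re (T w)) (cpt z) - x.1) ^+ 2 +
     (dext (fun w => complex.Im (T w)) (cpt z) - x.2) ^+ 2 < r ^+ 2 then 1 else 0.

Let inballE r z x : 0 < r -> N (cpt z) < 1 ->
  inball r z x = ballI (T (cpt z)) r (cpt x) /\ inball r z x = ballI (cpt x) r (T (cpt z)).
Proof.
move=> r0 z1; rewrite /inball /dext z1 /ballI.
have E (w : C) : (N w < r) = (complex.Re w ^+ 2 + complex.Im w ^+ 2 < r ^+ 2).
  by rewrite -normc_sqr ltr_pXn2r// nnegrE ?normc_ge0// ltW.
rewrite [N (cpt x - _)]normcB !E.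
have -> : complex.Re (T (cpt z) - cpt x) = complex.Re (T (cpt z)) - x.1 by case: (T _).
by have -> : complex.Im (T (cpt z) - cpt x) = complex.Im (T (cpt z)) - x.2 by case: (T _).
Qed.

Let Psi (r : R) (p : (Rm * Rm) * (Rm * Rm)) : R :=
  dext J (cpt p.1) * ((r ^+ 2 * A)^-1 * (dext h (cpt p.2) * inball r p.1 p.2)).

Let Psi_ge0 r p : 0 <= Psi r p.
Proof.
rewrite /Psi !mulr_ge0 ?dext_ge0//.
- by rewrite invr_ge0 mulr_ge0 ?sqr_ge0// ltW.
- by rewrite /inball; case: ifP.
Qed.

Let measurable_dext_fst g : contD g -> measurable_fun [set: (Rm * Rm) * (Rm * Rm)] (fun p => dext g (cpt p.1)).
Proof.
by move=> gc; exact: (measurableT_comp (measC_dext gc) (@measurable_fst _ _ _ _)).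
Qed.

Let measurable_inball r : measurable_fun [set: (Rm * Rm) * (Rm * Rm)] (fun p => inball r p.1 p.2).
Proof.
apply: measurable_fun_ifT => //; apply: measurable_fun_ltr => //.
have m21 : measurable_fun [set: (Rm * Rm) * (Rm * Rm)] (fun p => p.2.1 : R).
  exact: (measurableT_comp (@measurable_fst _ _ _ _) (@measurable_snd _ _ _ _)).
have m22 : measurable_fun [set: (Rm * Rm) * (Rm * Rm)] (fun p => p.2.2 : R).
  exact: (measurableT_comp (@measurable_snd _ _ _ _) (@measurable_snd _ _ _ _)).
apply: measurable_funD; apply: measurable_funX; apply: measurable_funB => //; apply: measurable_dext_fst => z /Tc.
  exact: tendsC_Re.
exact: tendsC_Im.
Qed.

Let measurable_Psi r : measurable_fun setT (Psi r).
Proof.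
have m2 g : contD g -> measurable_fun [set: (Rm * Rm) * (Rm * Rm)] (fun p => dext g (cpt p.2)).
  by move=> gc; exact: (measurableT_comp (measC_dext gc) (@measurable_snd _ _ _ _)).
apply: measurable_funM; first exact: measurable_dext_fst.
apply: measurable_funM; first exact: measurable_cst.
by apply: measurable_funM; [exact: m2|exact: measurable_inball].
Qed.

Let F r (z : Rm * Rm) : \bar R := (\int[leb2]_x (Psi r (z, x))%:E)%E.

Let measurable_F r : measurable_fun setT (F r).
Proof.
apply: (measurable_fun_fubini_tonelli_F (EFin \o Psi r)).
  by apply/measurable_EFinP; exact: measurable_Psi.
by move=> p; rewrite lee_fin; exact: Psi_ge0.
Qed.

Let F_lower z e : N (cpt z) < 1 -> 0 < e -> exists2 r0, 0 < r0 & forall r, 0 < r -> r < r0 ->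
  ((J (cpt z) * (h (T (cpt z)) - e))%:E <= F r z)%E.
Proof.
move=> z1 e0; have Tz := TD z1; set y := T (cpt z).
have [d d0 dP] : nearC y [set w | N w < 1 /\ `|h y - h w| < e].
  by apply: filterI; [exact: near_normc_lt|exact: near_dist_lt (hc Tz) e0].
exists d => // r r0 rd.
pose c := Num.max (h y - e) 0.
have c0 : 0 <= c by rewrite le_max lexx orbT.
have rA : 0 < r ^+ 2 * A by rewrite mulr_gt0// exprn_gt0.
have k0 : 0 <= J (cpt z) * (r ^+ 2 * A)^-1 * c by rewrite !mulr_ge0 ?J0// invr_ge0 ltW.
have : (((J (cpt z) * (r ^+ 2 * A)^-1 * c)%:E * intC (ballI y r) <= F r z))%E.
  rewrite /intC -ge0_integralZl//=; last 2 first.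
  - by apply/measurable_EFinP; exact: measC_ball.
  - by move=> x _; rewrite lee_fin ballI_ge0.
  apply: ge0_le_integral => //.
  - by move=> x _; rewrite mule_ge0// lee_fin ballI_ge0.
  - by apply: measurable_funeM; apply/measurable_EFinP; exact: measC_ball.
  - by apply/measurable_EFinP; apply: (measurableT_comp (@measurable_Psi r)); exact: measurable_pair1.
  - move=> x _; rewrite -EFinM lee_fin /Psi /=.
    have ik : 0 <= (r ^+ 2 * A)^-1 by rewrite invr_ge0 ltW.
    have [-> _] := inballE x r0 z1; rewrite -/y {1}/dext z1.
    move: ik; set k := (r ^+ 2 * A)^-1 => ik; rewrite -!mulrA.
    rewrite ler_wpM2l ?J0// ler_wpM2l//.
    rewrite /ballI; case: ifPn => xr; last by rewrite !mulr0.
    have [x1 hx] : N (cpt x) < 1 /\ `|h y - h (cpt x)| < e.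
      by apply: dP; rewrite normcB (lt_trans xr).
    rewrite !mulr1 /dext x1 /c ge_max h0// andbT.
    by move: hx; rewrite ltr_norml => /andP[_]; lra.
rewrite intC_ballE// AE -!EFinM; apply: le_trans; rewrite lee_fin.
have -> : J (cpt z) * (r ^+ 2 * A)^-1 * c * (r ^+ 2 * A) = J (cpt z) * c.
  by rewrite mulrAC divfK ?gt_eqF.
by rewrite ler_wpM2l ?J0// le_max lexx.
Qed.

Let intF_le e : 0 < e -> exists2 r0, 0 < r0 & forall r, 0 < r -> r < r0 ->
  (\int[leb2]_z F r z <= (1 + e)%:E * intC (dext h))%E.
Proof.
move=> e0; have [r0 r00 rP] := TJ e0; exists r0 => // r rp rr0.
have rA : 0 < r ^+ 2 * A by rewrite mulr_gt0// exprn_gt0.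
have mP : measurable_fun setT (EFin \o Psi r) by apply/measurable_EFinP; exact: measurable_Psi.
rewrite /F (fubini_tonelli (EFin \o Psi r))//; last first.
  by move=> p; rewrite lee_fin; exact: Psi_ge0.
rewrite /intC -ge0_integralZl//=; last 3 first.
- by apply/measurable_EFinP; exact: measC_dext.
- by move=> x _; rewrite lee_fin dext_ge0.
- by rewrite lee_fin addr_ge0// ltW.
apply: ge0_le_integral => //.
- by move=> x _; apply: integral_ge0 => z _; rewrite lee_fin; exact: Psi_ge0.
- apply: (measurable_fun_fubini_tonelli_G (EFin \o Psi r)) => //.
  by move=> p; rewrite lee_fin; exact: Psi_ge0.
- by apply: measurable_funeM; apply/measurable_EFinP; exact: measC_dext.
move=> x _.
have -> : (\int[leb2]_z (Psi r (z, x))%:E = ((r ^+ 2 * A)^-1 * dext h (cpt x))%:E *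
    \int[leb2]_z (dext J (cpt z) * inball r z x)%:E)%E.
  rewrite -ge0_integralZl//=; last 3 first.
  - apply/measurable_EFinP; apply: measurable_funM; first exact: measC_dext.
    exact: (measurableT_comp (@measurable_inball r) (@measurable_pair2 _ _ _ _ x)).
  - by move=> z _; rewrite lee_fin mulr_ge0 ?dext_ge0// /inball; case: ifP.
  - by rewrite lee_fin mulr_ge0 ?dext_ge0// invr_ge0 ltW.
  by apply: eq_integral => z _; rewrite -EFinM /Psi/=; congr EFin; ring.
have [x1|x1] := boolP (N (cpt x) < 1); last first.
  by rewrite /dext (negbTE x1) mulr0 mule0 mul0e.
have -> : (\int[leb2]_z (dext J (cpt z) * inball r z x)%:E =
    intC (dext (fun z => J z * ballI (cpt x) r (T z))%R))%E.
  apply: eq_integral => z _; congr EFin; rewrite {1 2}/dext.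
  case: ifPn => z1; last by rewrite mul0r.
  by have [_ ->] := inballE x rp z1.
apply: le_trans (lee_wpmul2l _ (rP r (cpt x) rp rr0 x1)) _.
  by rewrite lee_fin mulr_ge0 ?dext_ge0// invr_ge0 ltW.
rewrite -!EFinM lee_fin.
have -> : (r ^+ 2 * A)^-1 * dext h (cpt x) * ((1 + e) * (r ^+ 2 * A)) =
  (r ^+ 2 * A)^-1 * (r ^+ 2 * A) * ((1 + e) * dext h (cpt x)) by ring.
by rewrite mulVf ?mul1r// gt_eqF.
Qed.

(* Replace [h] by its averages over balls of radius [r], apply Tonelli and [TJ],
   and let [r] tend to 0 by Fatou's lemma. *)
Lemma change_of_variables_le : (intC (dext (fun z => J z * h (T z))%R) <= intC (dext h))%E.
Proof.
pose r n : R := n.+1%:R^-1.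
have rp n : 0 < r n by rewrite /r invr_gt0.
have rs e : 0 < e -> exists n0, forall n, (n0 <= n)%N -> r n < e.
  move=> e0; have [n0 _ hn] := near_dist_lt (@cvg_harmonic R) e0.
  exists n0 => n /hn; rewrite sub0r normrN /harmonic /=.
  by rewrite gtr0_norm// -/(r n).
have key e : 0 < e -> (intC (dext (fun z => J z * h (T z))%R) <= (1 + e)%:E * intC (dext h))%E.
  move=> e0; have [r0 r00 rP] := intF_le e0; have [n0 n0P] := rs _ r00.
  have : (\int[leb2]_z limn_einf (fun n => F (r (n + n0)%N) z) <= (1 + e)%:E * intC (dext h))%E.
    apply: le_trans (fatou _ _ _ _) _ => //.
    - by move=> n z _; apply: integral_ge0 => x _; rewrite lee_fin; exact: Psi_ge0.
    - by apply: limn_einf_le => k; apply: rP => //; apply: n0P; exact: leq_addl.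
  apply: le_trans; apply: ge0_le_integral => //.
  - move=> z _; rewrite lee_fin dext_ge0// => w w1; rewrite mulr_ge0 ?J0// h0//.
    exact: TD.
  - apply/measurable_EFinP; apply: measC_dext => z z1; apply: cvgM; first exact: Jc.
    exact: cvg_tendsC (hc (TD z1)) (Tc z1).
  - have : measurable_fun setT (fun z => limn_einf (fun n => F (r (n + n0)%N) z)).
      rewrite /limn_einf; apply: measurableT_comp => //.
      apply: (measurable_fun_limn_esup (f := fun n z => - F (r (n + n0)%N) z)%E) => n.
      by apply: measurableT_comp => //; exact: measurable_F.
    by [].
  move=> z _; rewrite /dext; case: ifPn => z1; last first.
    apply: (@limn_einf_ge _ _ _ 0%N) => k _; apply: integral_ge0 => x _.
    by rewrite lee_fin; exact: Psi_ge0.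
  apply/lee_addgt0Pr => d d0.
  have d'0 : 0 < d / (J (cpt z) + 1) by rewrite divr_gt0// ltr_wpDl// J0.
  have [r1 r10 r1P] := F_lower z1 d'0; have [n1 n1P] := rs _ r10.
  rewrite -leeBlDr//; apply: (@limn_einf_ge _ _ _ n1) => k n1k.
  apply: le_trans (r1P _ (rp _) (n1P _ _)); last by rewrite (leq_trans n1k)// leq_addr.
  rewrite -EFinB lee_fin mulrBr lerD2l lerN2 mulrCA ler_piMr ?(ltW d0)//.
  by rewrite ler_pdivrMr ?mul1r ?lerDl// ltr_wpDl// J0.
have I0 : (0 <= intC (dext h))%E by apply: integral_ge0 => z _; rewrite lee_fin dext_ge0.
case E : (intC (dext h)) I0 => [I| |] I0; [|by rewrite leey|by []].
rewrite lee_fin in I0; apply/lee_addgt0Pr => e e0.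
have e'0 : 0 < e / (I + 1) by rewrite divr_gt0// ltr_wpDl.
apply: le_trans (key _ e'0) _; rewrite E -EFinM -EFinD lee_fin mulrDl mul1r lerD2l.
by rewrite mulrAC -mulrA ler_piMr ?(ltW e0)// ler_pdivrMr ?mul1r ?lerDl// ltr_wpDl.
Qed.

End change_of_variables.

Section Moebius.
Context {R : realType}.
Local Notation C := R[i].
Local Notation N := (@Normc.normc R).
Implicit Types a z w : C.

Definition mobden a z : C := 1 - conjc a * z.

Definition mob a z : C := (a - z) / mobden a z.

Lemma mobden_ge a z : N z < 1 -> 1 - N a <= N (mobden a z).
Proof.
move=> z1; have := ler_normc_dist 1 (conjc a * z).
rewrite Normc.normc1 Normc.normcM normc_conj => /(le_trans (ler_norm _)).
apply: le_trans; rewrite lerD2l lerN2 ler_piMr ?normc_ge0// ltW//.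
Qed.

Lemma mobden_le a z : N a < 1 -> N z < 1 -> N (mobden a z) <= 2.
Proof.
move=> a1 z1; rewrite (le_trans (le_normcD _ _))// normcN Normc.normc1 Normc.normcM normc_conj.
have : N a * N z <= 1 * 1 by rewrite ler_pM ?normc_ge0// ltW.
lra.
Qed.

Lemma mobden_gt0 a z : N a < 1 -> N z < 1 -> 0 < N (mobden a z).
Proof. by move=> a1 z1; rewrite (lt_le_trans _ (mobden_ge a z1))// subr_gt0. Qed.

Lemma mobden_neq0 a z : N a < 1 -> N z < 1 -> mobden a z != 0.
Proof. by move=> a1 z1; rewrite -normc_gt0 mobden_gt0. Qed.

Lemma mobden_sqr a z :
  N (mobden a z) ^+ 2 - N (a - z) ^+ 2 = (1 - N a ^+ 2) * (1 - N z ^+ 2).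
Proof.
by rewrite !normc_sqr; case: a z => a1 a2 [z1 z2] /=; ring.
Qed.

Lemma mob_sqr a z : N a < 1 -> N z < 1 ->
  1 - N (mob a z) ^+ 2 = (1 - N a ^+ 2) * (1 - N z ^+ 2) / N (mobden a z) ^+ 2.
Proof.
move=> a1 z1; have d0 := mobden_gt0 a1 z1.
rewrite -mobden_sqr /mob Normc.normcM Normc.normcV expr_div_n mulrBl divff//.
by rewrite gt_eqF// exprn_gt0.
Qed.

Lemma normc_sqr_lt1 z : (0 < 1 - N z ^+ 2) = (N z < 1).
Proof. by rewrite subr_gt0 expr_lt1// normc_ge0. Qed.

Lemma mob_disk a z : N a < 1 -> N z < 1 -> N (mob a z) < 1.
Proof.
move=> a1 z1; rewrite -normc_sqr_lt1 mob_sqr//.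
by rewrite divr_gt0 ?exprn_gt0 ?mobden_gt0// mulr_gt0// normc_sqr_lt1.
Qed.

Lemma mulc_conj z : conjc z * z = (N z ^+ 2)%:C%C.
Proof.
rewrite normc_sqr; case: z => x y; apply/eqP; rewrite eq_complex /=.
by apply/andP; split; apply/eqP; ring.
Qed.

Lemma mobfactorE a : (1 - N a ^+ 2)%:C%C = 1 - conjc a * a.
Proof. by rewrite mulc_conj; apply/eqP; rewrite eq_complex /= subr0 !eqxx. Qed.

Lemma mobden_mob a z : N a < 1 -> N z < 1 ->
  mobden a (mob a z) = (1 - N a ^+ 2)%:C%C / mobden a z.
Proof.
move=> a1 z1; have d0 := mobden_neq0 a1 z1.
rewrite mobfactorE {1}/mobden /mob.
by move: d0; rewrite /mobden => d0; field.
Qed.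

Lemma mobK a z : N a < 1 -> N z < 1 -> mob a (mob a z) = z.
Proof.
move=> a1 z1; have d0 := mobden_neq0 a1 z1.
have k0 : (1 - N a ^+ 2)%:C%C != 0 :> C.
  by rewrite -normc_gt0 normcR normr_gt0 gt_eqF// normc_sqr_lt1.
rewrite {1}/mob mobden_mob//.
have -> : a - mob a z = (1 - N a ^+ 2)%:C%C * z / mobden a z.
  by rewrite mobfactorE /mob; move: d0; rewrite /mobden => d0; field.
by move: k0 d0; move: ((1 - N a ^+ 2)%:C%C) (mobden a z) => k d k0 d0; field; rewrite k0 d0.
Qed.

Lemma mobB a z w : N a < 1 -> N z < 1 -> N w < 1 ->
  mob a z - mob a w = (1 - N a ^+ 2)%:C%C * (w - z) / (mobden a z * mobden a w).
Proof.
move=> a1 z1 w1; have d0 := mobden_neq0 a1 z1; have e0 := mobden_neq0 a1 w1.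
rewrite mobfactorE /mob; move: d0 e0; rewrite /mobden => d0 e0.
by field; rewrite d0 e0.
Qed.

Lemma cdble_mobden a z : cdble (mobden a) z.
Proof.
apply: cdbleB; first exact: cdble_cst.
by apply: cdbleM; [exact: cdble_cst|exact: cdble_id].
Qed.

Lemma cdble_mob a z : N a < 1 -> N z < 1 -> cdble (mob a) z.
Proof.
move=> a1 z1; apply: cdbleM.
  by apply: cdbleB; [exact: cdble_cst|exact: cdble_id].
by apply: (@cdbleV _ (mobden a)); [exact: cdble_mobden|exact: mobden_neq0].
Qed.

Definition mobjac a z : R := ((1 - N a ^+ 2) / N (mobden a z) ^+ 2) ^+ 2.

Lemma mobjac_ge0 a z : 0 <= mobjac a z.
Proof. exact: sqr_ge0. Qed.

Lemma contD_mobjac a : N a < 1 -> contD (mobjac a).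
Proof.
move=> a1 z z1; rewrite /mobjac.
apply: (@cvg_comp _ _ _ _ (fun x : R => x ^+ 2)); last exact: exprn_continuous.
apply: cvgM; first exact: cvg_cst.
apply: cvgV; first by rewrite gt_eqF// exprn_gt0// mobden_gt0.
apply: (@cvg_comp _ _ _ _ (fun x : R => x ^+ 2)); last exact: exprn_continuous.
apply: tendsC_normc; exact: cdble_cont (cdble_mobden a z).
Qed.

End Moebius.

Section Moebius_area.
Context {R : realType}.
Local Notation C := R[i].
Local Notation N := (@Normc.normc R).

Lemma measC_dext_ballI (T : C -> C) (J : C -> R) x r :
  (forall z, N z < 1 -> tendsC (nearC z) T (T z)) -> contD J ->
  measC (dext (fun z => J z * ballI x r (T z))).
Proof.
move=> Tc Jc.
have -> : dext (fun z => J z * ballI x r (T z)) =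
    fun z => dext J z * (if dext (fun w => N (T w - x)) z < r then 1 else 0).
  by apply/funext => z; rewrite /dext /ballI; case: ifP => //; rewrite mul0r.
apply: measurable_funM; first exact: measC_dext.
apply: measurable_fun_ifT => //; apply: measurable_fun_ltr => //.
apply: measC_dext => z z1; apply: tendsC_normc; apply: tendsCB; first exact: Tc.
exact: tendsC_cst.
Qed.

Variable A : R.
Hypothesis A0 : 0 < A.
Hypothesis AE : @unit_area R = A%:E.

Lemma intC_rotation_le (e : C) (h : C -> R) : N e = 1 -> contD h ->
  (forall z, N z < 1 -> 0 <= h z) ->
  (intC (dext (fun z => h (e * z)%R)) <= intC (dext h))%E.
Proof.
move=> e1 hc h0.
have e0 : e != 0 by rewrite -normc_gt0 e1.
have := @change_of_variables_le R A A0 AE (fun z => e * z) (fun=> 1) h.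
rewrite (_ : (fun z => 1 * h (e * z)) = (fun z => h (e * z))); last first.
  by apply/funext => z; rewrite mul1r.
apply => //.
- by move=> z z1; apply: tendsCM; [exact: tendsC_cst|exact: tendsC_id].
- by move=> z z1; rewrite Normc.normcM e1 mul1r.
- by move=> z z1; exact: cvg_cst.
- move=> d d0; exists 1 => // r x r0 _ x1.
  apply: (@le_trans _ _ (intC (ballI (e^-1 * x) r))); last first.
    rewrite intC_ballE// AE -EFinM lee_fin ler_peMl ?lerDl ?(ltW d0)//.
    by rewrite mulr_ge0 ?sqr_ge0// ltW.
  apply: ge0_le_integral => //.
  - by move=> z _; rewrite lee_fin dext_ge0// => w _; rewrite mul1r ballI_ge0.
  - apply/measurable_EFinP; apply: measC_dext_ballI => z z1.
      by apply: tendsCM; [exact: tendsC_cst|exact: tendsC_id].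
    exact: cvg_cst.
  - by apply/measurable_EFinP; exact: measC_ball.
  - move=> z _; rewrite lee_fin /dext; case: ifP => _; last exact: ballI_ge0.
    rewrite mul1r /ballI.
    have -> : e * cpt z - x = e * (cpt z - e^-1 * x) by rewrite mulrBr mulVKf.
    by rewrite Normc.normcM e1 mul1r.
Qed.

Lemma intC_mob_le (a : C) (h : C -> R) : N a < 1 -> contD h ->
  (forall z, N z < 1 -> 0 <= h z) ->
  (intC (dext (fun z => mobjac a z * h (mob a z))%R) <= intC (dext h))%E.
Proof.
move=> a1 hc h0.
apply: (change_of_variables_le A0 AE) => //.
- by move=> z z1; exact: cdble_cont (cdble_mob a1 z1).
- by move=> z z1; exact: mob_disk.
- exact: contD_mobjac.
- by move=> z _; exact: mobjac_ge0.
move=> e e0.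
have k0 : 0 < 1 - N a ^+ 2 by rewrite normc_sqr_lt1.
have m0 : 0 < 1 - N a by rewrite subr_gt0.
have [q0 q00 qP] : exists2 q0 : R, 0 < q0 & forall q, 0 < q -> q < q0 ->
    q < 1 /\ (1 + q) ^+ 2 / (1 - q) ^+ 4 < 1 + e.
  have : (fun q : R => (1 + q) ^+ 2 / (1 - q) ^+ 4) q @[q --> (0 : R)] -->
      ((1 + 0) ^+ 2 / (1 - 0) ^+ 4 : R).
    apply: cvgM.
      apply: (@cvg_comp _ _ _ _ (fun x : R => x ^+ 2)); last exact: exprn_continuous.
      by apply: cvgD; [exact: cvg_cst|exact: cvg_id].
    apply: cvgV; first by rewrite subr0 expr1n oner_neq0.
    apply: (@cvg_comp _ _ _ _ (fun x : R => x ^+ 4)); last exact: exprn_continuous.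
    by apply: cvgB; [exact: cvg_cst|exact: cvg_id].
  rewrite addr0 subr0 !expr1n divr1 => /near_dist_lt /(_ e0) [d /= d0 dP].
  exists (Num.min d 1); first by rewrite lt_min d0 ltr01.
  move=> q q0; rewrite lt_min => /andP[qd q1]; split => //.
  have := dP q; rewrite /= sub0r normrN gtr0_norm// => /(_ qd).
  by rewrite ltr_norml => /andP[]; lra.
exists (q0 * ((1 - N a) * (1 - N a ^+ 2)) / 4); first by rewrite !mulr_gt0// invr_gt0.
move=> r x r0 rq x1.
set y := mob a x; have y1 : N y < 1 by exact: mob_disk.
pose q := 4 * r / ((1 - N a) * (1 - N a ^+ 2)).
have q_gt0 : 0 < q by rewrite /q divr_gt0 ?mulr_gt0.
have qq0 : q < q0.
  by rewrite /q ltr_pdivrMr ?mulr_gt0//; move: rq; rewrite ltr_pdivlMr// mulrC.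
have [q1 qe] := qP q q_gt0 qq0.
set dy := N (mobden a y); have dy0 : 0 < dy by exact: mobden_gt0.
have dy2 : dy <= 2 by exact: mobden_le.
have dym : 1 - N a <= dy by exact: mobden_ge.
pose rho := r * dy ^+ 2 * (1 + q) / (1 - N a ^+ 2).
have rho0 : 0 < rho by rewrite /rho divr_gt0// !mulr_gt0 ?exprn_gt0// addr_gt0.
pose c := ((1 - N a ^+ 2) / (dy ^+ 2 * (1 - q) ^+ 2)) ^+ 2.
have q1' : 0 < 1 - q by rewrite subr_gt0.
have main z : N z < 1 -> N (mob a z - x) < r -> N (z - y) < rho /\ mobjac a z <= c.
  move=> z1; rewrite -{1}(mobK a1 x1) -/y mobB// Normc.normcM Normc.normcM normcR.
  rewrite Normc.normcV Normc.normcM -/dy gtr0_norm// [N (y - z)]normcB.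
  set dz := N (mobden a z) => h1.
  have dz0 : 0 < dz by exact: mobden_gt0.
  have dz2 : dz <= 2 by exact: mobden_le.
  rewrite ltr_pdivrMr ?mulr_gt0// mulrC -ltr_pdivlMr// in h1.
  have h2 : `|dz - dy| <= q * dy.
    rewrite (le_trans (ler_normc_dist _ _))//.
    have -> : mobden a z - mobden a y = conjc a * (y - z) by rewrite /mobden; ring.
    rewrite Normc.normcM normc_conj normcB.
    have h3 : N (z - y) <= q * (1 - N a).
      rewrite (le_trans (ltW h1))// /q ler_pdivrMr//.
      have -> : 4 * r / ((1 - N a) * (1 - N a ^+ 2)) * (1 - N a) * (1 - N a ^+ 2) = r * (2 * 2).
        by field; rewrite !gt_eqF.
      by rewrite ler_wpM2l ?(ltW r0)// ler_pM// ltW.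
    rewrite (le_trans (ler_pM (normc_ge0 _) (normc_ge0 _) (ltW a1) h3))// mul1r.
    by rewrite ler_wpM2l// ltW.
  move: h2; rewrite ler_norml => /andP[h2 h3].
  have h4 : dz <= dy * (1 + q) by move: h3; rewrite mulrDr mulr1 [dy * q]mulrC; lra.
  have h5 : dy * (1 - q) <= dz by move: h2; rewrite mulrBr mulr1 [dy * q]mulrC; lra.
  split.
    rewrite (lt_le_trans h1)// /rho ler_pM2r ?invr_gt0//.
    have -> : r * dy ^+ 2 * (1 + q) = r * (dy * (1 + q) * dy) by ring.
    by rewrite ler_pM2l// ler_pM2r.
  rewrite /mobjac /c ler_pXn2r ?nnegrE ?divr_ge0 ?mulr_ge0 ?sqr_ge0 ?normc_ge0 ?(ltW k0) ?(ltW dy0) ?(ltW q1')//.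
  rewrite ler_pM2l// lef_pV2 ?posrE ?mulr_gt0 ?exprn_gt0// -exprMn.
  by rewrite ler_pXn2r// nnegrE ltW// mulr_gt0.
apply: (@le_trans _ _ (intC (fun z => c * ballI y rho z)%R)).
  apply: ge0_le_integral => //.
  - by move=> z _; rewrite lee_fin dext_ge0// => w _; rewrite mulr_ge0 ?mobjac_ge0 ?ballI_ge0.
  - apply/measurable_EFinP; apply: measC_dext_ballI; last exact: contD_mobjac.
    by move=> z z1; exact: cdble_cont (cdble_mob a1 z1).
  - by apply/measurable_EFinP; apply: measurable_funM => //; exact: measC_ball.
  move=> z _; rewrite lee_fin /dext.
  case: ifPn => z1; last by rewrite mulr_ge0 ?sqr_ge0 ?ballI_ge0.
  rewrite {1}/ballI; case: ifPn => zr; last by rewrite mulr0 mulr_ge0 ?sqr_ge0 ?ballI_ge0.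
  have [h1 h2] := main _ z1 zr.
  by rewrite /ballI h1 !mulr1.
have -> : intC (fun z => c * ballI y rho z)%R = (c%:E * intC (ballI y rho))%E.
  rewrite /intC -ge0_integralZl//=.
  - by apply/measurable_EFinP; exact: measC_ball.
  - by move=> z _; rewrite lee_fin ballI_ge0.
  - by rewrite lee_fin sqr_ge0.
rewrite intC_ballE// AE -!EFinM lee_fin.
have -> : c * (rho ^+ 2 * A) = (1 + q) ^+ 2 / (1 - q) ^+ 4 * (r ^+ 2 * A).
  by rewrite /c /rho; field; rewrite !gt_eqF.
by rewrite ler_wpM2r ?(ltW qe)// mulr_ge0 ?sqr_ge0// ltW.
Qed.

End Moebius_area.

(** * Monotonicity of circle means *)

Section principal_power.
Context {R : realType}.
Local Notation C := R[i].
Local Notation N := (@Normc.normc R).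
Local Notation Re := (@complex.Re R).
Local Notation Im := (@complex.Im R).

Definition clog (z : C) : C := Complex (ln (N z)) (atan (Im z / Re z)).

Lemma cexp_clog z : 0 < Re z -> cexp (clog z) = z.
Proof.
case: z => x y /= x0; rewrite /cexp /clog /=.
have n0 : 0 < Num.sqrt (x ^+ 2 + y ^+ 2).
  by rewrite sqrtr_gt0 ltr_wpDr ?sqr_ge0// exprn_gt0.
rewrite lnK ?posrE// /cis.
have c : cos (atan (y / x)) = x / Num.sqrt (x ^+ 2 + y ^+ 2).
  rewrite cos_atan.
  have -> : 1 + (y / x) ^+ 2 = (x ^+ 2 + y ^+ 2) / x ^+ 2 by field; rewrite gt_eqF.
  by rewrite sqrtrM ?addr_ge0 ?sqr_ge0// sqrtrV ?sqr_ge0// sqrtr_sqr gtr0_norm// invf_div.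
have s : sin (atan (y / x)) = y / Num.sqrt (x ^+ 2 + y ^+ 2).
  have := atanK (y / x); rewrite /tan c => h.
  rewrite -[LHS](@divfK _ (x / Num.sqrt (x ^+ 2 + y ^+ 2))); last first.
    by rewrite mulf_neq0 ?invr_eq0// gt_eqF.
  by rewrite h; field; rewrite !gt_eqF.
rewrite c s; apply/eqP; rewrite eq_complex /=; apply/andP; split; apply/eqP.
  by field; rewrite gt_eqF.
by field; rewrite gt_eqF.
Qed.

Lemma tendsC_clog z : 0 < Re z -> tendsC (nearC z) clog (clog z).
Proof.
move=> z0; have nz : 0 < N z by rewrite (lt_le_trans z0)// (le_trans (ler_norm _))// normc_geRe.
apply: tendsC_Complex.
  apply: (cvg_comp _ _ (tendsC_normc (@tendsC_id R z))).
  exact: continuous_ln.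
have h : Im w / Re w @[w --> nearC z] --> Im z / Re z.
  apply: cvgM; first exact: (tendsC_Im (@tendsC_id R z)).
  by apply: cvgV; [rewrite gt_eqF|exact: (tendsC_Re (@tendsC_id R z))].
exact: (cvg_comp _ _ h (@continuous_atan R _)).
Qed.

Lemma cdble_clog z : 0 < Re z -> cdble clog z.
Proof.
move=> z0; have lc := tendsC_clog z0.
have [q [qc qz] qE] := cdiff_cexp (clog z).
have q0 : cexp (clog z) != 0 by exact: cexp_neq0.
have qlc : tendsC (nearC z) (fun w => q (clog w)) (cexp (clog z)) by exact: tendsC_comp lc qc.
exists (cexp (clog z))^-1; apply: (@cdiff_nearI _ _ (fun w => (q (clog w))^-1)); last first.
  exact: (tendsCV qlc q0).
have qn : \forall w \near nearC z, q (clog w) != 0 by exact: (tendsC_neq0 qlc q0).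
have rn : \forall w \near nearC z, 0 < Re w.
  have h : \forall w \near nearC z, `|Re z - Re w| < Re z.
    exact: near_dist_lt (tendsC_Re (@tendsC_id R z)) z0.
  by apply: filterS h => w; rewrite ltr_norml => /andP[_]; rewrite ltrBlDr ltrDl.
apply: filterS2 qn rn => w qw w0; have := qE (clog w); rewrite !cexp_clog// => E.
have -> : w - z = (clog w - clog z) * q (clog w) by rewrite [in LHS]E; ring.
by rewrite mulfK// addrC subrK.
Qed.

Definition cpow (s : R) (z : C) : C := cexp (s%:C%C * clog z).

Lemma cdble_cpow s z : 0 < Re z -> cdble (cpow s) z.
Proof.
move=> z0; apply: (@cdble_comp _ (fun w => s%:C%C * clog w) cexp).
  by apply: cdbleM; [exact: cdble_cst|exact: cdble_clog].
by eexists; exact: cdiff_cexp.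
Qed.

Lemma normc_cpow s z : 0 < Re z -> N (cpow s z) = N z `^ s.
Proof.
move=> z0; have nz : 0 < N z by rewrite (lt_le_trans z0)// (le_trans (ler_norm _))// normc_geRe.
by rewrite normc_cexp /powR gt_eqF//= mul0r subr0.
Qed.

Lemma cpow1 s : cpow s 1 = 1.
Proof.
rewrite /cpow /clog /= expr1n expr0n /= addr0 sqrtr1 ln1 mul0r atan0.
have -> : (s%:C%C * Complex 0 0 : C) = 0.
  by apply/eqP; rewrite eq_complex /= !mulr0 subrr addr0 eqxx.
by rewrite /cexp /= expR0 /cis cos0 sin0 mul1r.
Qed.

Lemma submean_local (F : C -> C) c r p : 0 < r ->
  (forall z, N (z - c) <= r -> cdble F z /\ N (F z - F c) < N (F c)) ->
  tau * N (F c) `^ p <= segint 0 tau (fun t => N (F (circ c r t)) `^ p).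
Proof.
move=> r0 Fh.
have Fc : 0 < N (F c).
  have [|_] := Fh c; first by rewrite subrr Normc.normc0 ltW.
  by rewrite subrr Normc.normc0.
have Fc0 : F c != 0 by rewrite -normc_gt0.
pose G z := F z / F c.
have Gre z : N (z - c) <= r -> 0 < Re (G z).
  move=> /Fh[_ h]; have : N (G z - 1) < 1.
    have -> : G z - 1 = (F z - F c) / F c by rewrite /G mulrBl divff.
    by rewrite Normc.normcM Normc.normcV ltr_pdivrMr// mul1r.
  move=> /(le_lt_trans (normc_geRe _)); rewrite ltr_norml => /andP[].
  by case: (G z) => a b /=; lra.
have Kh z : N (z - c) <= r -> cdble (fun z => cpow p (G z)) z.
  move=> zr; apply: cdble_comp; last exact: cdble_cpow (Gre z zr).
  by apply: cdbleM; [exact: (Fh z zr).1|exact: cdble_cst].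
have Kc z : N (z - c) <= r -> tendsC (nearC z) (fun z => cpow p (G z)) (cpow p (G z)).
  by move=> /Kh; exact: cdble_cont.
have := @mean_value_Re _ (fun z => cpow p (G z)) c c r r0 Kc (fun z zr _ _ => Kh z zr).
have -> : G c = 1 by rewrite /G divff.
rewrite cpow1 mulr1 => E.
have circr t : N (circ c r t - c) <= r by rewrite normc_circ// ltW.
have FGp t : N (F (circ c r t)) `^ p = N (F c) `^ p * N (G (circ c r t)) `^ p.
  rewrite -powRM ?normc_ge0// /G Normc.normcM Normc.normcV mulrC divfK//.
  by rewrite gt_eqF.
have NGc : contI 0 tau (fun t => N (G (circ c r t)) `^ p).
  have h : cont_ball (fun z => N (cpow p (G z))) c r.
    by move=> z zr; apply: tendsC_normc; exact: Kc.
  have rr : 0 <= r <= r by rewrite (ltW r0) lexx.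
  have E2 : (fun t => N (G (circ c r t)) `^ p) = (fun t => N (cpow p (G (circ c r t)))).
    by apply/funext => t; rewrite normc_cpow// Gre.
  by rewrite E2 => t _; exact: (cont_ball_circ h rr).
rewrite (eq_segint (g := fun t => N (F c) `^ p * N (G (circ c r t)) `^ p)) => [|t _]; last exact: FGp.
rewrite segintZ// mulrC ler_wpM2l ?powR_ge0// -[leLHS]E.
apply: le_segint => //.
  move=> t _; apply: (cont_ball_circ (g := fun z => Re (cpow p (G z))) (c := c) (r := r)).
    by move=> z zr; apply: tendsC_Re; exact: Kc.
  by rewrite (ltW r0) lexx.
move=> t _; rewrite (le_trans (ler_norm _))// (le_trans (normc_geRe _))//.
by rewrite normc_cpow// Gre.
Qed.

End principal_power.

Section circle_average.
Context {R : realType}.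
Local Notation C := R[i].
Local Notation N := (@Normc.normc R).
Local Notation Re := (@complex.Re R).
Local Notation Im := (@complex.Im R).
Notation Rm := (measurableTypeR R).
Notation leb1 := (@leb1 R).
Implicit Types u : C -> R.

Lemma segint_swap a b (h : R -> R -> R) : (forall s t, 0 <= h s t) ->
  (forall w, h (Re v) (Im v) @[v --> nearC w] --> h (Re w) (Im w)) ->
  contI a b (fun s => segint a b (h s)) ->
  contI a b (fun t => segint a b (h ^~ t)) ->
  segint a b (fun s => segint a b (h s)) = segint a b (fun t => segint a b (h ^~ t)).
Proof.
move=> h0 hc c1 c2.
pose g (z : C) := h (Re z) (Im z).
have h1 s : continuous (h s).
  move=> t; apply: (cvg_tendsC (g := g) (f := fun t => Complex s t) (hc (Complex s t))).
  by apply: tendsC_Complex; [exact: cvg_cst|exact: cvg_id].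
have h2 t : continuous (h ^~ t).
  move=> s; apply: (cvg_tendsC (g := g) (f := fun s => Complex s t) (hc (Complex s t))).
  by apply: tendsC_Complex; [exact: cvg_id|exact: cvg_cst].
apply: EFin_inj; rewrite (EFin_segint c1) (EFin_segint c2).
under eq_integral => s _ do rewrite (EFin_segint (fun t _ => h1 s t)).
under [RHS]eq_integral => t _ do rewrite (EFin_segint (fun s _ => h2 t s)).
pose I x := (a <= x) && (x <= b).
pose G (p : Rm * Rm) : \bar R := (if I p.1 && I p.2 then h p.1 p.2 else 0)%:E.
have mI (T : Rm * Rm -> Rm) : measurable_fun setT T -> measurable_fun setT (fun p => I (T p)).
  by move=> mT; apply: measurable_and; apply: measurable_fun_ler.
have mG : measurable_fun setT G.
  apply/measurable_EFinP; apply: measurable_fun_ifT => //.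
    by apply: measurable_and; apply: mI.
  exact: (measC_continuous (h := fun z => h (Re z) (Im z)) hc).
have G0 p : (0 <= G p)%E by rewrite lee_fin /G; case: ifP.
have pE (f : Rm -> \bar R) : (\int[leb1]_(x in `[a, b]) f x = \int[leb1]_x (if I x then f x else 0))%E.
  rewrite integral_mkcond; apply: eq_integral => x _; rewrite patchE.
  by rewrite mem_setE in_itv.
have GE1 x : (\int[leb1]_y G (x, y) = if I x then \int[leb1]_(y in `[a, b]) (h x y)%:E else 0)%E.
  case: ifP => Ix; last by rewrite integral0_eq// => y _; rewrite /G /= Ix.
  by rewrite pE; apply: eq_integral => y _; rewrite /G /= Ix /=; case: ifP.
have GE2 y : (\int[leb1]_x G (x, y) = if I y then \int[leb1]_(x in `[a, b]) (h x y)%:E else 0)%E.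
  case: ifP => Iy; last by rewrite integral0_eq// => x _; rewrite /G /= Iy andbF.
  by rewrite pE; apply: eq_integral => x _; rewrite /G /= Iy andbT; case: ifP.
rewrite pE [RHS]pE; transitivity (\int[leb1]_x \int[leb1]_y G (x, y))%E.
  by apply: eq_integral => x _; rewrite GE1.
rewrite fubini_tonelli//; apply: eq_integral => y _; exact: GE2.
Qed.

Definition cavg u (z : C) := segint 0 tau (fun t => u (z * cis t)).

Lemma tends_cis {T : Type} {F : set_system T} {FF : Filter F} (v : T -> R) t :
  v @ F --> t -> tendsC F (fun x => cis (v x)) (cis t).
Proof.
move=> vt; apply: tendsC_Complex.
  exact: (cvg_comp _ _ vt (@continuous_cos R t)).
exact: (cvg_comp _ _ vt (@continuous_sin R t)).
Qed.

Lemma contD_tends {T : Type} {F : set_system T} {FF : Filter F} u (f : T -> C) l :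
  contD u -> N l < 1 -> tendsC F f l -> u (f x) @[x --> F] --> u l.
Proof. by move=> uc l1; exact: cvg_tendsC (uc _ l1). Qed.

Lemma normc_mulcis z t : N (z * cis t) = N z.
Proof. by rewrite Normc.normcM normc_cis mulr1. Qed.

Lemma contR_rot u z : contD u -> N z < 1 -> continuous (fun t => u (z * cis t)).
Proof.
move=> uc z1 t; apply: contD_tends => //; first by rewrite normc_mulcis.
by apply: tendsCM; [exact: tendsC_cst|apply: tends_cis].
Qed.

Lemma tends_segint {T : Type} {F : set_system T} {FF : Filter F} (B : R -> T -> R) (B0 : R -> R) :
  (\forall v \near F, continuous (B ^~ v)) -> continuous B0 ->
  (forall t, B p.1 p.2 @[p --> filter_prod (nbhs t) F] --> B0 t) ->
  segint 0 tau (B ^~ v) @[v --> F] --> segint 0 tau B0.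
Proof.
move=> Bc B0c BB0.
have E f : segint 0 tau f = tau * Re (cmean (fun t => (f t)%:C%C)).
  by rewrite /cmean /= mulrC divfK// gt_eqF// tau_gt0.
rewrite E; under eq_fun do rewrite E.
apply: cvgM; first exact: cvg_cst.
apply: tendsC_Re; apply: (@tends_cmean _ _ _ _ (fun t v => (B t v)%:C%C)).
- by apply: filterS Bc => v vc t; apply: tendsC_Complex; [exact: vc|exact: cvg_cst].
- by move=> t; apply: tendsC_Complex; [exact: B0c|exact: cvg_cst].
- by move=> t; apply: tendsC_Complex; [exact: BB0|exact: cvg_cst].
Qed.

Lemma contD_cavg u : contD u -> contD (cavg u).
Proof.
move=> uc z z1; apply: (@tends_segint _ _ _ (fun t v => u (v * cis t))).
- by apply: filterS (near_normc_lt z1) => v; exact: contR_rot.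
- exact: contR_rot.
move=> t; apply: contD_tends => //; first by rewrite normc_mulcis.
apply: tendsCM; first exact: tendsC_snd (@tendsC_id _ z).
apply: tends_cis; exact: cvg_fst.
Qed.

Lemma polar (z : C) : exists2 t, 0 <= t <= tau & z = (N z)%:C%C * cis t.
Proof.
have [->|z0] := eqVneq z 0.
  by exists 0; rewrite ?lexx ?(ltW tau_gt0)// Normc.normc0 mul0r.
have n0 : 0 < N z by rewrite normc_gt0.
pose c := Re z / N z.
have c1 : -1 <= c <= 1.
  rewrite -ler_norml normrM normfV (gtr0_norm n0) ler_pdivrMr// mul1r; exact: normc_geRe.
have s2 : (Im z / N z) ^+ 2 = 1 - c ^+ 2.
  rewrite /c !expr_div_n; have := normc_sqr z => E.
  have : N z ^+ 2 != 0 by rewrite expf_neq0// gt_eqF.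
  move=> h; apply: (mulIf h); rewrite mulrBl !divfK// mul1r E; ring.
have [t tT tE] : exists2 t, 0 <= t <= tau & cis t = Complex c (Im z / N z).
  have a0 := acos_ge0 c1; have api := acos_lepi c1; have pi0 := @pi_ge0 R.
  have ct : cos (acos c) = c by rewrite acosK.
  have st : sin (acos c) = `|Im z / N z| by rewrite sin_acos// -s2 sqrtr_sqr.
  have [Im0|Im0] := leP 0 (Im z / N z).
    exists (acos c); last by rewrite /cis ct st ger0_norm.
    by rewrite a0/= (le_trans api)// /tau mulr2n lerDl.
  exists (tau - acos c); last by rewrite addrC cis_tau /cis cosN sinN ct st ltr0_norm// opprK.
  by rewrite subr_ge0 gerBl a0 andbT (le_trans api)// /tau mulr2n lerDl.
exists t => //; rewrite tE /c; case: (z) n0 {s2 tE c1 z0 c} => x y n0.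
apply/eqP; rewrite eq_complex; apply/andP; split; apply/eqP.
  by rewrite /= in n0 *; field; rewrite gt_eqF.
by rewrite /= in n0 *; field; rewrite gt_eqF.
Qed.

Lemma segint_shift (G : R -> R) a b c : a <= b -> continuous G ->
  segint a b (fun x => G (x + c)) = segint (a + c) (b + c) G.
Proof.
move=> ab Gc; have D1 : (fun x : R => x + c)^`() = cst 1 :> (R -> R).
  by apply/funext => x; rewrite derive1E derive_val addr0.
rewrite /segint /Rintegral; congr fine; symmetry.
rewrite (@integration_by_substitution_increasing _ (fun x => x + c) G a b)//.
- by apply: eq_integral => x _; rewrite D1 /= mulr1.
- by move=> x y _ _; rewrite ltrD2r.
- by rewrite D1 => x _; exact: cvg_cst.
- by rewrite D1; exact: is_cvg_cst.
- by rewrite D1; exact: is_cvg_cst.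
- split => //.
  + by apply: cvgD; [exact: cvg_at_right_filter|exact: cvg_cst].
  + by apply: cvgD; [exact: cvg_at_left_filter|exact: cvg_cst].
- exact: continuous_subspaceT.
Qed.

Lemma segint_periodic (G : R -> R) s : continuous G -> (forall x, G (x + tau) = G x) ->
  0 <= s <= tau -> segint 0 tau (fun t => G (s + t)) = segint 0 tau G.
Proof.
move=> Gc Gp /andP[s0 st]; have t0 := ltW (@tau_gt0 R).
have c a b : contI a b G by move=> x _; exact: Gc.
rewrite (eq_segint (g := fun t => G (t + s))) => [|t _]; last by rewrite addrC.
rewrite segint_shift// add0r (segint_split (c := tau))// ?lerDl//.
rewrite [RHS](segint_split (c := s))// addrC; congr (_ + _).
rewrite addrC -{1}[tau]add0r -segint_shift//.
by apply: eq_segint => t _.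
Qed.

Lemma cavg_normc u z : contD u -> N z < 1 -> cavg u z = cavg u (N z)%:C%C.
Proof.
move=> uc z1; have [s sT zE] := polar z.
have n1 : N (N z)%:C%C < 1 by rewrite normcR ger0_norm ?normc_ge0.
rewrite /cavg -(segint_periodic (contR_rot uc n1) _ sT).
  by apply: eq_segint => t _; rewrite {1}zE -mulrA -cisD.
by move=> x; rewrite cis_tau.
Qed.

End circle_average.

Section monotone_means.
Context {R : realType}.
Local Notation C := R[i].
Local Notation N := (@Normc.normc R).
Local Notation Re := (@complex.Re R).
Local Notation Im := (@complex.Im R).
Implicit Types (u : C -> R).

Section maximum_principle.
Variable u : C -> R.
Hypothesis uc : contD u.
Hypothesis u0 : forall z, 0 <= u z.
Hypothesis usub : forall c, N c < 1 -> exists2 r0, 0 < r0 & forall r, 0 < r -> r < r0 ->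
  N c + r < 1 /\ forall s, 0 <= s <= tau ->
    tau * u (c * cis s) <= segint 0 tau (fun t => u (circ c r t * cis s)).

Let cavg_submean c : N c < 1 -> exists2 r0, 0 < r0 & forall r, 0 < r -> r < r0 ->
  N c + r < 1 /\ tau * cavg u c <= segint 0 tau (fun t => cavg u (circ c r t)).
Proof.
move=> c1; have [r0 r00 rP] := usub c1; exists r0 => // r rp rr0.
have [cr uP] := rP r rp rr0; split=> //.
have n1 t : N (circ c r t) < 1.
  rewrite (le_lt_trans _ cr)// /circ (le_trans (le_normcD _ _))// lerD2l.
  by rewrite normc_mulcis normcR gtr0_norm.
have hc w : u (circ c r (Im v) * cis (Re v)) @[v --> nearC w] -->
    u (circ c r (Im w) * cis (Re w)).
  apply: contD_tends => //; first by rewrite normc_mulcis.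
  apply: tendsCM; last by apply: tends_cis; exact: tendsC_Re (@tendsC_id _ w).
  by apply: tends_circ; [exact: cvg_cst|exact: tendsC_Im (@tendsC_id _ w)].
have cc s : continuous (fun t => u (circ c r t * cis s)).
  move=> t; apply: contD_tends => //; first by rewrite normc_mulcis.
  by apply: tendsCM; [exact: contR_circ|exact: tendsC_cst].
have c1' : contI 0 tau (fun s => segint 0 tau (fun t => u (circ c r t * cis s))).
  move=> s _; apply: (@tends_segint _ _ _ _ (fun t s => u (circ c r t * cis s))).
  - by apply: nearW => s'; exact: cc.
  - exact: cc.
  move=> t; apply: contD_tends => //; first by rewrite normc_mulcis.
  apply: tendsCM; first exact: tendsC_fst (contR_circ c r t).
  by apply: tends_cis; exact: cvg_snd.
have c2' : contI 0 tau (fun t => segint 0 tau (fun s => u (circ c r t * cis s))).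
  move=> t _; apply: (contD_tends (contD_cavg uc)) => //; exact: contR_circ.
have cu : contI 0 tau (fun s => u (c * cis s)) by move=> s _; exact: contR_rot.
rewrite /cavg -segintZ//.
rewrite -(@segint_swap _ _ _ (fun s t => u (circ c r t * cis s)))//.
apply: le_segint => //; apply: contIM => //; exact: contI_cst.
Qed.

Lemma cavg_nondecreasing s r : 0 <= s -> s <= r -> r < 1 -> cavg u s%:C%C <= cavg u r%:C%C.
Proof.
move=> s0 sr r1; pose V x := cavg u x%:C%C.
have Vc x : 0 <= x < 1 -> {for x, continuous V}.
  move=> /andP[x0 x1]; apply: (contD_tends (contD_cavg uc)); first by rewrite normcR ger0_norm.
  by apply: tendsC_Complex; [exact: cvg_id|exact: cvg_cst].
have r0 : 0 <= r by exact: le_trans sr.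
have Vw : {within `[0, r], continuous V}.
  by apply: contI_within => x /andP[x0 xr]; apply: Vc; rewrite x0 (le_lt_trans xr).
have [m + mV] := EVT_max r0 Vw; rewrite in_itv/= => /andP[m0 mr].
pose S := [set x | 0 <= x <= r /\ V x = V m].
have Sr : ubound S r by move=> x [/andP[]].
have Sm : S m by rewrite /S/= m0 mr.
have hs : has_sup S by split; [exists m|exists r].
pose t := sup S.
have tr : t <= r by apply: ge_sup => //; exists m.
have St x : S x -> x <= t by exact: sup_upper_bound.
have mt : m <= t by exact: St.
have t0 : 0 <= t by exact: le_trans mt.
have t1 : t < 1 by exact: le_lt_trans r1.
have Vt : V t = V m.
  apply/eqP; rewrite eq_le mV ?in_itv/= ?t0 ?tr//; apply/ler_addgt0Pr => e e0.
  have : \forall x \near t, `|V t - V x| < e.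
    have Vct : V x @[x --> t] --> V t by apply: Vc; rewrite t0.
    exact: near_dist_lt Vct e0.
  move=> /nbhs_ballP[d /= d0 dP].
  have [x [xr xm] tx] := sup_adherent d0 hs.
  have xt : x <= t by apply: St.
  have xd : `|t - x| < d by rewrite ger0_norm ?subr_ge0// ltrBlDr addrC -ltrBlDr.
  by have := dP x xd; rewrite /= xm ltr_norml => /andP[]; lra.
have Vmax x : 0 <= x <= r -> V x <= V t by move=> xr; rewrite Vt; apply: mV; rewrite in_itv.
suff -> : cavg u r%:C%C = V t by apply: Vmax; rewrite s0.
have [<-//|tr'] := eqVneq t r; have {}tr' : t < r by rewrite lt_neqAle tr'.
have t1c : N (t%:C%C : C) < 1 by rewrite normcR ger0_norm.
have [d0 d00 dP] := cavg_submean t1c.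
pose d := Num.min (d0 / 2) (r - t).
have d0' : 0 < d by rewrite lt_min divr_gt0//= subr_gt0.
have dd0 : d < d0 by rewrite gt_min ltr_pdivrMr// mulr2n mulrDr mulr1 ltrDl d00.
have dr : t + d <= r by rewrite -lerBrDl ge_min lexx orbT.
have [td dsub] := dP d d0' dd0.
have n1 x : N (circ t%:C%C d x) <= r.
  rewrite (le_trans (le_normcD _ _))// normc_mulcis !normcR !ger0_norm// ltW//.
have cV x : cavg u (circ t%:C%C d x) <= V t.
  rewrite cavg_normc//; last by rewrite (le_lt_trans (n1 x)).
  by apply: Vmax; rewrite normc_ge0 n1.
have cc : contI 0 tau (fun x => cavg u (circ t%:C%C d x)).
  move=> x _; apply: (contD_tends (contD_cavg uc)); first exact: le_lt_trans (n1 x) r1.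
  exact: contR_circ.
have c' : contI 0 tau (fun x => V t - cavg u (circ t%:C%C d x)).
  by apply: contIB => //; exact: contI_cst.
have := @segint_eq0 _ _ _ _ (@tau_gt0 R) c'.
have h0 x : 0 <= x <= tau -> 0 <= V t - cavg u (circ t%:C%C d x) by rewrite subr_ge0.
move=> /(_ h0); rewrite segintB//; last exact: contI_cst.
rewrite segint_cst ?(ltW tau_gt0)// subr0 mulrC subr_le0 => /(_ dsub 0).
rewrite lexx (ltW tau_gt0) => /(_ isT)/eqP; rewrite subr_eq0 => /eqP E.
have : S (t + d).
  split; first by rewrite dr addr_ge0// ltW.
  rewrite -Vt E /circ cis0 mulr1 /V; congr (cavg u _).
  by rewrite rmorphD.
by move=> /St; rewrite gerDl leNgt d0'.
Qed.

End maximum_principle.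

Lemma continuous_powR_gt0 p (t : R) : 0 < t -> {for t, continuous (fun t : R => t `^ p)}.
Proof.
move=> t0; apply: differentiable_continuous; apply/derivable1_diffP.
by apply: derivable_powR; rewrite in_itv/= t0.
Qed.

Lemma cvg_powR_ge0 {T : Type} {F : set_system T} {FF : Filter F} (f : T -> R) (p l : R) :
  0 < p -> (forall x, 0 <= f x) -> 0 <= l -> f @ F --> l -> f x `^ p @[x --> F] --> l `^ p.
Proof.
move=> p0 f0 l0 fl; have [l00|ln0] := eqVneq l 0.
  rewrite l00 powR0 ?gt_eqF//; apply/cvgrPdist_lt => e e0.
  have d0 : 0 < e `^ p^-1 by rewrite powR_gt0.
  have h : \forall x \near F, `|l - f x| < e `^ p^-1 by exact: near_dist_lt fl d0.
  apply: filterS h => x; rewrite l00 !sub0r !normrN ger0_norm// ger0_norm ?powR_ge0// => h.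
  have -> : e = (e `^ p^-1) `^ p by rewrite -powRrM mulVf ?gt_eqF// powRr1// ltW.
  by rewrite gt0_ltr_powR// nnegrE ?f0// powR_ge0.
have {l0 ln0} l0 : 0 < l by rewrite lt_neqAle eq_sym ln0.
exact: (cvg_comp _ _ fl (continuous_powR_gt0 l0)).
Qed.

Variables (F : C -> C) (p : R).
Hypothesis Fh : holoD F.
Hypothesis p0 : 0 < p.

Lemma contD_normc_powR : contD (fun z => N (F z) `^ p).
Proof.
move=> z z1; have : N (F w) @[w --> nearC z] --> N (F z).
  by apply: tendsC_normc; apply: cdble_cont; exact: Fh.
by apply: cvg_powR_ge0 => // *; exact: normc_ge0.
Qed.

Let ud d z := Num.max (N (F z) `^ p) d.

Let contD_ud d : contD (ud d).
Proof.
move=> z z1; have E x : ud d x = (N (F x) `^ p + d + `|N (F x) `^ p - d|) / 2 by rewrite /ud maxr_absE.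
rewrite E; under eq_fun do rewrite E.
have h := contD_normc_powR z1.
apply: cvgM; last exact: cvg_cst.
apply: cvgD; first by apply: cvgD h _; exact: cvg_cst.
by apply: cvg_norm; apply: cvgB h _; exact: cvg_cst.
Qed.

(* Where [|F|^p <= d] the truncation is constant; elsewhere [submean_local]
   applies on a ball whose radius does not depend on the rotation [s]. *)
Let ud_submean d : 0 < d -> forall c, N c < 1 -> exists2 r0, 0 < r0 & forall r, 0 < r -> r < r0 ->
  N c + r < 1 /\ forall s, 0 <= s <= tau ->
    tau * ud d (c * cis s) <= segint 0 tau (fun t => ud d (circ c r t * cis s)).
Proof.
move=> d0 c c1; pose e := d `^ p^-1.
have e0 : 0 < e by rewrite powR_gt0.
have ep : e `^ p = d by rewrite -powRrM mulVf ?gt_eqF// powRr1// ltW.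
have Fcont z : N z < 1 -> tendsC (nearC z) F (F z) by move=> z1; apply: cdble_cont; exact: Fh.
have : \forall v \near nearC c, forall s, 0 <= s <= tau -> N (F (c * cis s) - F (v * cis s)) < e.
  apply: (@near_unif _ _ _ _ (fun s v => F (v * cis s)) (fun s => F (c * cis s))) => //.
    move=> s; apply: tendsC_comp (Fcont _ _); last by rewrite normc_mulcis.
    by apply: tendsCM; [exact: tendsC_cst|apply: tends_cis; exact: cvg_id].
  move=> s; apply: tendsC_comp (Fcont _ _); last by rewrite normc_mulcis.
  apply: tendsCM; first exact: tendsC_snd (@tendsC_id _ c).
  by apply: tends_cis; exact: cvg_fst.
move=> [r1 r10 rP]; exists (Num.min r1 (1 - N c)); first by rewrite lt_min r10 subr_gt0.
move=> r rp; rewrite lt_min => /andP[rr1 rc].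
have cr1 : N c + r < 1 by rewrite -ltrBrDl.
have inD z : N (z - c) <= r -> N z < 1.
  move=> h; rewrite (le_lt_trans _ cr1)// -[z in N z](subrK c) addrC (le_trans (le_normcD _ _))//.
  by rewrite lerD2l.
split=> // s sT.
have nc t : N (circ c r t - c) <= r by rewrite normc_circ// ltW.
have ccu : contI 0 tau (fun t => ud d (circ c r t * cis s)).
  move=> t _; apply: (contD_tends (f := fun t => circ c r t * cis s) (@contD_ud d)); first by rewrite normc_mulcis; exact: inD.
  by apply: tendsCM; [exact: contR_circ|exact: tendsC_cst].
have [le_e|gt_e] := leP (N (F (c * cis s))) e.
  have -> : ud d (c * cis s) = d.
    by apply/max_idPr; rewrite -ep ge0_ler_powR ?nnegrE ?normc_ge0 ?(ltW p0)// ltW.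
  rewrite mulrC -{1}[tau]subr0 -segint_cst ?(ltW tau_gt0)//.
  by apply: le_segint => // [|t _]; [exact: contI_cst|rewrite le_max lexx orbT].
have udE : ud d (c * cis s) = N (F (c * cis s)) `^ p.
  by apply/max_idPl; rewrite -ep ge0_ler_powR ?nnegrE ?normc_ge0 ?(ltW p0)// ltW.
have sub := @submean_local _ (fun z => F (z * cis s)) c r p rp.
rewrite udE; apply: (le_trans (sub _)).
  move=> z zr; split.
    apply: (@cdble_comp _ (fun z => z * cis s)); last by apply: Fh; rewrite normc_mulcis inD.
    by apply: cdbleM; [exact: cdble_id|exact: cdble_cst].
  apply: lt_trans gt_e; rewrite normcB; apply: rP => //.
  by rewrite normcB (le_lt_trans zr).
apply: le_segint => // [|t _]; last by rewrite le_max lexx.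
move=> t _; apply: (contD_tends (f := fun t => circ c r t * cis s) contD_normc_powR); first by rewrite normc_mulcis; exact: inD.
by apply: tendsCM; [exact: contR_circ|exact: tendsC_cst].
Qed.

Lemma cavg_powR_nondecreasing s r : 0 <= s -> s <= r -> r < 1 ->
  cavg (fun z => N (F z) `^ p) s%:C%C <= cavg (fun z => N (F z) `^ p) r%:C%C.
Proof.
move=> s0 sr r1; apply/ler_addgt0Pr => e e0; pose d := e / tau.
have d0 : 0 < d by rewrite divr_gt0// tau_gt0.
have c (u : C -> R) x : contD u -> 0 <= x -> x <= r -> contI 0 tau (fun t => u (x%:C%C * cis t)).
  by move=> uc x0 xr t _; apply: contR_rot => //; rewrite normcR ger0_norm// (le_lt_trans xr).
have r0 := le_trans s0 sr.
have h1 : cavg (fun z => N (F z) `^ p) s%:C%C <= cavg (ud d) s%:C%C.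
  apply: le_segint; [exact: (c _ _ contD_normc_powR)|exact: (c _ _ (@contD_ud d))|].
  by move=> t _; rewrite le_max lexx.
have h2 : cavg (ud d) s%:C%C <= cavg (ud d) r%:C%C.
  apply: cavg_nondecreasing => //; last exact: ud_submean.
  by move=> z; rewrite le_max powR_ge0.
apply: (le_trans h1); apply: (le_trans h2).
rewrite [e in leRHS](_ : e = segint 0 tau (fun=> d)); last first.
  by rewrite segint_cst ?(ltW tau_gt0)// subr0 divfK// gt_eqF// tau_gt0.
rewrite -segintD; [|exact: (c _ _ contD_normc_powR)|exact: contI_cst].
apply: le_segint; first exact: (c _ _ (@contD_ud d)).
  by apply: contID; [exact: (c _ _ contD_normc_powR)|exact: contI_cst].
by move=> t _; rewrite ge_max lerDl lerDr (ltW d0) powR_ge0.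
Qed.

End monotone_means.

(** * Chebyshev's inequality for radial weights *)

Section chebyshev.
Context {R : realType}.
Local Notation C := R[i].
Local Notation N := (@Normc.normc R).
Notation Rm := (measurableTypeR R).
Notation leb1 := (@leb1 R).
Notation leb2 := (@leb2 R).
Notation cpt := (@cpt R).
Variable A : R.
Hypothesis A0 : 0 < A.
Hypothesis AE : @unit_area R = A%:E.

Lemma contDM (f g : C -> R) : contD f -> contD g -> contD (fun z => f z * g z).
Proof. by move=> fc gc z z1; apply: cvgM; [exact: fc|exact: gc]. Qed.

Lemma contD_rot (h : C -> R) e : N e = 1 -> contD h -> contD (fun z => h (e * z)).
Proof.
move=> e1 hc z z1; apply: contD_tends => //; first by rewrite Normc.normcM e1 mul1r.
by apply: tendsCM; [exact: tendsC_cst|exact: tendsC_id].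
Qed.

Lemma intC_rotation (h : C -> R) e : N e = 1 -> contD h -> (forall z, N z < 1 -> 0 <= h z) ->
  intC (dext (fun z => h (e * z))) = intC (dext h).
Proof.
move=> e1 hc h0; apply/eqP; rewrite eq_le (intC_rotation_le A0 AE)//=.
have e0 : e != 0 by rewrite -normc_gt0 e1.
have := @intC_rotation_le _ _ A0 AE e^-1 (fun z => h (e * z)).
rewrite Normc.normcV e1 invr1 => /(_ erefl (contD_rot e1 hc)).
have h0' z : N z < 1 -> 0 <= h (e * z) by move=> z1; apply: h0; rewrite Normc.normcM e1 mul1r.
move=> /(_ h0'); apply: le_trans.
rewrite le_eqVlt; apply/orP; left; apply/eqP; congr intC; apply/funext => z.
by rewrite /dext mulVKf.
Qed.

Lemma intC_cavg (u g : C -> R) : contD u -> (forall z, 0 <= u z) ->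
  contD g -> (forall z, N z < 1 -> 0 <= g z) ->
  (forall e z, N e = 1 -> g (e * z) = g z) ->
  (intC (dext (fun z => cavg u z * g z)%R) = tau%:E * intC (dext (fun z => u z * g z)%R))%E.
Proof.
move=> uc u0 gc g0 grot.
pose I t := (0 <= t) && (t <= @tau R).
pose G (p : (Rm * Rm) * Rm) : \bar R :=
  (if I p.2 then dext g (cpt p.1) * dext u (cpt p.1 * cis p.2) else 0)%:E.
have mG : measurable_fun setT G.
  apply/measurable_EFinP; apply: measurable_fun_ifT => //.
    by apply: measurable_and; apply: measurable_fun_ler.
  apply: measurable_funM.
    exact: (measurableT_comp (measC_dext gc) (@measurable_fst _ _ _ _)).
  pose T (p : (Rm * Rm) * Rm) : Rm * Rm :=
    (p.1.1 * cos p.2 - p.1.2 * sin p.2, p.1.1 * sin p.2 + p.1.2 * cos p.2).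
  have -> : (fun p : (Rm * Rm) * Rm => dext u (cpt p.1 * cis p.2)) = (dext u \o cpt) \o T.
    by apply/funext => -[[x y] t].
  apply: measurableT_comp; first exact: measC_dext.
  have m1 : measurable_fun setT (fun p : (Rm * Rm) * Rm => p.1.1).
    exact: (measurableT_comp (@measurable_fst _ _ Rm Rm) (@measurable_fst _ _ _ _)).
  have m2 : measurable_fun setT (fun p : (Rm * Rm) * Rm => p.1.2).
    exact: (measurableT_comp (@measurable_snd _ _ Rm Rm) (@measurable_fst _ _ _ _)).
  have mc : measurable_fun setT (fun p : (Rm * Rm) * Rm => cos p.2).
    by apply: measurableT_comp => //; apply: continuous_measurable_fun; exact: continuous_cos.
  have ms : measurable_fun setT (fun p : (Rm * Rm) * Rm => sin p.2).
    by apply: measurableT_comp => //; apply: continuous_measurable_fun; exact: continuous_sin.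
  by apply: measurable_fun_pair; [apply: measurable_funB|apply: measurable_funD]; apply: measurable_funM.
have G0 p : (0 <= G p)%E.
  by rewrite lee_fin; case: ifP => // _; rewrite mulr_ge0// dext_ge0.
have pE (f : Rm -> \bar R) : (\int[leb1]_(x in `[0%R, tau]) f x = \int[leb1]_x (if I x then f x else 0))%E.
  by rewrite integral_mkcond; apply: eq_integral => x _; rewrite patchE mem_setE in_itv.
transitivity (\int[leb2]_x \int[leb1]_t G (x, t))%E.
  apply: eq_integral => x _; rewrite /dext; case: ifPn => x1.
    rewrite mulrC /cavg -segintZ; last by move=> t _; exact: contR_rot.
    rewrite EFin_segint; last first.
      by apply: contIM; [exact: contI_cst|move=> t _; exact: contR_rot].
    rewrite pE; apply: eq_integral => t _; rewrite /G /= /dext normc_mulcis x1.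
    by case: ifP.
  by rewrite integral0_eq// => t _; rewrite /G /= /dext (negbTE x1) mul0r if_same.
rewrite fubini_tonelli//.
transitivity (\int[leb1]_(t in `[0%R, tau]) (intC (dext (fun z => u z * g z)%R)))%E.
  rewrite pE; apply: eq_integral => t _; rewrite /G /=.
  case: ifPn => It; last by rewrite integral0_eq.
  rewrite -(@intC_rotation (fun z => u z * g z) (cis t)); rewrite ?normc_cis//.
  - apply: eq_integral => x _; rewrite /dext normc_mulcis; case: ifPn => x1; last by rewrite mul0r.
    by rewrite grot ?normc_cis// mulrC [cpt x * _]mulrC.
  - exact: contDM.
  - by move=> z z1; rewrite mulr_ge0// g0.
rewrite integral_cst//= /leb1 lebesgue_measure_itv/= lte_fin tau_gt0.
by rewrite -EFinB subr0 muleC.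
Qed.

Lemma weighted_mean_le (F : C -> C) (p kap r0 : R) (W K : R -> R) :
  holoD F -> 0 < p -> 0 <= r0 < 1 -> 0 <= kap ->
  contD (fun z => W (N z)) -> contD (fun z => K (N z)) ->
  (forall x, 0 <= x < 1 -> 0 <= W x) -> (forall x, 0 <= x < 1 -> 0 <= K x) ->
  (forall x, 0 <= x -> x <= r0 -> K x <= kap) ->
  (forall x, r0 <= x -> x < 1 -> kap <= K x) ->
  (intC (dext (fun z => W (N z))) < +oo)%E ->
  (intC (dext (fun z => K (N z) * W (N z))%R) = kap%:E * intC (dext (fun z => W (N z))))%E ->
  (kap%:E * intC (dext (fun z => N (F z) `^ p * W (N z))%R) <=
   intC (dext (fun z => N (F z) `^ p * (K (N z) * W (N z)))%R))%E.
Proof.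
move=> Fh p0 /andP[r00 r01] kap0 Wc Kc W0 K0 Kle Kge Wfin KW.
pose u z := N (F z) `^ p.
have uc : contD u by exact: contD_normc_powR.
have u0 z : 0 <= u z by exact: powR_ge0.
have N01 z : N z < 1 -> 0 <= N z < 1 by move=> ->; rewrite normc_ge0.
have NM (e z : C) : N e = 1 -> N (e * z) = N z by rewrite Normc.normcM => ->; rewrite mul1r.
have W0' z : N z < 1 -> 0 <= W (N z) by move=> /N01; exact: W0.
have KWc : contD (fun z => K (N z) * W (N z)) by exact: contDM.
have KW0 z : N z < 1 -> 0 <= K (N z) * W (N z) by move=> z1; rewrite mulr_ge0 ?W0 ?K0 ?N01.
have tp : (0 < (@tau R)%:E)%E by rewrite lte_fin tau_gt0.
rewrite -(lee_pmul2l _ tp)// muleCA -!intC_cavg//; try by move=> e z /NM ->.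
have Vc := contD_cavg uc.
have V0 z : 0 <= cavg u z by apply: segint_ge0.
pose V0r := cavg u r0%:C%C.
pose mVW := dext (fun z => cavg u z * W (N z)).
pose mVKW := dext (fun z => cavg u z * (K (N z) * W (N z))).
pose mW := dext (fun z => W (N z)).
pose mKW := dext (fun z => K (N z) * W (N z)).
(* The circle mean minus its value at [r0] and [K - kap] have the same sign. *)
have pt z : kap * mVW z + V0r * mKW z <= mVKW z + V0r * kap * mW z.
  rewrite /mVW /mVKW /mW /mKW /dext; case: ifPn => z1; last by rewrite !mulr0 addr0.
  rewrite cavg_normc//.
  set v := cavg u (N z)%:C%C; set k := K (N z); set w := W (N z).
  have w0 : 0 <= w by exact: W0'.
  suff h : 0 <= (v - V0r) * (k - kap).
    rewrite -subr_ge0; have -> : v * (k * w) + V0r * kap * w - (kap * (v * w) + V0r * (k * w)) =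
      (v - V0r) * (k - kap) * w by ring.
    exact: mulr_ge0.
  have [zr|rz] := leP (N z) r0.
    apply: mulr_le0; rewrite subr_le0; last by apply: Kle => //; exact: normc_ge0.
    apply: cavg_powR_nondecreasing => //; exact: normc_ge0.
  apply: mulr_ge0; rewrite subr_ge0; last by apply: Kge => //; exact: ltW.
  by apply: cavg_powR_nondecreasing => //; exact: ltW.
have V0r0 : 0 <= V0r by exact: V0.
have n1 z : 0 <= mVW z by apply: dext_ge0 => w w1; apply: mulr_ge0; [exact: V0|exact: W0'].
have n2 z : 0 <= mVKW z by apply: dext_ge0 => w w1; apply: mulr_ge0; [exact: V0|exact: KW0].
have n3 z : 0 <= mW z by apply: dext_ge0.
have n4 z : 0 <= mKW z by apply: dext_ge0.
have m1 : measC mVW by apply: measC_dext; exact: contDM.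
have m2 : measC mVKW by apply: measC_dext; exact: contDM.
have m3 : measC mW by exact: measC_dext.
have m4 : measC mKW by exact: measC_dext.
have intZ (c : R) (f : C -> R) : 0 <= c -> measC f -> (forall z, 0 <= f z) ->
    intC (fun z => c * f z) = (c%:E * intC f)%E.
  move=> c0 mf f0; rewrite /intC -ge0_integralZl ?lee_fin//.
    by apply/measurable_EFinP.
  by move=> x _; rewrite lee_fin.
have intD (f g : C -> R) : measC f -> measC g -> (forall z, 0 <= f z) -> (forall z, 0 <= g z) ->
    intC (fun z => f z + g z) = (intC f + intC g)%E.
  move=> mf mg f0 g0; rewrite /intC -ge0_integralD//.
  - by move=> x _; rewrite lee_fin.
  - by apply/measurable_EFinP.
  - by move=> x _; rewrite lee_fin.
  - by apply/measurable_EFinP.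
have mZ (c : R) f : measC f -> measC (fun z => c * f z).
  by move=> mf; apply: measurable_funM => //; exact: mf.
have : (intC (fun z => kap * mVW z + V0r * mKW z)%R <=
        intC (fun z => mVKW z + V0r * kap * mW z)%R)%E.
  apply: ge0_le_integral => //.
  - by move=> x _; rewrite lee_fin addr_ge0// mulr_ge0.
  - by apply/measurable_EFinP; apply: measurable_funD; apply: mZ.
  - by apply/measurable_EFinP; apply: measurable_funD => //; apply: mZ.
  - by move=> x _; rewrite lee_fin.
rewrite !intD ?intZ ?mulr_ge0//; try exact: mZ; try by move=> z; rewrite !mulr_ge0.
rewrite KW muleA -EFinM leeD2rE//.
rewrite fin_numM// ge0_fin_numE// integral_ge0// => x _; rewrite lee_fin; exact: n3.
Qed.

End chebyshev.

Section radial_integral.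
Context {R : realType}.
Local Notation C := R[i].
Local Notation N := (@Normc.normc R).
Notation Rm := (measurableTypeR R).
Notation leb1 := (@leb1 R).
Notation leb2 := (@leb2 R).
Notation cpt := (@cpt R).
Variable A : R.
Hypothesis A0 : 0 < A.
Hypothesis AE : @unit_area R = A%:E.

Let phi (x : Rm * Rm) : Rm := N (cpt x) ^+ 2.

Let measurable_phi : measurable_fun setT phi.
Proof.
apply: measurable_funX; have -> : (fun x => N (cpt x)) = (fun z : C => N (z - 0)) \o cpt.
  by apply/funext => x; rewrite /comp (subr0 (cpt x : C)).
exact: measC_normB.
Qed.

Let mphi (D : set Rm) : measurable D -> measurable (phi @^-1` D).
Proof. by move=> mD; rewrite -[X in measurable X]setTI; exact: measurable_phi. Qed.

Let disk_area b : 0 < b -> leb2 [set x | phi x < b] = (A * b)%:E.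
Proof.
move=> b0; have s0 : 0 < Num.sqrt b by rewrite sqrtr_gt0.
have := intC_ballE 0 s0; rewrite sqr_sqrtr ?(ltW b0)// AE -EFinM mulrC => <-.
have mb : measurable [set x | phi x < b].
  have -> : [set x | phi x < b] = phi @^-1` `]-oo, b[.
    by apply/seteqP; split=> x /=; rewrite in_itv.
  exact: mphi.
rewrite -[RHS](_ : (\int[leb2]_x (\1_[set x | phi x < b] x)%:E)%E = _).
  by rewrite integral_indic// setIT.
apply: eq_integral => x _; rewrite indicE /ballI subr0.
have -> : (N (cpt x) < Num.sqrt b) = (phi x < b).
  by rewrite -(@ltr_pXn2r _ 2%N)// ?nnegrE ?normc_ge0 ?sqrtr_ge0// (sqr_sqrtr (ltW b0)).
have -> : (x \in [set x | phi x < b]) = (phi x < b) by apply/idP/idP; rewrite inE.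
by case: ifP.
Qed.

Let closed_disk_area b : 0 <= b -> leb2 [set x | phi x <= b] = (A * b)%:E.
Proof.
move=> b0; have mle c : measurable [set x | phi x <= c].
  have -> : [set x | phi x <= c] = phi @^-1` `]-oo, c].
    by apply/seteqP; split=> x /=; rewrite in_itv.
  exact: mphi.
have mlt c : measurable [set x | phi x < c].
  have -> : [set x | phi x < c] = phi @^-1` `]-oo, c[.
    by apply/seteqP; split=> x /=; rewrite in_itv.
  exact: mphi.
apply/eqP; rewrite eq_le; apply/andP; split; last first.
  have [->|bn0] := eqVneq b 0; first by rewrite mulr0 measure_ge0.
  rewrite -disk_area ?lt_neqAle 1?eq_sym ?bn0//.
  by apply: le_measure; rewrite ?inE// => x /= /ltW.
apply/lee_addgt0Pr => e e0; rewrite -EFinD.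
have -> : A * b + e = A * (b + e / A) by field; rewrite gt_eqF.
have eA : 0 < e / A by rewrite divr_gt0.
rewrite -disk_area ?ltr_wpDl//.
by apply: le_measure; rewrite ?inE// => x /= h; rewrite (le_lt_trans h)// ltrDl.
Qed.

Let neg_itv : measurable (`]-oo, 0%R[%classic : set Rm).
Proof. exact: measurable_itv. Qed.

Let Ainv_gt0 : 0 < A^-1. Proof. by rewrite invr_gt0. Qed.

Let Anng : {nonneg R} := NngNum (ltW Ainv_gt0).

(* The half-line makes [nu] agree with Lebesgue measure on all of [R], so that
   its uniqueness applies; it does not meet [[0, 1[]. *)
Let half : {measure set Rm -> \bar R} := mrestr leb1 neg_itv.
Let push : {measure set Rm -> \bar R} :=
  measure_function_pushforward__canonical__measure_function_Measure leb2 measurable_phi.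
Let nu : {measure set Rm -> \bar R} := measure_add (mscale Anng push) half.

Let nuE X : nu X = (A^-1%:E * leb2 (phi @^-1` X) + leb1 (X `&` `]-oo, 0%R[))%E.
Proof. exact: measure_addE. Qed.

Let lebE (X : set Rm) : measurable X -> leb1 X = nu X.
Proof.
move=> mX; apply: lebesgue_measure_unique => // _ [[a b] _ <-].
rewrite nuE /leb1 /=.
have [ba|ab] := leP b a.
  by rewrite set_itv_ge ?bnd_simp -?leNgt// set0I !measure0 mule0 adde0.
rewrite lebesgue_measure_itv/= lte_fin ab -EFinB.
have E : phi @^-1` `]a, b] = [set x | a < phi x <= b].
  by apply/seteqP; split=> x /=; rewrite in_itv.
rewrite E; have phi0 x : 0 <= phi x by exact: sqr_ge0.
have [b0|b0] := ltP b 0.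
  have -> : [set x | a < phi x <= b] = set0.
    by rewrite -subset0 => x /= /andP[_]; rewrite leNgt (lt_le_trans b0).
  rewrite measure0 mule0 add0e.
  have -> : `]a, b]%classic `&` `]-oo, 0%R[%classic = `]a, b]%classic.
    apply/seteqP; split=> x /=; rewrite !in_itv/=; first by case.
    by move=> /andP[-> xb]; rewrite xb (le_lt_trans xb).
  by rewrite lebesgue_measure_itv/= lte_fin ab -EFinB.
have [a0|a0] := ltP a 0.
  have -> : [set x | a < phi x <= b] = [set x | phi x <= b].
    by apply/seteqP; split=> x /=; rewrite (lt_le_trans a0).
  have -> : `]a, b]%classic `&` `]-oo, 0%R[%classic = `]a, 0[%classic.
    apply/seteqP; split=> x /=; rewrite !in_itv/=; first by move=> [/andP[-> _] ->].
    by move=> /andP[-> x0]; rewrite x0 (ltW (lt_le_trans x0 b0)).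
  rewrite closed_disk_area// lebesgue_measure_itv/= lte_fin a0 -EFinB -EFinM -EFinD.
  by rewrite sub0r mulKf// gt_eqF.
have -> : `]a, b]%classic `&` `]-oo, 0%R[%classic = set0.
  rewrite -subset0 => x /=; rewrite !in_itv/= => -[/andP[ax _]].
  by rewrite ltNge (le_trans a0)// ltW.
rewrite measure0 adde0.
have mle c : measurable [set x | phi x <= c].
  have -> : [set x | phi x <= c] = phi @^-1` `]-oo, c].
    by apply/seteqP; split=> x /=; rewrite in_itv.
  exact: mphi.
have mab : measurable [set x | a < phi x <= b] by rewrite -E; exact: mphi.
have : leb2 [set x | phi x <= b] =
    (leb2 [set x | (a < phi x <= b)%R] + leb2 [set x | (phi x <= a)%R])%E.
  rewrite -measureU//.
    congr leb2; apply/seteqP; split=> x /=.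
      by case: (leP (phi x) a) => h1 h2; [right|left; rewrite h2].
    by case=> [/andP[]//|h]; rewrite (le_trans h)// ltW.
  by rewrite -subset0 => x /= [/andP[+ _]]; rewrite ltNge => /negP.
rewrite !closed_disk_area//; case: (leb2 _) => [c||]//= [].
move=> E2; have -> : c = A * b - A * a by rewrite E2 addrK.
by rewrite -EFinM -mulrBr mulKf// gt_eqF.
Qed.

Lemma intC_radial (f : Rm -> Rm) : measurable_fun (`[0%R, 1%R[ : set Rm) f ->
  (forall t, 0 <= t < 1 -> 0 <= f t) ->
  intC (dext (fun z => f (N z ^+ 2))) = (A%:E * \int[leb1]_(t in `[0%R, 1%R[) (f t)%:E)%E.
Proof.
move=> mf f0.
have mI : measurable (`[0%R, 1%R[ : set Rm) by exact: measurable_itv.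
have mf' : measurable_fun (`[0%R, 1%R[ : set Rm) (EFin \o f) by apply/measurable_EFinP.
have f0' (t : Rm) : `[0%R, 1%R[%classic t -> (0 <= (f t)%:E)%E.
  by rewrite /= in_itv/= lee_fin; exact: f0.
rewrite (@eq_measure_integral _ _ _ _ nu); last by move=> B mB _; exact: lebE.
rewrite ge0_integral_measure_add//.
rewrite [X in (_ + X)%E]null_set_integral//; last first.
  rewrite /half /= /mrestr (_ : _ `&` _ = set0) ?measure0//.
  by rewrite -subset0 => t /=; rewrite !in_itv/= => -[/andP[h _]]; rewrite ltNge h.
rewrite adde0 ge0_integral_mscale//= muleA -EFinM divff ?gt_eqF// mul1e.
rewrite ge0_integral_pushforward//; last by move=> t; rewrite inE; exact: f0'.
rewrite integral_mkcond; apply: eq_integral => x _; rewrite patchE /dext.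
have -> : (x \in phi @^-1` `[0%R, 1%R[) = (N (cpt x) < 1).
  have -> : (N (cpt x) < 1) = (phi x < 1).
    by rewrite /phi -[in RHS](expr1n _ 2) ltr_pXn2r// ?nnegrE ?normc_ge0.
  by apply/idP/idP; rewrite inE /preimage/= in_itv/= sqr_ge0.
by case: ifP.
Qed.

End radial_integral.

(** * The Beta-Gamma relation *)

Section Gamma_function.
Context {R : realType}.
Notation Rm := (measurableTypeR R).
Notation leb1 := (@leb1 R).
Implicit Types x y : R.

Definition gam x (t : Rm) : Rm := if 0 < t then t `^ (x - 1) * expR (- t) else 0.

Definition bet x y (t : Rm) : Rm :=
  if (0 < t) && (t < 1) then t `^ (x - 1) * (1 - t) `^ (y - 1) else 0.

Definition Gint x : \bar R := (\int[leb1]_t (gam x t)%:E)%E.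

Definition Bint x y : \bar R := (\int[leb1]_t (bet x y t)%:E)%E.

Lemma one_powR x : 1 `^ x = 1 :> R.
Proof. by rewrite powR1. Qed.

Lemma gam_ge0 x t : 0 <= gam x t.
Proof. by rewrite /gam; case: ifP => // _; rewrite mulr_ge0 ?powR_ge0 ?expR_ge0. Qed.

Lemma bet_ge0 x y t : 0 <= bet x y t.
Proof. by rewrite /bet; case: ifP => // _; rewrite mulr_ge0 ?powR_ge0. Qed.

Lemma measurable_gam x : measurable_fun setT (gam x).
Proof.
apply: measurable_fun_ifT => //; first exact: measurable_fun_ltr.
apply: measurable_funM; first exact: measurable_powR.
by apply: measurableT_comp => //; exact: measurable_expR.
Qed.

Lemma measurable_bet x y : measurable_fun setT (bet x y).
Proof.
apply: measurable_fun_ifT => //.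
  by apply: measurable_and; apply: measurable_fun_ltr.
apply: measurable_funM; first exact: measurable_powR.
apply: (measurableT_comp (measurable_powR _)); exact: measurable_funB.
Qed.

Lemma GammaE x : Gamma x = fine (Gint x).
Proof.
rewrite /Gamma /Gint integral_mkcond; congr fine; apply: eq_integral => t _.
rewrite patchE /gam; have -> : (t \in [set t : R | (0 < t)%R]) = (0 < t) by apply/idP/idP; rewrite inE.
by case: ifP.
Qed.

Lemma Gint_Bint x y : (Gint x * Gint y = Gint (x + y) * Bint x y)%E.
Proof.
have mg := measurable_gam; have g0 := gam_ge0.
pose H (p : Rm * Rm) : \bar R := (gam x p.1 * gam y (p.2 - p.1))%:E.
have mH : measurable_fun setT H.
  apply/measurable_EFinP; apply: measurable_funM.
    by apply: measurableT_comp => //; exact: mg.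
  by apply: (measurableT_comp (mg y)); apply: measurable_funB.
have H0 p : (0 <= H p)%E by rewrite lee_fin mulr_ge0// g0.
have EM z : measurable_fun setT (fun t => (gam z t)%:E).
  by apply/measurable_EFinP; exact: mg.
have Gy0 : (0 <= Gint y)%E by apply: integral_ge0 => t _; exact: g0.
transitivity (\int[leb1]_s \int[leb1]_r H (s, r))%E.
  rewrite /Gint muleC -ge0_integralZl//; last by move=> t _; exact: g0.
  apply: eq_integral => s _.
  rewrite [X in (X * _)%E](@ge0_integral_affine _ 1 (- s))// muleC -ge0_integralZl ?lee_fin//.
  - by apply: eq_integral => r _; rewrite /H /= -EFinM mul1r mulr1.
  - apply/measurable_EFinP; apply: measurable_funM => //.
    by apply: (measurableT_comp (mg y)); apply: measurable_funD => //; apply: measurable_funM.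
  - by move=> r _; rewrite lee_fin mulr1.
rewrite fubini_tonelli// /Gint muleC -ge0_integralZl//; last 2 first.
- by move=> t _; exact: g0.
- by apply: integral_ge0 => t _; rewrite lee_fin bet_ge0.
apply: eq_integral => r _; have [r0|r0] := leP r 0.
  rewrite integral0_eq => [|s _]; last first.
    rewrite /H /gam /=; case: ifP => [s0|]; last by rewrite mul0r.
    by rewrite subr_gt0 ltNge (le_trans r0) ?(ltW s0)// mulr0.
  by rewrite /gam ltNge r0 mule0.
have mk : measurable_fun setT (fun s : Rm => gam x s * gam y (r - s) : Rm).
  apply: measurable_funM; first exact: mg.
  by apply: (measurableT_comp (mg y)); apply: measurable_funB.
rewrite [LHS](@ge0_integral_affine _ r 0 (fun s => gam x s * gam y (r - s)))//; last first.
  by move=> s; rewrite mulr_ge0.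
rewrite muleC -ge0_integralZl ?lee_fin//; last 2 first.
- by apply/measurable_EFinP; exact: measurable_bet.
- by move=> t _; rewrite lee_fin bet_ge0.
apply: eq_integral => v _; rewrite -EFinM addr0; congr EFin.
rewrite /gam /bet r0 pmulr_rgt0// subr_gt0 gtr_pMr//.
have [v0|] := ltP 0 v; last by rewrite !(mul0r, mulr0).
have [v1|] := ltP v 1; last by rewrite !(mul0r, mulr0).
have rv : r - r * v = r * (1 - v) by ring.
have v1' : 0 <= 1 - v by rewrite subr_ge0 ltW.
have rn0 : r != 0 by rewrite gt_eqF.
have Ee : expR (- (r * v)) * expR (- (r - r * v)) = expR (- r).
  by rewrite -expRD; congr expR; ring.
have Er : r `^ (x - 1) * r `^ (y - 1) * r = r `^ (x + y - 1).
  rewrite -[X in _ * X](powRr1 (ltW r0)) -!powRD ?rn0 ?implybT//; congr (_ `^ _); ring.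
rewrite /= -Ee -Er rv !powRM ?(ltW r0) ?(ltW v0)//; ring.
Qed.

Lemma Gint1 : Gint 1 = 1%E.
Proof.
have D (t : R) : is_derive t 1 (fun t => - expR (- t)) (expR (- t)).
  by apply: is_derive_eq; rewrite mulrN1 opprK.
have -> : Gint 1 = (\int[leb1]_(t in `[0%R, +oo[) (expR (- t))%:E)%E.
  rewrite -integral_itv_obnd_cbnd; last first.
    apply: measurable_funTS; apply/measurable_EFinP.
    by apply: measurableT_comp => //; exact: measurable_expR.
  rewrite [RHS]integral_mkcond; apply: eq_integral => t _.
  by rewrite patchE mem_setE in_itv/= andbT /gam subrr powRr0 mul1r; case: ifP.
rewrite (@ge0_continuous_FTC2y _ _ (fun t => - expR (- t)) 0 0).
- by rewrite oppr0 expR0 -EFinB opprK add0r.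
- by move=> t _; exact: expR_ge0.
- apply: continuous_subspaceT => t; apply: (@continuous_comp _ _ _ -%R expR).
    exact: opp_continuous.
  exact: continuous_expR.
- rewrite -oppr0; apply: cvgN; exact: cvgr_expR.
- by move=> t _; have [] := D t.
- rewrite /at_right; apply: cvg_at_right_filter.
  have := D 0 => -[/derivable1_diffP/differentiable_continuous]; exact.
- by move=> t _; rewrite derive1E; exact: derive_val.
Qed.

Lemma Gint_gt0 x : (0 < Gint x)%E.
Proof.
apply: (@integral_gt0 _ 1 2 _ (fun t => t `^ (x - 1) * expR (- t))); first by rewrite ltr1n.
- exact: measurable_gam.
- exact: gam_ge0.
- apply: contIM => t /andP[t1 _].
    by apply: continuous_powR_gt0; exact: lt_le_trans t1.
  apply: continuous_comp; first exact: opp_continuous.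
  exact: continuous_expR.
- by move=> t /andP[t1 _]; rewrite /gam (lt_le_trans ltr01 t1).
- by rewrite powR1 mul1r gt_eqF// expR_gt0.
Qed.

Lemma Bint_gt0 x y : (0 < Bint x y)%E.
Proof.
have h4 : 0 < 4^-1 :> R by rewrite invr_gt0.
apply: (@integral_gt0 _ 4^-1 2^-1 _ (fun t => t `^ (x - 1) * (1 - t) `^ (y - 1))); first by lra.
- exact: measurable_bet.
- exact: bet_ge0.
- apply: contIM => t /andP[t1 t2].
    by apply: continuous_powR_gt0; exact: lt_le_trans t1.
  apply: (@continuous_comp _ _ _ (fun t : R => 1 - t) (fun u => u `^ (y - 1))).
    by apply: cvgB; [exact: cvg_cst|exact: cvg_id].
  by apply: continuous_powR_gt0; lra.
- by move=> t /andP[t1 t2]; rewrite /bet; have -> : (0 < t) && (t < 1) by lra.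
- by rewrite gt_eqF// mulr_gt0// powR_gt0//; lra.
Qed.

Lemma integral_powR x a : 0 < x -> 0 < a < 1 ->
  (\int[leb1]_(t in `[a, 1%R]) (t `^ (x - 1))%:E = ((1 - a `^ x) / x)%:E)%E.
Proof.
move=> x0 /andP[a0 a1]; have ct p t : a <= t -> {for t, continuous (fun t => t `^ p)}.
  by move=> at_; apply: continuous_powR_gt0; exact: lt_le_trans at_.
have cF t : a <= t -> {for t, continuous (fun t => t `^ x / x)}.
  by move=> at_; apply: cvgM; [exact: ct|exact: cvg_cst].
rewrite (@continuous_FTC2 _ (fun t => t `^ (x - 1)) (fun t => t `^ x / x) a 1)//.
- by rewrite -EFinB powR1 mulrBl.
- by apply: contI_within => t /andP[/ct].
- split.
  + move=> t; rewrite in_itv/= => /andP[at_ _]; apply: derivableM => //.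
    by apply: derivable_powR; rewrite in_itv/= (lt_trans a0).
  + by apply: cvg_at_right_filter; exact: cF.
  + by apply: cvg_at_left_filter; apply: cF; exact: ltW.
- move=> t; rewrite in_itv/= => /andP[at_ _].
  have t0 : t \in `]0, +oo[%R by rewrite in_itv/= (lt_trans a0).
  rewrite derive1E deriveMr; last exact: derivable_powR.
  rewrite -derive1E powR_derive1// /GRing.scale/=.
  by field; rewrite gt_eqF.
Qed.

Lemma Bintx1 x : 0 < x -> Bint x 1 = (x^-1)%:E.
Proof.
move=> x0; have xi : 0 < x^-1 by rewrite invr_gt0.
have bE (a : R) t : 0 < a -> a <= t < 1 -> bet x 1 t = t `^ (x - 1).
  by move=> a0 /andP[at_ t1]; rewrite /bet (lt_le_trans a0)// t1 subrr powRr0 mulr1.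
apply/eqP; rewrite eq_le; apply/andP; split; last first.
  apply/lee_addgt0Pr => e e0; pose d := Num.min (e * x) 2^-1.
  have d0 : 0 < d by rewrite lt_min mulr_gt0//= invr_gt0.
  have d1 : d < 1 by rewrite gt_min invf_lt1 ?ltr1n ?orbT.
  pose a := d `^ x^-1; have a0 : 0 < a by rewrite powR_gt0.
  have ax : a `^ x = d by rewrite -powRrM mulVf ?gt_eqF// powRr1// ltW.
  have a1 : a < 1 by rewrite -[ltRHS](one_powR x^-1) gt0_ltr_powR// nnegrE ltW.
  have a01 : 0 < a < 1 by rewrite a0.
  have h : ((1 - d) / x)%:E = (\int[leb1]_(t in `[a, 1%R[) (bet x 1 t)%:E)%E.
    rewrite -ax -integral_powR// -integral_itv_bndo_bndc; last first.
      apply: measurable_funTS; apply/measurable_EFinP; exact: measurable_powR.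
    by apply: eq_integral => t; rewrite inE/= in_itv/= => /(bE _ _ a0) ->.
  apply: (@le_trans _ _ (((1 - d) / x)%:E + e%:E)%E).
    rewrite -EFinD lee_fin mulrBl mul1r -addrA lerDl addrC subr_ge0.
    by rewrite ler_pdivrMr// ge_min lexx.
  rewrite leeD2r// h; apply: ge0_subset_integral => //.
    by apply/measurable_EFinP; exact: measurable_bet.
  by move=> t _; rewrite lee_fin bet_ge0.
pose a n : R := n.+2%:R^-1.
have a01 n : 0 < a n < 1 by rewrite /a invr_gt0 ltr0n /= invf_lt1 ?ltr0n// ltr1n.
pose f n (t : Rm) : Rm := if (a n <= t) && (t <= 1) then t `^ (x - 1) else 0.
have f0 n t : 0 <= f n t by rewrite /f; case: ifP => // _; exact: powR_ge0.
have mf n : measurable_fun setT (fun t => (f n t)%:E).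
  apply/measurable_EFinP; apply: measurable_fun_ifT => //.
  by apply: measurable_and; apply: measurable_fun_ler.
apply: (@le_trans _ _ (\int[leb1]_t limn_einf (fun n => (f n t)%:E))%E); last first.
  apply: le_trans (fatou _ _ _ _) _ => //.
    by move=> n t _; rewrite lee_fin.
  apply: limn_einf_le => n; apply: (@le_trans _ _ ((1 - a n `^ x) / x)%:E); last first.
    by rewrite lee_fin ler_piMl ?(ltW xi)// gerBl powR_ge0.
  rewrite -integral_powR//.
  rewrite [leRHS]integral_mkcond le_eqVlt; apply/orP; left; apply/eqP.
  by apply: eq_integral => t _; rewrite patchE mem_setE in_itv/= /f; case: ifP.
apply: ge0_le_integral => //.
- by move=> t _; rewrite lee_fin bet_ge0.
- by apply/measurable_EFinP; exact: measurable_bet.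
- have : measurable_fun setT (fun t => limn_einf (fun n => (f n t)%:E)).
    rewrite /limn_einf; apply: measurableT_comp => //.
    apply: (measurable_fun_limn_esup (f := fun n t => - (f n t)%:E)%E) => n.
    exact: measurableT_comp.
  by [].
move=> t _; rewrite /bet; case: ifPn => [/andP[t0 t1]|_]; last first.
  by apply: (@limn_einf_ge _ _ _ 0%N) => n _; rewrite lee_fin.
have [n0 _ hn] := near_dist_lt (@cvg_harmonic R) t0.
apply: (@limn_einf_ge _ _ _ n0) => n nn0.
have := hn n.+1 (leq_trans nn0 (leqnSn n)); rewrite sub0r normrN /harmonic /= => h.
have : a n < t by move: h; rewrite gtr0_norm ?invr_gt0// ltr0n.
by rewrite /f => /ltW ->; rewrite (ltW t1) subrr powRr0 mulr1.
Qed.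

Lemma Gint_lty x : 0 < x -> (Gint x < +oo)%E.
Proof.
move=> x0; pose s := `|x - 1|; pose M := 2 * (s + 1).
have s0 : 0 <= s by exact: normr_ge0.
have M0 : 0 < M by rewrite /M; lra.
have c0 : 0 <= M `^ s by exact: powR_ge0.
have bd t : gam x t <= bet x 1 t + M `^ s * gam 1 (2^-1 * t + 0).
  have [t0|t0] := leP t 0.
    by rewrite /gam (ltNge 0 t) t0 addr_ge0 ?bet_ge0// mulr_ge0// gam_ge0.
  rewrite addr0 /gam t0 subrr powRr0 mul1r pmulr_rgt0 ?invr_gt0// t0.
  have [t1|t1] := ltP t 1.
    rewrite /bet t0 t1 subrr powRr0 mulr1 ler_wpDr ?mulr_ge0 ?expR_ge0//.
    by rewrite ler_piMr ?powR_ge0// -expR0 ler_expR oppr_le0 ltW.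
  rewrite ler_wpDl ?bet_ge0//.
  have -> : expR (- t) = (expR (2^-1 * t))^-1 * expR (- (2^-1 * t)).
    by rewrite -expRN -expRD; congr expR; lra.
  rewrite mulrA ler_wpM2r ?expR_ge0// ler_pdivrMr ?expR_gt0//.
  apply: (@le_trans _ _ (t `^ s)); first by apply: ler_powR => //; exact: ler_norm.
  have -> : t = M * (t / M) by rewrite mulrC divfK// gt_eqF.
  rewrite powRM ?(ltW M0) ?divr_ge0 ?(ltW t0) ?(ltW M0)// ler_wpM2l//.
  have tM : 0 < t / M by rewrite divr_gt0.
  rewrite /powR gt_eqF// ler_expR (le_trans (ler_wpM2l s0 (ltW (ln_sublinear tM))))//.
  rewrite [M * _]mulrC divfK ?gt_eqF// mulrCA mulrC ler_wpM2r// ?(ltW t0)//.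
  by rewrite ler_pdivrMr// /M; lra.
have mg1 : measurable_fun setT (fun t : Rm => gam 1 (2^-1 * t + 0)).
  apply: (measurableT_comp (measurable_gam _)).
  by apply: measurable_funD => //; exact: measurable_funM.
apply: (@le_lt_trans _ _ (\int[leb1]_t ((bet x 1 t)%:E + (M `^ s * gam 1 (2^-1 * t + 0))%:E))%E).
  apply: ge0_le_integral => //.
  - by move=> t _; rewrite lee_fin gam_ge0.
  - by apply/measurable_EFinP; exact: measurable_gam.
  - apply: emeasurable_funD; apply/measurable_EFinP; first exact: measurable_bet.
    exact: measurable_funM.
  - by move=> t _; rewrite -EFinD lee_fin.
rewrite ge0_integralD//; last 4 first.
- by move=> t _; rewrite lee_fin bet_ge0.
- by apply/measurable_EFinP; exact: measurable_bet.
- by move=> t _; rewrite lee_fin mulr_ge0// gam_ge0.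
- by apply/measurable_EFinP; exact: measurable_funM.
rewrite lte_add_pinfty//; first by rewrite -/(Bint x 1) Bintx1// ltry.
have half0 : 0 < 2^-1 :> R by rewrite invr_gt0.
have := ge0_integral_affine 0 half0 (measurable_gam 1) (gam_ge0 1).
rewrite -/(Gint 1) Gint1 => h.
suff -> : (\int[leb1]_t (M `^ s * gam 1 (2^-1 * t + 0))%:E)%E = ((M `^ s * 2)%:E * 1)%E.
  by rewrite mule1 ltry.
rewrite h -ge0_integralZl//.
- by apply: eq_integral => t _; rewrite -EFinM; congr EFin; field.
- by apply/measurable_EFinP; exact: measurable_funM.
- by move=> t _; rewrite lee_fin mulr_ge0 ?gam_ge0// ltW.
- by rewrite lee_fin mulr_ge0.
Qed.

Lemma Gint_fin x : 0 < x -> exists2 g, 0 < g & Gint x = g%:E.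
Proof.
move=> /Gint_lty; have := Gint_gt0 x; case: (Gint x) => [g||]// g0 _.
by exists g.
Qed.

Lemma Gamma_gt0 x : 0 < x -> 0 < Gamma x.
Proof. by rewrite GammaE => /Gint_fin[g g0 ->]. Qed.

Lemma GammaS x : 0 < x -> Gamma (x + 1) = x * Gamma x.
Proof.
move=> x0; have := Gint_Bint x 1; rewrite Gint1 mule1 Bintx1// !GammaE.
have [g g0 ->] := Gint_fin x0; have [h h0 ->] := Gint_fin (addr_gt0 x0 ltr01).
by move=> [->] /=; field; rewrite gt_eqF.
Qed.

Lemma Gamma1 : Gamma (1 : R) = 1.
Proof. by rewrite GammaE Gint1. Qed.

Lemma Bint_lty x y : 0 < x -> 0 < y -> (Bint x y < +oo)%E.
Proof.
move=> x0 y0; have := Gint_Bint x y.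
have [g g0 ->] := Gint_fin x0; have [h h0 ->] := Gint_fin y0.
have [k k0 ->] := Gint_fin (addr_gt0 x0 y0).
by case: (Bint x y) => [b||]//; [rewrite ltry|rewrite gt0_muley].
Qed.

Lemma Bint_ratio x y : 0 < x -> 0 < y ->
  (Bint x y = ((Gamma (1 + y) * Gamma x) / Gamma (x + y))%:E * Bint 1 y)%E.
Proof.
move=> x0 y0; have := Gint_Bint x y; have := Gint_Bint 1 y; rewrite Gint1 mul1e !GammaE.
have [g1 g10 ->] := Gint_fin x0; have [g2 g20 ->] := Gint_fin y0.
have [g3 g30 ->] := Gint_fin (addr_gt0 x0 y0).
have [g4 g40 ->] := Gint_fin (addr_gt0 ltr01 y0).
have := Bint_lty ltr01 y0; have := Bint_gt0 1 y.
have := Bint_lty x0 y0; have := Bint_gt0 x y.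
case: (Bint 1 y) => [b1||]//; case: (Bint x y) => [b2||]// _ _ _ _ /= [E1] [E2].
rewrite -EFinM; congr EFin.
have -> : b2 = g1 * g2 / g3 by rewrite E2 mulrC mulKf// gt_eqF.
by rewrite E1; field; rewrite gt_eqF.
Qed.

Lemma Bint_lt x y : 1 < x -> 0 < y -> (Bint x y < Bint 1 y)%E.
Proof.
move=> x1 y0; have x0 : 0 < x by exact: lt_trans x1.
pose d (t : Rm) : Rm := bet 1 y t - bet x y t.
have d0 t : 0 <= d t.
  rewrite subr_ge0 /bet; case: ifP => // /andP[t0 t1].
  rewrite ler_wpM2r ?powR_ge0// subrr powRr0 -[leRHS](one_powR (x - 1)).
  by rewrite ge0_ler_powR ?nnegrE ?subr_ge0// ltW.
have md : measurable_fun setT d by apply: measurable_funB; exact: measurable_bet.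
have -> : Bint 1 y = (Bint x y + \int[leb1]_t (d t)%:E)%E.
  rewrite /Bint -ge0_integralD//.
  - by apply: eq_integral => t _; rewrite -EFinD /d addrC subrK.
  - by move=> t _; rewrite lee_fin bet_ge0.
  - by apply/measurable_EFinP; exact: measurable_bet.
  - by move=> t _; rewrite lee_fin d0.
  - exact/measurable_EFinP.
have bf : Bint x y \is a fin_num by rewrite ge0_fin_numE ?(ltW (Bint_gt0 _ _))// Bint_lty.
rewrite lteDl//.
have h4 : 0 < 4^-1 :> R by rewrite invr_gt0.
apply: (@integral_gt0 _ 4^-1 2^-1 _ (fun t => (1 - t `^ (x - 1)) * (1 - t) `^ (y - 1))) => //; first by lra.
- apply: contIM => t /andP[t1 t2].
    apply: cvgB; first exact: cvg_cst.
    by apply: continuous_powR_gt0; exact: lt_le_trans t1.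
  apply: (@continuous_comp _ _ _ (fun t : R => 1 - t) (fun u => u `^ (y - 1))).
    by apply: cvgB; [exact: cvg_cst|exact: cvg_id].
  by apply: continuous_powR_gt0; lra.
- move=> t /andP[t1 t2]; rewrite /d /bet; have -> : (0 < t) && (t < 1) by lra.
  by rewrite subrr powRr0 mulrBl.
- have h1 : 4^-1 `^ (x - 1) < 1 :> R.
    by rewrite -[ltRHS](one_powR (x - 1)) gt0_ltr_powR ?subr_gt0// ?nnegrE; lra.
  by rewrite mulf_neq0// gt_eqF ?subr_gt0// powR_gt0; lra.
Qed.

End Gamma_function.

(** * The weighted inequality *)

Section weighted_inequality.
Context {R : realType}.
Local Notation C := R[i].
Local Notation N := (@Normc.normc R).
Notation Rm := (measurableTypeR R).
Variable A : R.
Hypothesis A0 : 0 < A.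
Hypothesis AE : @unit_area R = A%:E.
Variables (p al s : R).
Hypothesis p0 : 0 < p.
Hypothesis al1 : -1 < al.
Hypothesis s0 : 0 < s.

Definition weight (x : R) : R := (1 - x ^+ 2) `^ al.

Definition wint (u : C -> R) : \bar R := intC (dext (fun z => u z * weight (N z))).

Definition kappa : R := Gamma (2 + al) * Gamma (s / 2 + 1) / Gamma (s / 2 + 2 + al).

Lemma contD_weight : contD (fun z => weight (N z)).
Proof.
move=> z z1.
have hn : N w @[w --> nearC z] --> N z by apply: tendsC_normc; exact: tendsC_id.
have h : N w ^+ 2 @[w --> nearC z] --> N z ^+ 2 by rewrite expr2; exact: (cvgM hn hn).
have h2 : 1 - N w ^+ 2 @[w --> nearC z] --> 1 - N z ^+ 2 by apply: cvgB => //; exact: cvg_cst.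
have hc : {for 1 - N z ^+ 2, continuous (fun x : R => x `^ al)}.
  by apply: continuous_powR_gt0; rewrite normc_sqr_lt1.
exact: (cvg_comp _ _ h2 hc).
Qed.

Lemma weight_ge0 x : 0 <= weight x. Proof. exact: powR_ge0. Qed.

Lemma contD_normc_pow : contD (fun z => N z `^ s).
Proof. by apply: (@contD_normc_powR _ id) => // z _; exact: cdble_id. Qed.

Lemma intC_bet x : 0 <= x ->
  intC (dext (fun z => N z `^ x * weight (N z))) = (A%:E * Bint (x / 2 + 1) (1 + al))%E.
Proof.
move=> x0.
pose f (t : Rm) : Rm := t `^ (x / 2) * (1 - t) `^ al.
have mf : measurable_fun setT f.
  apply: measurable_funM; first exact: measurable_powR.
  apply: (measurableT_comp (measurable_powR _)); exact: measurable_funB.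
have fE : (fun z => N z `^ x * weight (N z)) = (fun z => f (N z ^+ 2)).
  apply/funext => z; rewrite /f /weight; congr (_ * _).
  by rewrite -powR_mulrn ?normc_ge0// -powRrM; congr (_ `^ _); field.
rewrite fE (intC_radial A0 AE); last 2 first.
- exact: measurable_funTS.
- by move=> t _; rewrite mulr_ge0 ?powR_ge0.
congr (_ * _)%E; rewrite -integral_itv_obnd_cbnd; last first.
  by apply: measurable_funTS; apply/measurable_EFinP.
rewrite integral_mkcond; apply: eq_integral => t _.
rewrite patchE mem_setE in_itv/= /bet /f addrK [1 + al]addrC addrK.
by case: ifP.
Qed.

Lemma kappaE : Gamma (1 + (1 + al)) * Gamma (s / 2 + 1) / Gamma (s / 2 + 1 + (1 + al)) = kappa.
Proof.
have -> : 1 + (1 + al) = 2 + al by ring.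
by have -> : s / 2 + 1 + (1 + al) = s / 2 + 2 + al by ring.
Qed.

Lemma kappa_gt0 : 0 < kappa.
Proof.
have h : 0 < s / 2 by rewrite divr_gt0.
by rewrite /kappa divr_gt0 ?mulr_gt0// Gamma_gt0//; have := al1; lra.
Qed.

Lemma int_weight_fin : (intC (dext (fun z => weight (N z))) < +oo)%E.
Proof.
have -> : (fun z => weight (N z)) = (fun z => N z `^ 0 * weight (N z)).
  by apply/funext => z; rewrite powRr0 mul1r.
rewrite intC_bet// mul0r add0r lte_mul_pinfty ?lee_fin ?(ltW A0)//.
by apply: Bint_lty => //; have := al1; lra.
Qed.

Lemma int_powR_weight :
  intC (dext (fun z => N z `^ s * weight (N z))) = (kappa%:E * intC (dext (fun z => weight (N z))))%E.
Proof.
have -> : (fun z => weight (N z)) = (fun z => N z `^ 0 * weight (N z)).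
  by apply/funext => z; rewrite powRr0 mul1r.
rewrite !intC_bet ?(ltW s0)// mul0r add0r muleCA; congr (_ * _)%E.
have h : 0 < s / 2 by rewrite divr_gt0.
rewrite Bint_ratio; [|lra|by have := al1; lra].
by rewrite kappaE.
Qed.

Lemma kappa_lt1 : kappa < 1.
Proof.
have h : 0 < s / 2 by rewrite divr_gt0.
have a0 : 0 < 1 + al by have := al1; lra.
have := @Bint_lt _ (s / 2 + 1) (1 + al); rewrite ltrDr => /(_ h a0).
have hs : 0 < s / 2 + 1 by lra.
rewrite Bint_ratio//.
have := Bint_lty ltr01 a0; have := Bint_gt0 1 (1 + al).
rewrite kappaE; case: (Bint _ _) => [b||]// b0 _; rewrite lte_fin in b0.
by rewrite -EFinM lte_fin gtr_pMl.
Qed.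

Lemma holoD_weighted_le (F : C -> C) : holoD F ->
  (kappa%:E * wint (fun z => N (F z) `^ p)%R <= wint (fun z => N (F z) `^ p * N z `^ s)%R)%E.
Proof.
move=> Fh; pose r0 := kappa `^ s^-1.
have k0 := kappa_gt0; have k1 := kappa_lt1.
have r00 : 0 <= r0 by exact: powR_ge0.
have r0s : r0 `^ s = kappa by rewrite -powRrM mulVf ?gt_eqF// powRr1// ltW.
have r01 : r0 < 1.
  by rewrite -[ltRHS](one_powR s^-1) gt0_ltr_powR ?invr_gt0// nnegrE ltW.
have := @weighted_mean_le _ _ A0 AE F p kappa r0 weight (fun x => x `^ s) Fh p0.
rewrite r00 r01 (ltW k0) => /(_ isT isT contD_weight contD_normc_pow).
move=> /(_ (fun _ _ => weight_ge0 _) (fun _ _ => powR_ge0 _ _)).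
have h1 x : 0 <= x -> x <= r0 -> x `^ s <= kappa.
  by move=> x0 xr; rewrite -r0s ge0_ler_powR ?nnegrE ?(ltW s0).
have h2 x : r0 <= x -> x < 1 -> kappa <= x `^ s.
  by move=> rx _; rewrite -r0s ge0_ler_powR ?nnegrE ?(ltW s0)// (le_trans r00).
move=> /(_ h1 h2 int_weight_fin int_powR_weight) => h; rewrite /wint.
by under [X in (_ <= intC (dext X))%E]eq_fun do rewrite -mulrA.
Qed.

Section transport.
Variable a : C.
Hypothesis a1 : N a < 1.

Let c := 1 - N a ^+ 2.

Let c0 : 0 < c. Proof. by rewrite /c normc_sqr_lt1. Qed.

(* The principal branch of [(phi_a')^((alpha+2)/p)] up to a unimodular constant. *)
Definition jacroot (z : C) : C :=
  (c `^ ((al + 2) / p))%:C%C * cpow (- (2 * ((al + 2) / p))) (mobden a z).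

Let Re_mobden z : N z < 1 -> 0 < complex.Re (mobden a z).
Proof.
move=> z1; have h : N (conjc a * z) < 1.
  by rewrite Normc.normcM normc_conj mulr_ilt1 ?normc_ge0.
have := le_lt_trans (normc_geRe _) h; rewrite /mobden.
by case: (conjc a * z) => x y /=; rewrite ltr_norml => /andP[]; lra.
Qed.

Lemma holoD_jacroot : holoD jacroot.
Proof.
move=> z z1; apply: cdbleM; first exact: cdble_cst.
apply: (@cdble_comp _ (mobden a)); first exact: cdble_mobden.
by apply: cdble_cpow; exact: Re_mobden.
Qed.

Lemma normc_jacroot z : N z < 1 ->
  N (jacroot z) `^ p = (c / N (mobden a z) ^+ 2) `^ (al + 2).
Proof.
move=> z1; have d0 := mobden_gt0 a1 z1.
rewrite /jacroot Normc.normcM normc_cpow ?Re_mobden// normcR ger0_norm ?powR_ge0//.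
have -> : N (mobden a z) `^ (- (2 * ((al + 2) / p))) =
    ((N (mobden a z) ^+ 2)^-1) `^ ((al + 2) / p).
  by rewrite -powR_invn ?(ltW d0)// -powRrM mulNr.
rewrite -powRM ?invr_ge0 ?sqr_ge0 ?(ltW c0)// -powRrM divfK// gt_eqF//.
Qed.

Lemma jacroot_weight z : N z < 1 ->
  N (jacroot z) `^ p * weight (N z) = mobjac a z * weight (N (mob a z)).
Proof.
move=> z1; have d0 := mobden_gt0 a1 z1; rewrite normc_jacroot// /weight mob_sqr//.
set q := c / N (mobden a z) ^+ 2.
have q0 : 0 < q by rewrite divr_gt0 ?exprn_gt0.
have -> : (1 - N a ^+ 2) * (1 - N z ^+ 2) / N (mobden a z) ^+ 2 = q * (1 - N z ^+ 2).
  by rewrite /q -/c; ring.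
have w0 : 0 <= 1 - N z ^+ 2 by rewrite ltW// normc_sqr_lt1.
have -> : mobjac a z = q ^+ 2 by [].
clearbody q; rewrite powRM ?(ltW q0)// mulrA; congr (_ * _).
rewrite powRD; last by rewrite (gt_eqF q0) implybT.
by rewrite powR_mulrn ?(ltW q0)// mulrC.
Qed.

Lemma jacroot_mob z : N z < 1 -> N (jacroot (mob a z)) `^ p * N (jacroot z) `^ p = 1.
Proof.
move=> z1; have d0 := mobden_gt0 a1 z1.
rewrite !normc_jacroot ?mob_disk// -powRM ?divr_ge0 ?sqr_ge0 ?(ltW c0)//.
rewrite mobden_mob// Normc.normcM Normc.normcV normcR ger0_norm ?(ltW c0)// -/c.
rewrite (_ : _ * _ = 1) ?one_powR//; field; rewrite !gt_eqF//.
Qed.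

Lemma wint_mob_le (u : C -> R) : contD u -> (forall z, N z < 1 -> 0 <= u z) ->
  (wint (fun z => u (mob a z) * N (jacroot z) `^ p)%R <= wint u)%E.
Proof.
move=> uc u0; rewrite /wint.
have h0 z : N z < 1 -> 0 <= u z * weight (N z) by move=> z1; rewrite mulr_ge0 ?u0 ?weight_ge0.
apply: le_trans (intC_mob_le A0 AE a1 (contDM uc contD_weight) h0).
rewrite le_eqVlt; apply/orP; left; apply/eqP; congr intC; apply/funext => z.
rewrite /dext; case: ifP => // z1; rewrite -mulrA jacroot_weight//; ring.
Qed.

Lemma eq_wint (u v : C -> R) : (forall z, N z < 1 -> u z = v z) -> wint u = wint v.
Proof.
move=> uv; congr intC; apply/funext => z; rewrite /dext; case: ifP => // z1.
by rewrite uv.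
Qed.

Lemma wint_div_le (g : C -> C) : holoD g ->
  (kappa%:E * wint (fun z => (N (g z) `^ p)%R) <= wint (fun z => N (g z) `^ p * N (mob a z) `^ s)%R)%E.
Proof.
move=> gh.
pose F w := g (mob a w) * jacroot w.
have Fh : holoD F.
  move=> z z1; apply: cdbleM; last exact: holoD_jacroot.
  by apply: (@cdble_comp _ (mob a)); [exact: cdble_mob|apply: gh; exact: mob_disk].
have Fp w : N (F w) `^ p = N (g (mob a w)) `^ p * N (jacroot w) `^ p.
  by rewrite Normc.normcM powRM ?normc_ge0.
have gc := contD_normc_powR gh p0; have Fc := contD_normc_powR Fh p0.
have mobc : contD (fun z => N (mob a z) `^ s).
  apply: (@contD_normc_powR _ (mob a)) => // z z1; exact: cdble_mob.
apply: (@le_trans _ _ (kappa%:E * wint (fun z => (N (F z) `^ p)%R))%E).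
  apply: lee_wpmul2l; first by rewrite lee_fin ltW// kappa_gt0.
  apply: le_trans (wint_mob_le Fc _); last by move=> *; exact: powR_ge0.
  rewrite (@eq_wint _ (fun z => N (F (mob a z)) `^ p * N (jacroot z) `^ p))// => z z1.
  by rewrite Fp mobK// -mulrA jacroot_mob// mulr1.
apply: (le_trans (holoD_weighted_le Fh)).
apply: le_trans (wint_mob_le (contDM gc mobc) _); last by move=> *; rewrite mulr_ge0// powR_ge0.
rewrite (@eq_wint _ (fun z => N (g (mob a z)) `^ p * N (mob a (mob a z)) `^ s * N (jacroot z) `^ p))//.
by move=> z z1; rewrite Fp mobK//; ring.
Qed.

Lemma wint_jacroot_lty : (wint (fun z => (N (jacroot z) `^ p)%R) < +oo)%E.
Proof.
apply: le_lt_trans int_weight_fin.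
have one_c : contD (fun=> 1 : R) by move=> z z1; apply: cvg_cst.
have := wint_mob_le one_c (fun _ _ => ler01); rewrite [wint (fun=> 1)]/wint.
under [X in (_ <= intC (dext X))%E -> _]eq_fun do rewrite mul1r.
by apply: le_trans; under [leRHS]eq_wint do rewrite mul1r.
Qed.

Lemma wint_jacroot_eq :
  (kappa%:E * wint (fun z => (N (jacroot z) `^ p)%R) =
   wint (fun z => N (jacroot z) `^ p * N (mob a z) `^ s)%R)%E.
Proof.
apply/eqP; rewrite eq_le wint_div_le; last exact: holoD_jacroot.
have Nc := contD_normc_pow; have Hc := contD_normc_powR holoD_jacroot p0.
have h1 : (wint (fun z => N (jacroot z) `^ p * N (mob a z) `^ s)%R <=
    wint (fun z => (N z `^ s)%R))%E.
  apply: le_trans (wint_mob_le Nc (fun _ _ => powR_ge0 _ _)).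
  by under eq_wint do rewrite mulrC.
apply: (le_trans h1); rewrite /wint int_powR_weight.
apply: lee_wpmul2l; first by rewrite lee_fin ltW// kappa_gt0.
apply: le_trans (wint_mob_le Hc (fun _ _ => powR_ge0 _ _)).
rewrite (@eq_wint _ (fun=> 1)); last by move=> z z1; rewrite jacroot_mob.
by rewrite /wint; under [X in (_ <= intC (dext X))%E]eq_fun do rewrite mul1r.
Qed.

End transport.
End weighted_inequality.

Section bergman.
Context {R : realType}.
Local Notation C := R[i].
Local Notation N := (@Normc.normc R).

Lemma holo_diskP (f : CC R -> CC R) : holo_disk f <-> holoD (f : C -> C).
Proof.
split=> fh z z1; first by apply/derivable_cdiff; apply: fh; rewrite inE.
by apply/derivable_cdiff; apply: fh; move: z1; rewrite inE.
Qed.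

Lemma bergman_intE (p al : R) (f : CC R -> CC R) : 0 < p -> -1 < al -> holoD (f : C -> C) ->
  (bergman_int p al f = ((al + 1) / pi)%:E * wint al (fun z : C => N (f z) `^ p)%R)%E.
Proof.
move=> p0 al1 fh.
have u_c : contD (fun z => N (f z) `^ p * weight al (N z)).
  by apply: contDM; [exact: contD_normc_powR|exact: contD_weight].
have u0 z : N z < 1 -> 0 <= N (f z) `^ p * weight al (N z).
  by move=> _; rewrite mulr_ge0 ?powR_ge0// weight_ge0.
have c0 : 0 <= (al + 1) / pi by rewrite divr_ge0 ?pi_ge0//; lra.
rewrite /wint /intC -ge0_integralZl//; last 2 first.
- by apply/measurable_EFinP; exact: measC_dext.
- by move=> x _; rewrite lee_fin dext_ge0.
transitivity (\int[@leb2 R]_(xy in @cpt R @^-1` disk)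
   (cabs (f (cpt xy)) `^ p * ((al + 1) * (1 - cabs (cpt xy) ^+ 2) `^ al) / pi)%:E)%E.
  by [].
rewrite [LHS]integral_mkcond; apply: eq_integral => x _; rewrite patchE /dext.
have -> : (x \in @cpt R @^-1` disk) = (N (cpt x) < 1) by apply/idP/idP; rewrite inE.
case: ifP => _; last by rewrite mule0.
rewrite -EFinM; congr EFin; rewrite /cabs /weight; ring.
Qed.

Lemma derive1n_zero (a : C) (h : CC R -> CC R) n : N a < 1 -> holoD (h : C -> C) ->
  forall k, (k < n)%N -> derive1n k (fun w : CC R => ((w : C) - a) ^+ n * h w : CC R) a = 0.
Proof.
move=> a1 hh; elim: n => // n IHn k kn.
pose g (w : CC R) : CC R := ((w : C) - a) ^+ n * h w.
have gh : holoD (g : C -> C).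
  move=> z z1; apply: cdbleM; last exact: hh.
  by apply: cdbleX; apply: cdbleB; [exact: cdble_id|exact: cdble_cst].
have -> : (fun w : CC R => ((w : C) - a) ^+ n.+1 * h w : CC R) = (fun w => ((w : C) - a) * g w).
  by apply/funext => w; rewrite /g exprS mulrA.
rewrite derive1n_mul_sub// subrr mul0r add0r.
by case: k kn => [|k] kn; rewrite ?mul0r//= IHn// mulr0.
Qed.

Section extremal.
Variables (p al : R) (a : C) (n : nat).
Hypothesis p0 : 0 < p.
Hypothesis al1 : -1 < al.
Hypothesis a1 : N a < 1.
Hypothesis n0 : (0 < n)%N.

Let s : R := n%:R * p.

Let s0 : 0 < s. Proof. by rewrite mulr_gt0// ltr0n. Qed.

Definition bound : R := (Gamma (n%:R * p / 2 + 2 + al) /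
  (Gamma (2 + al) * Gamma (n%:R * p / 2 + 1))) `^ (p^-1).

Let boundE : bound = ((kappa al s)^-1) `^ (p^-1).
Proof.
by rewrite /bound /kappa invf_div.
Qed.

Let c : R := (al + 1) / pi.

Let c0 : 0 < c. Proof. by rewrite divr_gt0 ?pi_gt0//; have := al1; lra. Qed.

Lemma wint_ge0 (f : C -> C) : (0 <= wint al (fun z => N (f z) `^ p)%R)%E.
Proof.
apply: integral_ge0 => x _; rewrite lee_fin dext_ge0// => z _.
by rewrite mulr_ge0 ?powR_ge0// weight_ge0.
Qed.

Lemma in_ApaP (f : CC R -> CC R) : holoD (f : C -> C) ->
  in_Apa p al f <-> (wint al (fun z : C => N (f z) `^ p)%R < +oo)%E.
Proof.
move=> fh; rewrite /in_Apa bergman_intE//.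
have w0 := wint_ge0 f.
split=> [[_]|h].
  by case: (wint _ _) w0 => [w||]// _; rewrite ?ltry// gt0_muley ?lte_fin.
by split; [exact/holo_diskP|rewrite lte_mul_pinfty// lee_fin ltW].
Qed.

Lemma bergman_normE (f : CC R -> CC R) : holoD (f : C -> C) ->
  bergman_norm p al f = (c * fine (wint al (fun z : C => N (f z) `^ p)%R)) `^ p^-1.
Proof.
move=> fh; rewrite /bergman_norm bergman_intE// -/c; congr (_ `^ _).
by case: (wint _ _) => [w||]//; rewrite ?gt0_muley ?gt0_muleNy ?lte_fin//= mulr0.
Qed.

Lemma bound_mul (x : R) : 0 <= x -> bound * (c * x) `^ p^-1 = (c * (x / kappa al s)) `^ p^-1.
Proof.
move=> x0; have k0 := kappa_gt0 al1 s0.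
rewrite boundE -powRM ?invr_ge0 ?(ltW k0)//; last by rewrite mulr_ge0// ltW.
by congr (_ `^ _); ring.
Qed.

Lemma fine_wint_ge0 (f : C -> C) : 0 <= fine (wint al (fun z => N (f z) `^ p)%R).
Proof. by apply: fine_ge0; exact: wint_ge0. Qed.

Lemma mob_eq0 z : N z < 1 -> z != a -> mob a z != 0.
Proof.
move=> z1 za; rewrite mulf_neq0 ?invr_eq0 ?mobden_neq0// subr_eq0 eq_sym//.
Qed.

Lemma eq_wint_mob (f g : C -> C) : (forall z, N z < 1 -> f z = g z * mob a z ^+ n) ->
  wint al (fun z => N (f z) `^ p)%R = wint al (fun z => N (g z) `^ p * N (mob a z) `^ s)%R.
Proof.
move=> fg; apply: eq_wint => z z1; rewrite fg// Normc.normcM powRM ?normc_ge0//.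
congr (_ * _); rewrite /s powRrM powR_mulrn ?normc_ge0//; congr (_ `^ _).
by elim: (n) => [|k IH]; rewrite ?expr0 ?Normc.normc1// !exprS Normc.normcM IH.
Qed.

Lemma bergman_division (f : CC R -> CC R) : in_Apa p al f ->
  (forall k, (k < n)%N -> cderiv k f a = 0) ->
  exists g : CC R -> CC R, is_div_ext a n f g /\ in_Apa p al g /\
    bergman_norm p al g <= bound * bergman_norm p al f.
Proof.
move=> fA f0; have fh := (holo_diskP f).1 fA.1.
have [g1 g1h g1E] := holoD_factor a1 fh f0.
pose g (z : CC R) : CC R := (-1) ^+ n * mobden a z ^+ n * g1 z.
have gh : holoD (g : C -> C).
  move=> z z1; apply: cdbleM; last exact: g1h.
  by apply: cdbleM; [exact: cdble_cst|apply: cdbleX; exact: cdble_mobden].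
have fg z : N z < 1 -> f z = g z * mob a z ^+ n :> C.
  move=> z1; rewrite g1E// /g /mob expr_div_n.
  have -> : (a - z) ^+ n = (-1) ^+ n * (z - a) ^+ n by rewrite -exprMn mulN1r opprB.
  have d0 : mobden a z ^+ n != 0 by rewrite expf_neq0// mobden_neq0.
  have e1 : (-1) ^+ n * (-1) ^+ n = 1 :> C by rewrite -exprMn mulrNN mulr1 expr1n.
  move: ((-1) ^+ n) e1 (mobden a z ^+ n) d0 ((z - a) ^+ n) (g1 z : C) => e e1 d d0 w v.
  transitivity (e * e * (w * v)); first by rewrite e1 mul1r.
  by field.
have [A A0 AE] := @unit_area_fin_gt0 R.
have := wint_div_le A0 AE p0 al1 s0 a1 gh; rewrite -(eq_wint_mob fg).
have := (in_ApaP fh).1 fA; have k0 := kappa_gt0 al1 s0.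
rewrite bergman_normE// => ffin hle.
have gfin : (wint al (fun z : C => N (g z) `^ p)%R < +oo)%E.
  move: hle ffin; case: (wint al (fun z : C => N (g z) `^ p)%R) => [w||]//.
    by rewrite ltry.
  by rewrite gt0_muley ?lte_fin// leye_eq => /eqP ->.
exists g; split; [split|split].
- exact/holo_diskP.
- move=> z; rewrite inE => z1 za; rewrite [f z](fg z z1) /phi mulfK// expf_neq0//.
  exact: mob_eq0.
- exact/in_ApaP.
rewrite bergman_normE// bound_mul ?fine_wint_ge0//.
have cle : 0 <= c by exact: ltW.
apply: ge0_ler_powR; first by rewrite invr_ge0 ltW.
- by rewrite nnegrE mulr_ge0// fine_wint_ge0.
- by rewrite nnegrE mulr_ge0// divr_ge0 ?(ltW k0)// fine_wint_ge0.
rewrite ler_wpM2l// ler_pdivlMr// mulrC.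
move: hle ffin gfin (wint_ge0 g) (wint_ge0 f).
by case: (wint _ _) => [w||]//; case: (wint _ _) => [v||].
Qed.

Lemma bergman_division_sharp : exists f : CC R -> CC R,
  in_Apa p al f /\ (exists z, z \in disk /\ f z != 0) /\
  (forall k, (k < n)%N -> cderiv k f a = 0) /\
  exists g : CC R -> CC R, is_div_ext a n f g /\ in_Apa p al g /\
    bergman_norm p al g = bound * bergman_norm p al f.
Proof.
have [A A0 AE] := @unit_area_fin_gt0 R; have k0 := kappa_gt0 al1 s0.
pose g : CC R -> CC R := jacroot p al a.
have gh : holoD (g : C -> C) by exact: holoD_jacroot.
pose f (z : CC R) : CC R := g z * mob a z ^+ n.
have fh : holoD (f : C -> C).
  by move=> z z1; apply: cdbleM; [exact: gh|apply: cdbleX; exact: cdble_mob].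
have gfin : (wint al (fun z : C => N (g z) `^ p)%R < +oo)%E.
  exact: (wint_jacroot_lty A0 AE p0 al1 a1).
have E : ((kappa al s)%:E * wint al (fun z : C => N (g z) `^ p)%R =
    wint al (fun z : C => N (f z) `^ p)%R)%E.
  by rewrite (@eq_wint_mob f g)//; exact: (wint_jacroot_eq A0 AE p0 al1 s0 a1).
have ffin : (wint al (fun z : C => N (f z) `^ p)%R < +oo)%E.
  by rewrite -E lte_mul_pinfty// ?lee_fin ?(ltW k0).
have g0 (z : C) : N z < 1 -> (g z : C) != 0.
  have pn0 : p != 0 by rewrite gt_eqF.
  move=> z1; apply/eqP => gz.
  have gz0 : jacroot p al a z = 0 by exact: gz.
  have := jacroot_mob al p0 a1 z1.
  by rewrite gz0 Normc.normc0 (powR0 pn0) mulr0 => /esym/eqP; rewrite oner_eq0.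
exists f; split; first exact/in_ApaP.
split.
  have [z [z1 za]] : exists z : C, N z < 1 /\ z != a.
    have [a0|a0] := eqVneq a 0.
      exists (2^-1)%:C%C; rewrite normcR gtr0_norm ?invr_gt0// invf_lt1 ?ltr1n//; split=> //.
      by rewrite a0 -normc_eq0 normcR normr_eq0 invr_eq0 pnatr_eq0.
    by exists 0; rewrite Normc.normc0 ltr01 eq_sym.
  exists z; split; first by rewrite inE.
  by rewrite /f mulf_neq0 ?g0// expf_neq0// mob_eq0.
split.
  pose h (z : CC R) : CC R := (-1) ^+ n * (mobden a z ^+ n)^-1 * g z.
  have hh : holoD (h : C -> C).
    move=> z z1; apply: cdbleM; last exact: gh.
    apply: cdbleM; first exact: cdble_cst.
    by apply: cdbleV; [apply: cdbleX; exact: cdble_mobden|rewrite expf_neq0// mobden_neq0].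
  move=> k kn; rewrite /cderiv -(derive1n_zero a1 hh kn).
  apply: derive1n_eq_disk => // z z1.
  rewrite /f /h /mob expr_div_n.
  have -> : (a - z) ^+ n = (-1) ^+ n * (z - a) ^+ n by rewrite -exprMn mulN1r opprB.
  by ring.
exists g; split; [split|split].
- exact/holo_diskP.
- move=> z; rewrite inE => z1 za; rewrite /f /phi mulfK// expf_neq0//; exact: mob_eq0.
- exact/in_ApaP.
rewrite !bergman_normE// bound_mul ?fine_wint_ge0//; congr ((c * _) `^ _).
rewrite -E; move: gfin (wint_ge0 g); case: (wint _ _) => [w||]// _ _.
by rewrite /= mulrC mulKf// gt_eqF.
Qed.

End extremal.

Lemma bound1 (p : R) : 0 < p -> bound p 0 1 = ((p + 2) / 2) `^ p^-1.
Proof.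
move=> p0; rewrite /bound mul1r !addr0; congr (_ `^ _).
have h : 0 < p / 2 + 1 by rewrite ltr_wpDl// divr_ge0// ltW.
have G2 : Gamma (2 : R) = 1 by rewrite -[2]/(1 + 1) GammaS// Gamma1 mulr1.
have -> : p / 2 + 2 = (p / 2 + 1) + 1 by ring.
have := Gamma_gt0 h; rewrite (GammaS h) G2; set G := Gamma _ => G0.
by field; rewrite gt_eqF.
Qed.

End bergman.

Close Scope classical_set_scope.

Theorem theorem3p3 (R : realType) (p alpha : R) (a : CC R) (N : nat) :
  0 < p -> -1 < alpha -> a \in disk -> (0 < N)%N ->
  let K := (Gamma (N%:R * p / 2 + 2 + alpha)
            / (Gamma (2 + alpha) * Gamma (N%:R * p / 2 + 1))) `^ (p^-1) in
  (* the inequality *)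
  (forall f : CC R -> CC R,
     in_Apa p alpha f ->
     (forall k : nat, (k < N)%N -> cderiv k f a = 0) ->
     exists g : CC R -> CC R,
       is_div_ext a N f g /\ in_Apa p alpha g /\
       bergman_norm p alpha g <= K * bergman_norm p alpha f) /\
  (* sharpness *)
  (exists f : CC R -> CC R,
     in_Apa p alpha f /\ (exists z, z \in disk /\ f z != 0) /\
     (forall k : nat, (k < N)%N -> cderiv k f a = 0) /\
     exists g : CC R -> CC R,
       is_div_ext a N f g /\ in_Apa p alpha g /\
       bergman_norm p alpha g = K * bergman_norm p alpha f) /\
  (* the particular case A^p = A^p_0, N = 1 *)
  (forall f : CC R -> CC R,
     in_Apa p 0 f -> f a = 0 ->
     exists g : CC R -> CC R,
       is_div_ext a 1 f g /\ in_Apa p 0 g /\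
       bergman_norm p 0 g <= ((p + 2) / 2) `^ (p^-1) * bergman_norm p 0 f).
Proof.
move=> p0 al1; rewrite inE => a1 N0 K; split; last split.
- exact: bergman_division.
- exact: bergman_division_sharp.
- move=> f fA fa; rewrite -bound1//; apply: bergman_division => //.
  by case.
Qed.
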